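(* Let $\gamma$ be radial, i.e. $\gamma(x,x')=\hat\gamma(|x-x'|)$, and let (H1), (H2), (H3) hold. Then $a(\cdot,\cdot;\delta)$ is differentiable with respect to $\delta$, i.e. there exists a bounded bilinear form $a'_\delta(\cdot,\cdot;\delta)$ such that $a'_\delta(u,v;\delta)=\frac{d}{d\delta}a(u,v;\delta)$ for all $u,v\in V$ and $\delta\in[\delta_{\min},\delta_{\max}]$. In particular, $$a'_\delta(u,v;\delta)=\int_{\mathbb{R}^n}\int_{\partial B_\delta(x)}(u(x)-u(x'))(v(x)-v(x'))\gamma(x,x')\,dx'\,dx,$$ where $\partial B_\delta(x)=\{x'\in\mathbb{R}^n: |x-x'|=\delta\}$ and the inner integral is understood as a surface integral, together with the estimate $$|a'_\delta(u,v;\delta)|\le C_{a'}\|u\|_{L^2(\Omega)}\|v\|_{L^2(\Omega)},\qquad C_{a'}=4\omega_{n-1}\delta^{n-1}\hat\gamma(\delta).$$ Moreover, if $u\in H^1_0(\Omega)$ and if $\hat\gamma$ is Lipschitz continuous with respect to $\delta$, i.e. $|\hat\gamma(\delta_1)-\hat\gamma(\delta_2)|\le L_\gamma|\delta_1-\delta_2|$ for all $\delta_1,\delta_2\in[\delta_{\min},\delta_{\max}]$, with $L_\gamma>0$, then $a'_\delta(\cdot,\cdot;\delta)$ is also Lipschitz continuous and $$|a'_\delta(u,v;\delta_1)-a'_\delta(u,v;\delta_2)|\le L_{a'}\|u\|_{H^1_0(\Omega)}\|v\|_{L^2(\Omega)}|\delta_1-\delta_2|,$$ with $L_{a'}=2\omega_{n-1}\delta_2^{n-1}\Big(2C_P\big((n-1)\delta_2^{-1}\hat\gamma(\delta_1)+L_\gamma\big)+\hat\gamma(\delta_2)\Big)$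 for $\delta_1<\delta_2$.
   Context: $\Omega\subset\mathbb{R}^n$ is a bounded domain with Lipschitz boundary and $0<\delta_{\min}<\delta_{\max}<\infty$. $\gamma:\mathbb{R}^n\times\mathbb{R}^n\to[0,\infty)$ is a symmetric kernel; for $\delta\in[\delta_{\min},\delta_{\max}]$ the truncated kernel is $\gamma(x,x';\delta)=\gamma(x,x')$ if $|x-x'|\le\delta$ and $0$ otherwise. (H1): $\gamma(x,x';\delta)\ge0$, it vanishes for $|x-x'|>\delta$, and there is $\gamma_0>0$ with $\gamma(x,x';\delta)\ge\gamma_0$ whenever $|x-x'|\le\delta_{\min}/2$. (H2): there is $\hat\gamma:\mathbb{R}^+\to\mathbb{R}^+$ with $\gamma(x,x';\delta)\le\hat\gamma(|x-x'|)$ and $\xi^{n-1}\hat\gamma(\xi)\in L^1((\delta_{\min},\delta_{\max}))$. (H3): there is $C_\gamma>0$ with $\xi^{n-1}\hat\gamma(\xi)\le C_\gamma$ for $\xi\in(\delta_{\min},\delta_{\max})$. $\omega_{n-1}=2\pi^{n/2}/\Gamma(n/2)$ is the surface measure of the unit sphere in $\mathbb{R}^n$. Functions on $\Omega$ are extended by zero to $\mathbb{R}^n$. Let $S_\delta=\{(x,x')\in\mathbb{R}^{2n}:|x-x'|\le\delta\}$, $$a(u,v;\delta)=\int_{S_\delta}(u(x)-u(x'))(v(x)-v(x'))\gamma(x,x')\,d(x',x),\qquad \|u\|_{V_\delta}^2=a(u,u;\delta),$$ and $V_\delta=\{v\in L^2(\mathbb{R}^n): v=0 \text{ a.e. outside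 }\Omega,\ \|v\|_{V_\delta}<\infty\}$. For a fixed reference value $\delta^\star\in[\delta_{\min},\delta_{\max}]$ put $V=V_{\delta^\star}$, $\|\cdot\|_V=\|\cdot\|_{V_{\delta^\star}}$ (all $V_\delta$, $\delta\in[\delta_{\min},\delta_{\max}]$, coincide as sets with equivalent norms). Standing assumption (Poincaré): $\|v\|_{L^2(\Omega)}\le C_P\|v\|_{V_\delta}$ for all $v\in V_\delta$, with $C_P>0$ independent of $\delta\in[\delta_{\min},\delta_{\max}]$. The constant $C_P$ is also used as Poincaré constant in $\|v\|_{L^2(\Omega)}\le C_P\|v\|_{H^1_0(\Omega)}$ for $v\in H^1_0(\Omega)$, where $\|v\|_{H^1_0(\Omega)}=\|\nabla v\|_{L^2(\Omega)}$.
   Formalization: The identity a'_δ = da/dδ is proved at every δ where γ̂ is continuous on [δ_min,δ_max], and for almost every δ without continuity; for all δ it fails when γ̂ has a jump. Derivatives at the endpoints are one-sided, and γ is assumed Borel measurable. *)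

(* Defs.v *)
From HB Require Import structures.
From mathcomp Require Import all_boot all_order all_algebra.
From mathcomp Require Import all_classical all_reals all_analysis.
From mathcomp Require Import measurable_realfun.

Set Implicit Arguments.
Unset Strict Implicit.
Unset Printing Implicit Defensive.
Import Order.TTheory GRing.Theory Num.Theory.
Import numFieldNormedType.Exports.
Local Open Scope classical_set_scope.
Local Open Scope ring_scope.

Definition rV_display : measure_display.
Proof. exact: default_measure_display. Qed.

Section rV_measurable.
Context {R : realType} {n : nat}.

Definition rV_coord (i : 'I_n) (x : 'rV[R]_n) : measurableTypeR R := x ord0 i.

Let rV_set0 : g_sigma_preimage rV_coord set0.
Proof. exact: sigma_algebra0. Qed.

Let rV_setC A : g_sigma_preimage rV_coord A -> g_sigma_preimage rV_coord (~` A).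
Proof. exact: sigma_algebraC. Qed.

Let rV_bigcup (F : (set 'rV[R]_n)^nat) :
  (forall i, g_sigma_preimage rV_coord (F i)) ->
  g_sigma_preimage rV_coord (\bigcup_i (F i)).
Proof. exact: sigma_algebra_bigcup. Qed.

(* Borel sigma-algebra of R^n, generated by the coordinate functions. *)
HB.instance Definition _ := @isMeasurable.Build rV_display
  'rV[R]_n (g_sigma_preimage rV_coord) rV_set0 rV_setC rV_bigcup.

Lemma measurable_rV_coord (i : 'I_n) :
  measurable_fun [set: 'rV[R]_n] (fun x => x ord0 i : R).
Proof.
move=> _ Y mY; rewrite setTI; apply: sub_sigma_algebra => /=.
rewrite -bigcup_seq/=; exists i => /=; first by rewrite mem_index_enum.
by exists Y => //; rewrite setTI.
Qed.

Lemma measurable_fun_rVP d (T : measurableType d) (f : T -> 'rV[R]_n) :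
  (forall i, measurable_fun [set: T] (fun t => f t ord0 i : R)) ->
  measurable_fun [set: T] f.
Proof.
move=> mf.
have mpre : g_sigma_preimage (fun i => rV_coord i \o f) `<=` measurable.
  apply: smallest_sub; first exact: sigma_algebra_measurable.
  move=> A; rewrite -bigcup_seq/= => -[i _] [B mB <-].
  exact: (mf i measurableT B mB).
move=> _ A mA; apply: mpre; rewrite g_sigma_preimage_comp.
by exists A.
Qed.

End rV_measurable.

(* [pushforward m f], carrying the measurability of [f]. *)
Definition image_measure d1 d2 (T1 : measurableType d1)
    (T2 : measurableType d2) (R : realType)
    (m : {measure set T1 -> \bar R}) (f : T1 -> T2)
    (_ : measurable_fun [set: T1] f) : set T2 -> \bar R :=
  pushforward m f.

Section image_measure.
Context d1 d2 (T1 : measurableType d1) (T2 : measurableType d2) (R : realType).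
Variables (m : {measure set T1 -> \bar R}) (f : T1 -> T2).
Variable mf : measurable_fun [set: T1] f.

Let im0 : image_measure m mf set0 = 0%E.
Proof. by rewrite /image_measure /pushforward preimage_set0 measure0. Qed.

Let im_ge0 A : (0 <= image_measure m mf A)%E.
Proof. exact: measure_ge0. Qed.

Let im_sigma_additive : semi_sigma_additive (image_measure m mf).
Proof.
move=> F mF tF mUF; rewrite /image_measure /pushforward preimage_bigcup.
apply: measure_semi_sigma_additive.
- by move=> k; rewrite -[X in measurable X]setTI; exact: mf.
- apply/trivIsetP => /= i j _ _ ij; rewrite -preimage_setI.
  by move/trivIsetP : tF => /(_ _ _ _ _ ij) ->//; rewrite preimage_set0.
- by rewrite -preimage_bigcup -[X in measurable X]setTI; exact: mf.
Qed.

HB.instance Definition _ := isMeasure.Build _ _ _ (image_measure m mf)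
  im0 im_ge0 im_sigma_additive.

End image_measure.

Section lebesgue_rV.
Context {R : realType}.

Definition rV_cons n (p : measurableTypeR R * 'rV[R]_n) : 'rV[R]_n.+1 :=
  \row_i (if unlift ord0 i is Some j then p.2 ord0 j else p.1).

Definition rV_uncons n (x : 'rV[R]_n.+1) : measurableTypeR R * 'rV[R]_n :=
  (x ord0 ord0, \row_j x ord0 (lift ord0 j)).

Lemma rV_consK n : cancel (@rV_cons n) (@rV_uncons n).
Proof.
move=> [a y]; rewrite /rV_uncons /rV_cons mxE unlift_none /=; congr pair.
by apply/rowP => j; rewrite !mxE liftK.
Qed.

Lemma rV_unconsK n : cancel (@rV_uncons n) (@rV_cons n).
Proof.
by move=> x; apply/rowP => i; rewrite mxE; case: unliftP => [j ->|->]//=;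
  rewrite mxE.
Qed.

Lemma measurable_rV_cons n : measurable_fun setT (@rV_cons n).
Proof.
apply: measurable_fun_rVP => i; rewrite /rV_cons.
under eq_fun do rewrite mxE.
case: (unlift ord0 i) => [j|]; last exact: measurable_fst.
exact: (measurableT_comp (measurable_rV_coord j) measurable_snd).
Qed.

Lemma measurable_rV_uncons n : measurable_fun setT (@rV_uncons n).
Proof.
apply/measurable_fun_pairP; split; first exact: measurable_rV_coord.
apply: measurable_fun_rVP => j /=.
by under eq_fun do rewrite mxE; exact: measurable_rV_coord.
Qed.

Section step.
Variables (n : nat) (m : {sigma_finite_measure set 'rV[R]_n -> \bar R}).

Definition lebesgue_rVS : set 'rV[R]_n.+1 -> \bar R :=
  image_measure ((@lebesgue_measure R) \x m)%E (@measurable_rV_cons n).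

HB.instance Definition _ := Measure.on lebesgue_rVS.

Let lebesgue_rVS_sigma_finite : sigma_finite setT lebesgue_rVS.
Proof.
pose l : {sigma_finite_measure set (measurableTypeR R) -> \bar R} :=
  @lebesgue_measure R.
have /sigma_finiteP[F [TF ndF Foo]] := sigma_finiteT l.
have /sigma_finiteP[G [TG ndG Goo]] := sigma_finiteT m.
exists (fun k => @rV_uncons n @^-1` (F k `*` G k)).
  apply/esym/seteqP; split=> // x _.
  have [k _ Fk] : (\bigcup_k F k) (rV_uncons x).1 by rewrite -TF.
  have [j _ Gj] : (\bigcup_k G k) (rV_uncons x).2 by rewrite -TG.
  exists (maxn k j) => //; split.
  - by move: Fk; exact/subsetPset/ndF/leq_maxl.
  - by move: Gj; exact/subsetPset/ndG/leq_maxr.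
move=> k; have [mF Fk] := Foo k; have [mG Gk] := Goo k; split.
  rewrite -[X in measurable X]setTI; apply: measurable_rV_uncons => //.
  exact: measurableX.
rewrite /lebesgue_rVS /image_measure /pushforward -comp_preimage.
rewrite (_ : _ \o _ = id) ?preimage_id; last first.
  by apply/funext => p /=; rewrite rV_consK.
by rewrite [ltLHS]product_measure1E// lte_mul_pinfty// ge0_fin_numE.
Qed.

HB.instance Definition _ := Measure_isSigmaFinite.Build _ _ _
  lebesgue_rVS lebesgue_rVS_sigma_finite.

End step.

(* Lebesgue measure on R^n: the n-fold product of the one-dimensional one. *)
Fixpoint lebesgue_rV (n : nat) : {sigma_finite_measure set 'rV[R]_n -> \bar R} :=
  match n with
  | 0 => \d_(0 : 'rV[R]_0)
  | k.+1 => lebesgue_rVS (lebesgue_rV k)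
  end.

End lebesgue_rV.
Arguments lebesgue_rV {R} n.

Section euclid.
Context {R : realType} {n : nat}.

Definition dotv (x y : 'rV[R]_n) : R := \sum_i x ord0 i * y ord0 i.

(* The library norm `|x| on 'rV[R]_n is the sup norm. *)
Definition enorm (x : 'rV[R]_n) : R := Num.sqrt (dotv x x).

Definition normalize (x : 'rV[R]_n) : 'rV[R]_n := (enorm x)^-1 *: x.

Definition sphere (x : 'rV[R]_n) (r : R) : set 'rV[R]_n :=
  [set x' | enorm (x - x') = r].

Definition punctured_unit_ball : set 'rV[R]_n := [set x | 0 < enorm x <= 1].

Lemma measurable_enorm : measurable_fun [set: 'rV[R]_n] enorm.
Proof.
have msqrt : measurable_fun [set: R] (@Num.sqrt R).
  by apply: continuous_measurable_fun; exact: sqrt_continuous.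
apply: (measurableT_comp msqrt); apply: measurable_sum => i.
by apply: measurable_funM; exact: measurable_rV_coord.
Qed.

Lemma measurable_normalize : measurable_fun [set: 'rV[R]_n] normalize.
Proof.
apply: measurable_fun_rVP => i; rewrite /normalize.
under eq_fun do rewrite mxE -powR_inv1 ?sqrtr_ge0//.
apply: measurable_funM; last exact: measurable_rV_coord.
apply: (@measurableT_comp _ _ _ _ _ _ (fun a : R => a `^ (-1))).
  exact: measurable_powR.
exact: measurable_enorm.
Qed.

Lemma measurable_punctured_unit_ball : measurable punctured_unit_ball.
Proof.
rewrite (_ : punctured_unit_ball = enorm @^-1` `]0, 1]%classic).
  by rewrite -[X in measurable X]setTI; apply: measurable_enorm.
by apply/seteqP; split=> x /=; rewrite in_itv.
Qed.

(* Surface measure of the unit sphere, characterised by polar coordinates: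
   sigma(A) = n * |{r s : 0 < r <= 1, s in A}|. *)
Definition unit_sphere_measure : {measure set 'rV[R]_n -> \bar R} :=
  mscale (n%:R : R)%:nng
    (image_measure
       (mrestr (lebesgue_rV n) measurable_punctured_unit_ball)
       measurable_normalize).

Lemma measurable_sphere_param (x : 'rV[R]_n) (r : R) :
  measurable_fun [set: 'rV[R]_n] (fun s => x + r *: s).
Proof.
apply: measurable_fun_rVP => i; under eq_fun do rewrite !mxE.
by apply: measurable_funD => //; apply: measurable_funM => //;
  exact: measurable_rV_coord.
Qed.

(* Surface measure of the sphere of centre x and radius r. *)
Definition sphere_measure (x : 'rV[R]_n) (r : R) :
    {measure set 'rV[R]_n -> \bar R} :=
  mscale (`|r| ^+ n.-1)%:nng
    (image_measure unit_sphere_measure (measurable_sphere_param x r)).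

End euclid.

Section special_constants.
Context {R : realType}.

Definition Gamma (s : R) : R :=
  \int[@lebesgue_measure R]_(t in `]0, +oo[) (t `^ (s - 1) * expR (- t)).

(* omega_{n-1} *)
Definition sphere_area (n : nat) : R :=
  2 * (pi `^ (n%:R / 2)) / Gamma (n%:R / 2).

End special_constants.

Section domains.
Context {R : realType} {n : nat}.
Implicit Types (Omega : set 'rV[R]_n) (u : 'rV[R]_n -> R).

(* Near each boundary point, Omega is the strict epigraph, in the direction of
   a unit vector e, of a Lipschitz function on the hyperplane orthogonal to e. *)
Definition lipschitz_boundary Omega : Prop :=
  forall p, (closure Omega `\` interior Omega) p ->
  exists (e : 'rV[R]_n) (phi : 'rV[R]_n -> R) (L r : R),
    [/\ enorm e = 1, 0 < r,
        forall x y, `|phi x - phi y| <= L * enorm (x - y) &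
        forall x, enorm (x - p) < r ->
          (Omega x <-> phi (x - dotv x e *: e) < dotv x e)].

Definition bounded_lipschitz_domain Omega : Prop :=
  [/\ Omega !=set0, open Omega, connected Omega, bounded_set Omega &
      lipschitz_boundary Omega].

(* Square-integrable functions on Omega, extended by zero to R^n. *)
Definition L2_zero Omega u : Prop :=
  u \in Lfun (lebesgue_rV n) 2%:E /\
  {ae lebesgue_rV n, forall x, ~ Omega x -> u x = 0}.

Definition L2norm Omega u : R :=
  fine ('N[lebesgue_rV n]_2%:E [EFin \o (u \_ Omega)])%E.

Definition partial (i : 'I_n) (f : 'rV[R]_n -> R) : 'rV[R]_n -> R :=
  fun x => 'D_(delta_mx ord0 i) f x.

Definition smooth (f : 'rV[R]_n -> R) : Prop :=
  forall s : seq 'I_n,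
    let g := foldr partial f s in
    continuous g /\ forall i x, derivable g x (delta_mx ord0 i).

Definition test_function Omega (f : 'rV[R]_n -> R) : Prop :=
  smooth f /\
  exists K : set 'rV[R]_n,
    [/\ compact K, K `<=` Omega & forall x, ~ K x -> f x = 0].

Definition is_weak_gradient Omega u (g : 'rV[R]_n -> 'rV[R]_n) : Prop :=
  forall i : 'I_n,
    ((fun x => g x ord0 i) \_ Omega) \in Lfun (lebesgue_rV n) 2%:E /\
    forall f, test_function Omega f ->
      \int[lebesgue_rV n]_(x in Omega) (u x * partial i f x) =
      - \int[lebesgue_rV n]_(x in Omega) (g x ord0 i * f x).

(* The weak gradient (unique up to null sets) when there is one. *)
Definition weak_gradient Omega u : 'rV[R]_n -> 'rV[R]_n :=
  xget (fun _ => 0) [set g | is_weak_gradient Omega u g].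

(* H^1_0(Omega): the H^1-closure of the test functions. *)
Definition H10 Omega u : Prop :=
  [/\ L2_zero Omega u,
      is_weak_gradient Omega u (weak_gradient Omega u) &
      exists f : nat -> 'rV[R]_n -> R,
        [/\ forall k, test_function Omega (f k),
            L2norm Omega (fun x => f k x - u x) @[k --> \oo] --> 0 &
            forall i, L2norm Omega (fun x =>
              partial i (f k) x - weak_gradient Omega u x ord0 i)
              @[k --> \oo] --> 0]].

Definition H10norm Omega u : R :=
  L2norm Omega (fun x => enorm (weak_gradient Omega u x)).

End domains.

Section kernels.
Context {R : realType} {n : nat}.
Implicit Types (gamma : 'rV[R]_n -> 'rV[R]_n -> R) (ghat : R -> R).

Definition truncated gamma (delta : R) : 'rV[R]_n -> 'rV[R]_n -> R :=
  fun x x' => if enorm (x - x') <= delta then gamma x x' else 0.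

Definition kernel_H1 gamma (dmin dmax : R) : Prop :=
  exists2 gamma0 : R, 0 < gamma0 &
  forall delta, delta \in `[dmin, dmax] -> forall x x',
    [/\ 0 <= truncated gamma delta x x',
        delta < enorm (x - x') -> truncated gamma delta x x' = 0 &
        enorm (x - x') <= dmin / 2 -> gamma0 <= truncated gamma delta x x'].

(* [ghat] is a parameter because the radial profile of the kernel is required
   to be this majorant. *)
Definition kernel_H2 gamma ghat (dmin dmax : R) : Prop :=
  [/\ forall xi, 0 <= xi -> 0 <= ghat xi,
      forall delta, delta \in `[dmin, dmax] -> forall x x',
        truncated gamma delta x x' <= ghat (enorm (x - x')) &
      (@lebesgue_measure R).-integrable `]dmin, dmax[
        (fun xi => (xi ^+ n.-1 * ghat xi)%:E)].

Definition kernel_H3 ghat (dmin dmax : R) : Prop :=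
  exists2 Cgamma : R, 0 < Cgamma &
  forall xi, xi \in `]dmin, dmax[ -> xi ^+ n.-1 * ghat xi <= Cgamma.

Definition S_set (delta : R) : set ('rV[R]_n * 'rV[R]_n) :=
  [set p | enorm (p.1 - p.2) <= delta].

Definition aform gamma (delta : R) (u v : 'rV[R]_n -> R) : R :=
  \int[(lebesgue_rV n \x lebesgue_rV n)%E]_(p in S_set delta)
    ((u p.1 - u p.2) * (v p.1 - v p.2) * gamma p.1 p.2).

Definition Vnorm gamma (delta : R) (u : 'rV[R]_n -> R) : R :=
  Num.sqrt (aform gamma delta u u).

(* Finiteness of the norm is expressed on the extended-real integral, since
   [aform] is 0 by convention when that integral diverges. *)
Definition Vspace (Omega : set 'rV[R]_n) gamma (delta : R)
    (u : 'rV[R]_n -> R) : Prop :=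
  L2_zero Omega u /\
  (\int[(lebesgue_rV n \x lebesgue_rV n)%E]_(p in S_set delta)
     ((u p.1 - u p.2) * (u p.1 - u p.2) * gamma p.1 p.2)%:E < +oo)%E.

End kernels.
Arguments kernel_H3 {R} n ghat dmin dmax.

Section calculus.
Context {R : realType}.

Definition bounded_bilinear_on (T : Type) (V : (T -> R) -> Prop)
    (nrm : (T -> R) -> R) (b : (T -> R) -> (T -> R) -> R) : Prop :=
  [/\ forall (c : R) u w v, V u -> V w -> V v ->
        b (fun x => c * u x + w x) v = c * b u v + b w v,
      forall (c : R) u v w, V u -> V v -> V w ->
        b u (fun x => c * v x + w x) = c * b u v + b u w &
      exists C : R, forall u v, V u -> V v -> `|b u v| <= C * nrm u * nrm v].

(* l is the derivative at d of f as a function on the interval [a, b]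
   (one-sided at the endpoints). *)
Definition has_derivative_within (a b : R) (f : R -> R) (d l : R) : Prop :=
  (f h - f d) / (h - d) @[h --> within `[a, b]%classic (d^')] --> l.

Definition continuous_within (a b : R) (f : R -> R) (d : R) : Prop :=
  f h @[h --> within `[a, b]%classic (nbhs d)] --> f d.

End calculus.

(* Main.v *)
(** By polar coordinates, for [0 < d1 <= d2],
      a(u,v;d2) - a(u,v;d1) = \int_{d1}^{d2} r^{n-1} ghat(r) G(r) dr,
    where G(r) is the integral over unit vectors s of H(r s) and
    H(z) = \int (u(x) - u(x-z)) (v(x) - v(x-z)) dx.  Translations being continuous
    in L^2, H and G are continuous, so a(u,v;.) is differentiable with derivative
    delta^{n-1} ghat(delta) G(delta) wherever the primitive of r^{n-1} ghat(r) is
    differentiable in the expected way: at the continuity points of ghat, and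
    almost everywhere by Lebesgue's theorem.  Bounding |H| by 4 ||u|| ||v|| gives
    the estimate of a'.  For the Lipschitz bound, expand
    H(z) = 2<u,v> - <u(.-z) + u(.+z), v> and use ||u(.+h) - u|| <= |h| ||grad u||,
    which holds for test functions and passes to the limit in H^1_0. *)

Require Import Defs.
From HB Require Import structures.
From mathcomp Require Import all_boot all_order all_algebra.
From mathcomp Require Import all_classical all_reals all_analysis.
From mathcomp Require Import measurable_realfun.
From mathcomp Require Import ring lra.

Set Implicit Arguments.
Unset Strict Implicit.
Unset Printing Implicit Defensive.
Import Order.TTheory GRing.Theory Num.Theory.
Import numFieldNormedType.Exports.
Local Open Scope classical_set_scope.
Local Open Scope ring_scope.

(** * Integration under affine maps *)

(** The kernel enters an increment only through the scalar weight r^(n-1) ghat(r), the functions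
    only through the continuous mean G. So the exceptional null set of radii depends on [ghat] alone
    and serves all [u], [v] at once. Altering [ghat] at one radius alters the proposed derivative
    but not the form; hence the derivative is claimed at continuity points of [ghat] and otherwise
    almost everywhere. The surface measure is a normalised cone volume. Polar coordinates therefore
    reduce to Tonelli and dilations, and the total mass [sphere_area] comes from evaluating the
    Gaussian integral both as a product and radially. Since [u] and [v] are merely square
    integrable, H has a modulus of continuity but no rate. On the annulus between two horizons H(z)
    is replaced by H(delta z / |z|); the error is at most that modulus times the mass of the weight,
    so after division by the width it vanishes as long as the means of the weight stay bounded. The
    4 in the estimate of a' is a factor 2 per difference; the 2 in the Lipschitz constant counts the
    two translates of [u] in the expanded H. *)

Section real_valued_integrals.
Context d (T : measurableType d) (R : realType) (m : {measure set T -> \bar R}).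
Local Open Scope ereal_scope.

Lemma integral_mkindic (D : set T) (f : T -> R) :
  \int[m]_(x in D) (f x)%:E = \int[m]_x (\1_D x * f x)%:E.
Proof.
rewrite integral_mkcond; apply: eq_integral => x _; rewrite patchE indicE.
by case: ifP => _; rewrite (mul1r, mul0r).
Qed.

Lemma EFinZl_ge0_integral (k : R) (f : T -> R) :
  measurable_fun setT f -> (forall x, 0 <= f x)%R -> (0 <= k)%R ->
  k%:E * \int[m]_x (f x)%:E = \int[m]_x (k * f x)%:E.
Proof.
move=> mf f0 k0; rewrite -ge0_integralZl//; first exact/measurable_EFinP.
by move=> x _; rewrite lee_fin.
Qed.

Lemma EFinD_ge0_integral (f g : T -> R) :
  measurable_fun setT f -> measurable_fun setT g ->
  (forall x, 0 <= f x)%R -> (forall x, 0 <= g x)%R ->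
  \int[m]_x (f x + g x)%:E = \int[m]_x (f x)%:E + \int[m]_x (g x)%:E.
Proof.
move=> mf mg f0 g0; rewrite -ge0_integralD//.
- by move=> x _; rewrite lee_fin.
- exact/measurable_EFinP.
- by move=> x _; rewrite lee_fin.
- exact/measurable_EFinP.
Qed.

Lemma le_ge0_integral_EFin (f g : T -> R) :
  measurable_fun setT f -> measurable_fun setT g ->
  (forall x, 0 <= f x)%R -> (forall x, f x <= g x)%R ->
  \int[m]_x (f x)%:E <= \int[m]_x (g x)%:E.
Proof.
move=> mf mg f0 fg; apply: ge0_le_integral => //.
- by move=> x _; rewrite lee_fin.
- exact/measurable_EFinP.
- exact/measurable_EFinP.
- by move=> x _; rewrite lee_fin.
Qed.

End real_valued_integrals.

Section image_integral.
Context d1 d2 (T1 : measurableType d1) (T2 : measurableType d2) (R : realType).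
Variables (m : {measure set T1 -> \bar R}) (f : T1 -> T2).
Variable mf : measurable_fun [set: T1] f.
Local Open Scope ereal_scope.

Lemma ge0_integral_image (g : T2 -> \bar R) :
  measurable_fun setT g -> (forall y, 0 <= g y) ->
  \int[image_measure m mf]_y g y = \int[m]_x g (f x).
Proof.
move=> mg g0; transitivity (\int[pushforward m f]_y g y).
  exact: eq_measure_integral.
by rewrite ge0_integral_pushforward//.
Qed.

Lemma integral_image (g : T2 -> \bar R) : measurable_fun setT g ->
  \int[image_measure m mf]_y g y = \int[m]_x g (f x).
Proof.
move=> mg; rewrite [in LHS]integralE [in RHS]integralE.
rewrite !ge0_integral_image//; first by congr (_ - _); apply: eq_integral => x _; rewrite !(funeposE, funenegE).
- exact: measurable_funeneg.
- exact: measurable_funepos.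
Qed.

End image_integral.

Section affine1.
Context {R : realType}.
Notation mu := (@lebesgue_measure R).

Lemma measurable_affine1 (c h : R) :
  measurable_fun [set: measurableTypeR R]
    ((fun a => c * a + h) : measurableTypeR R -> measurableTypeR R).
Proof. by apply: measurable_funD => //; exact: measurable_funM. Qed.

(** The right-hand side is a measure in [A] that gives every half-open interval its length, so
    uniqueness of Lebesgue measure applies. *)
Lemma lebesgue_affine1 (c h : R) (c0 : 0 < c) (A : set (measurableTypeR R)) :
  measurable A ->
  mu A = (c%:E * mu ((fun a => c * a + h)%R @^-1` A))%E.
Proof.
move=> mA.
pose c' : {nonneg R} := NngNum (ltW c0).
pose m' : {measure set (measurableTypeR R) -> \bar R} :=
  mscale c' (image_measure mu (measurable_affine1 c h)).
rewrite (_ : (_ * _)%E = m' A)//.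
apply: lebesgue_measure_unique => // X [[a b] _ <-] /=.
rewrite /m' /mscale/= /image_measure /pushforward /=.
rewrite (_ : _ @^-1` _ = `]((a - h) / c), ((b - h) / c)]%classic); last first.
  apply/seteqP; split => x /=; rewrite !in_itv/=.
    by rewrite ltr_pdivrMr// ler_pdivlMr// [x * c]mulrC ltrBlDr lerBrDr.
  by rewrite ltr_pdivrMr// ler_pdivlMr// [x * c]mulrC ltrBlDr lerBrDr.
rewrite !lebesgue_measure_itv/= !lte_fin ltr_pM2r ?invr_gt0// ltrD2r.
case: ifP => _; last by rewrite mule0.
by rewrite -!EFinB -EFinM; congr EFin; field; rewrite gt_eqF.
Qed.

Lemma ge0_integral_affine1 (c h : R) (f : R -> \bar R) : 0 < c ->
  measurable_fun [set: R] f -> (forall x, 0 <= f x)%E ->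
  (\int[mu]_x f x = c%:E * \int[mu]_x f (c * x + h)%R)%E.
Proof.
move=> c0 mf f0.
pose c' : {nonneg R} := NngNum (ltW c0).
pose m' : {measure set (measurableTypeR R) -> \bar R} :=
  mscale c' (image_measure mu (measurable_affine1 c h)).
transitivity (\int[m']_x f x)%E.
  by apply: eq_measure_integral => A mA _; exact: lebesgue_affine1.
by rewrite ge0_integral_mscale// ge0_integral_image.
Qed.

End affine1.

Section affine.
Context {R : realType}.
Local Open Scope ereal_scope.
Notation mu := (@lebesgue_measure R).

Lemma measurable_affine n (c : R) (h : 'rV[R]_n) :
  measurable_fun [set: 'rV[R]_n] (fun x => c *: x + h)%R.
Proof.
apply: measurable_fun_rVP => i; under eq_fun do rewrite !mxE.
by apply: measurable_funD => //; apply: measurable_funM => //;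
  exact: measurable_rV_coord.
Qed.

Lemma measurable_cons2 n (a : R) :
  measurable_fun [set: 'rV[R]_n] (fun y => rV_cons (a, y)).
Proof.
exact: (measurableT_comp (@measurable_rV_cons R n) (measurable_pair1 a)).
Qed.

Lemma ge0_integral_rVS n (f : 'rV[R]_n.+1 -> \bar R) :
  measurable_fun setT f -> (forall x, 0 <= f x) ->
  \int[lebesgue_rV n.+1]_x f x =
  \int[mu]_a \int[lebesgue_rV n]_y f (rV_cons (a, y)).
Proof.
move=> mf f0.
transitivity (\int[lebesgue_rVS (lebesgue_rV n)]_x f x); first by [].
rewrite [LHS]ge0_integral_image//.
rewrite (@fubini_tonelli1 _ _ _ _ R mu (lebesgue_rV n) (fun p => f (rV_cons p)))//.
exact: (measurableT_comp mf (@measurable_rV_cons R n)).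
Qed.

Lemma measurable_integral_rVS n (f : 'rV[R]_n.+1 -> \bar R) :
  measurable_fun setT f -> (forall x, 0 <= f x) ->
  measurable_fun [set: R] (fun a => \int[lebesgue_rV n]_y f (rV_cons (a, y))).
Proof.
move=> mf f0.
apply: (@measurable_fun_fubini_tonelli_F _ _ (measurableTypeR R) _ R (lebesgue_rV n) (fun p => f (rV_cons p))) => //.
exact: (measurableT_comp mf (@measurable_rV_cons R n)).
Qed.

(** Induction on the dimension: Tonelli splits off the first coordinate, and each coordinate
    contributes one factor [c]. *)
Lemma ge0_integral_affine n (c : R) (h : 'rV[R]_n) (f : 'rV[R]_n -> \bar R) :
  (0 < c)%R -> measurable_fun setT f -> (forall x, 0 <= f x) ->
  \int[lebesgue_rV n]_x f x =
  (c ^+ n)%:E * \int[lebesgue_rV n]_x f (c *: x + h)%R.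
Proof.
move=> c0; elim: n h f => [|n IH] h f mf f0.
  by rewrite expr0 mul1e; apply: eq_integral => x _; congr f;
    apply/rowP => -[].
have mfa : measurable_fun setT (fun x : 'rV[R]_n.+1 => f (c *: x + h)%R).
  by apply: measurableT_comp => //; exact: measurable_affine.
rewrite !ge0_integral_rVS//.
rewrite (ge0_integral_affine1 (h ord0 ord0) c0) => //; last 2 first.
  - exact: measurable_integral_rVS.
  - by move=> a; exact: integral_ge0.
rewrite exprS EFinM -muleA; congr (_ * _).
rewrite -ge0_integralZl//; last 3 first.
  - exact: (measurable_integral_rVS mfa).
  - by move=> a _; exact: integral_ge0.
  - by rewrite lee_fin exprn_ge0// ltW.
apply: eq_integral => a _.
rewrite (IH (\row_j h ord0 (lift ord0 j))%R)//; last first.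
  by apply: measurableT_comp => //; exact: measurable_cons2.
congr (_ * _); apply: eq_integral => y _; congr f.
by apply/rowP => i; rewrite !mxE; case: unliftP => [j ->|->] /=; rewrite ?mxE.
Qed.

Lemma ge0_integral_translation n (h : 'rV[R]_n) (f : 'rV[R]_n -> \bar R) :
  measurable_fun setT f -> (forall x, 0 <= f x) ->
  \int[lebesgue_rV n]_x f (x + h)%R = \int[lebesgue_rV n]_x f x.
Proof.
move=> mf f0; rewrite [RHS](ge0_integral_affine h ltr01)// expr1n mul1e.
by apply: eq_integral => x _; rewrite scale1r.
Qed.

Lemma ge0_integral_scale n (c : R) (f : 'rV[R]_n -> \bar R) :
  (0 < c)%R -> measurable_fun setT f -> (forall x, 0 <= f x) ->
  \int[lebesgue_rV n]_x f x = (c ^+ n)%:E * \int[lebesgue_rV n]_x f (c *: x)%R.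
Proof.
move=> c0 mf f0; rewrite (ge0_integral_affine 0 c0)//; congr (_ * _).
by apply: eq_integral => x _; rewrite addr0.
Qed.

End affine.

(** * The Euclidean norm and the unit sphere *)

Section enorm_theory.
Context {R : realType} {n : nat}.
Implicit Types (x y : 'rV[R]_n) (c : R).

Lemma dotv_ge0 x : 0 <= dotv x x.
Proof. by apply: sumr_ge0 => i _; rewrite -expr2 sqr_ge0. Qed.

Lemma enorm_ge0 x : 0 <= enorm x.
Proof. exact: sqrtr_ge0. Qed.

Lemma sqr_enorm x : enorm x ^+ 2 = dotv x x.
Proof. by rewrite sqr_sqrtr// dotv_ge0. Qed.

Lemma enormZ c x : enorm (c *: x) = `|c| * enorm x.
Proof.
rewrite /enorm (_ : dotv _ _ = c ^+ 2 * dotv x x).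
  by rewrite sqrtrM ?sqr_ge0// sqrtr_sqr.
by rewrite /dotv mulr_sumr; apply: eq_bigr => i _; rewrite !mxE; ring.
Qed.

Lemma enormN x : enorm (- x) = enorm x.
Proof. by rewrite -scaleN1r enormZ normrN1 mul1r. Qed.

Lemma coord_le_enorm x i : `|x ord0 i| <= enorm x.
Proof.
rewrite -sqrtr_sqr ler_sqrt ?dotv_ge0// /dotv (bigD1 i)//= -expr2 lerDl.
by apply: sumr_ge0 => j _; rewrite -expr2 sqr_ge0.
Qed.

Lemma enorm_eq0 x : enorm x = 0 -> x = 0.
Proof.
move=> x0; apply/rowP => i; rewrite mxE; apply/eqP; rewrite -normr_le0 -x0.
exact: coord_le_enorm.
Qed.

(** The topology of row vectors comes from the sup norm, the kernel from the Euclidean one; together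
    with [enorm_le_norm] this carries smallness and boundedness from one to the other. *)
Lemma norm_le_enorm x : `|x| <= enorm x.
Proof.
rewrite [`|x|]mx_normrE; apply: bigmax_le; first exact: enorm_ge0.
by move=> [i j] _ /=; rewrite ord1 coord_le_enorm.
Qed.

Lemma enorm_le_norm x : enorm x <= n%:R * `|x|.
Proof.
have le i : `|x ord0 i| <= `|x|.
  rewrite [leRHS]mx_normrE.
  exact: (@le_bigmax _ _ _ _ (fun ij : 'I_1 * 'I_n => `|x ij.1 ij.2|) (ord0, i)).
case: n x le => [x _|k x le].
  by rewrite mul0r /enorm /dotv big_ord0 sqrtr0.
rewrite -[leRHS]ger0_norm ?mulr_ge0// -sqrtr_sqr ler_sqrt ?sqr_ge0//.
rewrite exprMn -natrX (@le_trans _ _ (k.+1%:R * `|x| ^+ 2))//.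
  apply: (@le_trans _ _ (\sum_(i < k.+1) `|x| ^+ 2)).
    apply: ler_sum => i _; rewrite -expr2 -real_normK ?num_real//.
    by rewrite lerXn2r ?nnegrE.
  by rewrite sumr_const card_ord mulr_natl.
by rewrite ler_wpM2r ?sqr_ge0// ler_nat -mulnn leq_pmulr.
Qed.

Lemma enorm_normalize x : 0 < enorm x -> enorm (normalize x) = 1.
Proof. by move=> x0; rewrite enormZ gtr0_norm ?invr_gt0// mulVf// gt_eqF. Qed.

Lemma normalizeK x : 0 < enorm x -> enorm x *: normalize x = x.
Proof. by move=> x0; rewrite scalerA mulfV ?scale1r// gt_eqF. Qed.

Lemma dotv_lin a b x y :
  dotv (a *: x + b *: y) (a *: x + b *: y) =
  a ^+ 2 * dotv x x + 2 * a * b * dotv x y + b ^+ 2 * dotv y y.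
Proof.
rewrite /dotv !mulr_sumr -!big_split/=.
by apply: eq_bigr => i _; rewrite !mxE; ring.
Qed.

(** Cauchy-Schwarz without division: the squared length of [dotv y y *: x - dotv x y *: y] is
    [dotv y y] times the deficit. *)
Lemma dotv_le x y : `|dotv x y| <= enorm x * enorm y.
Proof.
rewrite -sqrtr_sqr -sqrtrM ?dotv_ge0// ler_sqrt; last first.
  by rewrite mulr_ge0// dotv_ge0.
have := dotv_ge0 y; rewrite le_eqVlt => /predU1P[y0|y0].
  have /enorm_eq0 -> : enorm y = 0 by rewrite /enorm -y0 sqrtr0.
  rewrite (_ : dotv x 0 = 0) ?expr0n/= ?mulr_ge0 ?dotv_ge0//.
  by rewrite /dotv big1// => i _; rewrite mxE mulr0.
rewrite -(ler_pM2l y0) -subr_ge0.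
have := dotv_ge0 (dotv y y *: x + (- dotv x y) *: y).
by rewrite dotv_lin; congr (0 <= _); ring.
Qed.

End enorm_theory.

Lemma measurable_scale_pair {R : realType} {n : nat} d (T : measurableType d)
    (a : T -> R) (g : T -> 'rV[R]_n) :
  measurable_fun setT a -> measurable_fun setT g ->
  measurable_fun setT (fun t => a t *: g t).
Proof.
move=> ma mg; apply: measurable_fun_rVP => i; under eq_fun do rewrite mxE.
by apply: measurable_funM => //;
  exact: measurableT_comp (measurable_rV_coord i) mg.
Qed.

Lemma measurable_add_pair {R : realType} {n : nat} d (T : measurableType d)
    (f g : T -> 'rV[R]_n) :
  measurable_fun setT f -> measurable_fun setT g ->
  measurable_fun setT (fun t => f t + g t).
Proof.
move=> mf mg; apply: measurable_fun_rVP => i; under eq_fun do rewrite mxE.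
by apply: measurable_funD => //;
  [exact: measurableT_comp (measurable_rV_coord i) mf
  |exact: measurableT_comp (measurable_rV_coord i) mg].
Qed.

(** * Gaussian integral, finite volume of balls, negligibility of the origin *)

Section null_origin.
Context {R : realType}.

Lemma measurable_enorm_itv n (i : interval R) :
  measurable [set x : 'rV[R]_n | enorm x \in i].
Proof.
rewrite (_ : [set _ | _] = enorm @^-1` [set` i])//.
by rewrite -[X in measurable X]setTI; apply: measurable_enorm.
Qed.

Local Open Scope ereal_scope.
Notation mu := (@lebesgue_measure R).

(** The Gaussian factorises over the coordinates. Its value serves twice: it bounds the volume of
    balls, and it fixes the total mass of the unit sphere. *)
Lemma integral_gauss n :
  \int[lebesgue_rV n]_x (expR (- dotv x x))%:E = (Num.sqrt pi ^+ n)%:E :> \bar R.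
Proof.
have mg k : measurable_fun setT (fun x : 'rV[R]_k => (expR (- dotv x x))%:E).
  apply/measurable_EFinP; apply: measurableT_comp => //.
  apply: measurable_funN; apply: measurable_sum => i.
  by apply: measurable_funM; exact: measurable_rV_coord.
elim: n => [|n IH].
  transitivity (\int[\d_(0%R : 'rV[R]_0)]_x (expR (- dotv x x))%:E); first by [].
  rewrite integral_dirac//=; last exact: mg.
  by rewrite diracE in_setT mul1e /dotv big_ord0 oppr0 expR0 expr0.
rewrite ge0_integral_rVS//.
transitivity (\int[mu]_a ((gauss_fun a)%:E * (Num.sqrt pi ^+ n)%:E) : \bar R).
  apply: eq_integral => a _; rewrite -IH -ge0_integralZl//; last 2 first.
    exact: mg.
    by rewrite lee_fin gauss_fun_ge0.
  apply: eq_integral => y _; rewrite -EFinM -expRD; congr (expR _)%:E.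
  rewrite /dotv big_ord_recl !mxE unlift_none/= opprD -expr2; congr (_ - _)%R.
  by apply: eq_bigr => i _; rewrite !mxE liftK.
rewrite ge0_integralZr//; last 2 first.
  - by apply/measurable_EFinP; exact: measurable_gauss_fun.
  - by move=> x _; rewrite lee_fin gauss_fun_ge0.
by rewrite integralT_gauss -EFinM exprS.
Qed.

(** On the ball, 1 is at most exp(c^2) exp(-|x|^2), whose integral is finite. *)
Lemma lebesgue_rV_ball_fin n (c : R) :
  lebesgue_rV n [set x : 'rV[R]_n | (enorm x <= c)%R] < +oo.
Proof.
have mB : measurable [set x : 'rV[R]_n | (enorm x <= c)%R].
  have := @measurable_enorm_itv n `]-oo, c]%R.
  by congr measurable; apply/seteqP; split => x /=; rewrite in_itv.
have mg : measurable_fun setT (fun x : 'rV[R]_n => expR (- dotv x x)).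
  apply: measurableT_comp => //.
  apply: measurable_funN; apply: measurable_sum => i.
  by apply: measurable_funM; exact: measurable_rV_coord.
rewrite -[X in X < _]mul1e -integral_cst//.
apply: (@le_lt_trans _ _
  ((expR (c ^+ 2))%:E * \int[lebesgue_rV n]_x (expR (- dotv x x))%:E)).
  rewrite -ge0_integralZl//; last by exact/measurable_EFinP.
  apply: (@le_trans _ _ (\int[lebesgue_rV n]_(x in
      [set x : 'rV[R]_n | (enorm x <= c)%R])
      ((expR (c ^+ 2))%:E * (expR (- dotv x x))%:E))).
    apply: ge0_le_integral => //.
    - apply: emeasurable_funM => //.
      exact/measurable_EFinP/measurable_funTS.
    - move=> x /= xc; rewrite -EFinM lee_fin -expRD -expR0 ler_expR.
      rewrite subr_ge0 -sqr_enorm; apply: lerXn2r => //; rewrite nnegrE.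
        exact: enorm_ge0.
      by rewrite (le_trans _ xc)// enorm_ge0.
  apply: ge0_subset_integral => //.
  by apply: emeasurable_funM => //; exact/measurable_EFinP.
by rewrite integral_gauss -EFinM ltry.
Qed.

(** Dilation by 2 fixes the origin but multiplies volume by 2^(n+1); a finite mass with this
    property is 0. In dimension 0 the measure is the Dirac mass at the origin, hence the
    successor. *)
Lemma ge0_integral_off_origin n (f : 'rV[R]_n.+1 -> R) :
  measurable_fun setT f -> (forall x, (0 <= f x)%R) ->
  \int[lebesgue_rV n.+1]_x (f x)%:E =
  \int[lebesgue_rV n.+1]_x (\1_[set x | (0 < enorm x)%R] x * f x)%:E.
Proof.
move=> mf f0.
have mE : measurable [set x : 'rV[R]_n.+1 | (0 < enorm x)%R].
  have := @measurable_enorm_itv n.+1 `]0%R, +oo[.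
  by congr measurable; apply/seteqP; split => x /=; rewrite in_itv/= andbT.
have E0 : ~` [set x : 'rV[R]_n.+1 | (0 < enorm x)%R] = [set 0%R].
  apply/seteqP; split => x /=.
    move/negP; rewrite -leNgt => x0; apply: enorm_eq0.
    by apply/eqP; rewrite eq_le x0 enorm_ge0.
  by move=> ->; rewrite -(scale0r (0%R : 'rV[R]_n.+1)) enormZ normr0 mul0r ltxx.
have m0 : measurable [set (0%R : 'rV[R]_n.+1)] by rewrite -E0; exact: measurableC.
have l0 : lebesgue_rV n.+1 [set (0%R : 'rV[R]_n.+1)] = 0.
  have fin : lebesgue_rV n.+1 [set (0%R : 'rV[R]_n.+1)] \is a fin_num.
    rewrite ge0_fin_numE//; apply: le_lt_trans (lebesgue_rV_ball_fin n.+1 0).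
    apply: le_measure; rewrite ?inE//.
      have := @measurable_enorm_itv n.+1 `]-oo, 0%R].
      by congr measurable; apply/seteqP; split => x /=; rewrite in_itv.
    move=> x /= ->.
    by rewrite -(scale0r (0%R : 'rV[R]_n.+1)) enormZ normr0 mul0r lexx.
  have m1 : measurable_fun setT (fun x : 'rV[R]_n.+1 => (\1_[set 0%R] x)%:E : \bar R).
    exact/measurable_EFinP/measurable_indic.
  have := @ge0_integral_scale R n.+1 2 _ (ltr0n _ 2) m1 (fun x => ltac:(by rewrite lee_fin)).
  have -> : (fun x : 'rV[R]_n.+1 => (\1_[set 0%R] (2 *: x)%R)%:E : \bar R) =
            (fun x => (\1_[set 0%R] x)%:E).
    apply/funext => x; congr EFin; rewrite !indicE; congr (nat_of_bool _)%:R.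
    apply/idP/idP; rewrite !inE/=; last by move=> ->; rewrite scaler0.
    by move/eqP; rewrite scaler_eq0 pnatr_eq0/= => /eqP.
  rewrite integral_indic// setIT.
  move=> h; have [r rE] : exists r,
      lebesgue_rV n.+1 [set (0%R : 'rV[R]_n.+1)] = r%:E.
    by exists (fine (lebesgue_rV n.+1 [set (0%R : 'rV[R]_n.+1)])); rewrite fineK.
  have {}h : r%:E = (2 ^+ n.+1)%:E * r%:E by rewrite -rE; exact: h.
  case: h => h; rewrite rE; congr EFin; apply/eqP.
  have : ((2 ^+ n.+1 - 1) * r = 0)%R by rewrite mulrBl mul1r [X in (_ - X)%R]h subrr.
  by move/eqP; rewrite mulf_eq0 subr_eq0 => /orP[] //;
    rewrite -natrX (eqr_nat _ _ 1%N) -(expn0 2) eqn_exp2l.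
apply: ae_eq_integral => //.
- exact/measurable_EFinP.
- by apply/measurable_EFinP/measurable_funM => //; exact: measurable_indic.
exists [set 0%R]; split => // x /= h; apply: contrapT => x0; apply: h => _.
rewrite indicE mem_set ?mul1r//=.
apply: contrapT => ex; apply: x0.
have : (~` [set x : 'rV[R]_n.+1 | (0 < enorm x)%R]) x by [].
by rewrite E0.
Qed.

End null_origin.

Lemma ge0_integral_mrestr d (T : measurableType d) (R : realType)
    (m : {measure set T -> \bar R}) (D : set T) (mD : measurable D)
    (f : T -> \bar R) : measurable_fun setT f -> (forall x, 0 <= f x)%E ->
  (\int[mrestr m mD]_x f x = \int[m]_(x in D) f x)%E.
Proof.
move=> mf f0; rewrite [LHS](ge0_negligible_integral (measurableC mD))//.
  rewrite setTD setCK; apply: eq_measure_integral => A mA AD.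
  by rewrite /= /mrestr (setIidl AD).
by rewrite /= /mrestr setICl measure0.
Qed.

Section sphere.
Context {R : realType} (n : nat).
Local Open Scope ereal_scope.

(* [unit_sphere_measure], seen as a finite measure *)
Definition sph : set 'rV[R]_n -> \bar R := unit_sphere_measure.

HB.instance Definition _ := Measure.on sph.

Lemma sphE (A : set 'rV[R]_n) :
  sph A = n%:R%:E * lebesgue_rV n (normalize @^-1` A `&` punctured_unit_ball).
Proof. by []. Qed.

Lemma sph_fin : fin_num_fun sph.
Proof.
apply: lty_fin_num_fun.
rewrite -[X in X < _]/(sph setT) sphE preimage_setT setTI lte_mul_pinfty//.
apply: le_lt_trans (@lebesgue_rV_ball_fin R n 1).
apply: le_measure; rewrite ?inE//.
- exact: measurable_punctured_unit_ball.
- have := @measurable_enorm_itv R n `]-oo, 1%R].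
  by congr measurable; apply/seteqP; split => x /=; rewrite in_itv.
- by move=> x /= /andP[].
Qed.

HB.instance Definition _ := Measure_isFinite.Build _ _ _ sph sph_fin.

Notation B := (@punctured_unit_ball R n).

Lemma integral_sph (f : 'rV[R]_n -> \bar R) :
  \int[unit_sphere_measure]_s f s = \int[sph]_s f s.
Proof. exact: eq_measure_integral. Qed.

Lemma ge0_integral_sph (f : 'rV[R]_n -> \bar R) :
  measurable_fun setT f -> (forall x, 0 <= f x) ->
  \int[sph]_s f s =
  n%:R%:E * \int[lebesgue_rV n]_(y in B) f (normalize y).
Proof.
move=> mf f0; rewrite -integral_sph ge0_integral_mscale//= ge0_integral_image//=.
rewrite ge0_integral_mrestr//.
exact: measurableT_comp mf measurable_normalize.
Qed.

(** The measure lives on the whole space, but [normalize] sends the punctured ball into the unit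
    vectors, so the preimage of everything else is empty. *)
Lemma sph_enorm1 :
  sph [set s | enorm s <> 1%R] = 0.
Proof.
rewrite sphE (_ : _ `&` _ = set0) ?measure0 ?mule0//.
apply/seteqP; split => // x [/= + /andP[x0 _]].
by rewrite enorm_normalize.
Qed.

End sphere.

(** * Polar coordinates *)

Section polar.
Context {R : realType} (m : nat).
Local Notation n := m.+1.
Notation mu := (@lebesgue_measure R).
Notation la := (@lebesgue_rV R n).
Notation B := (@punctured_unit_ball R n).

(* [t^-(n+1)], written so as to be measurable on the whole line *)
Let w (t : R) : R := n%:R * (t ^+ n.+1) `^ (-1).

Let wE (t : R) : 0 < t -> w t = n%:R / t ^+ n.+1.
Proof. by move=> t0; rewrite /w powR_inv1// exprn_ge0// ltW. Qed.

Let mw : measurable_fun [set: R] w.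
Proof.
apply: measurable_funM => //.
apply: (@measurableT_comp _ _ _ _ _ _ (fun a : R => a `^ (-1))).
  exact: measurable_powR.
exact: measurable_funX.
Qed.

(** The antiderivative is -t^(-n). With a = |x| the factor |x|^n times this integral is 1, which is
    how [polar] trades the radial variable for a pointwise identity. *)
Let integral_w (a : R) : 0 < a ->
  (\int[mu]_(t in `[a, +oo[) (w t)%:E = ((a ^+ n)^-1)%:E)%E.
Proof.
move=> a0.
transitivity (\int[mu]_(t in `[a, +oo[) (n%:R / t ^+ n.+1)%:E)%E.
  apply: eq_integral => t; rewrite inE/= in_itv/= andbT => ta.
  by rewrite wE// (lt_le_trans a0).
have dF (x : R) : x != 0 ->
    is_derive x 1 (fun t : R => - (t ^+ n)^-1) (n%:R / x ^+ n.+1).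
  move=> x0.
  have h1 : is_derive x 1 (fun t : R => t ^+ n) ((n%:R * x ^+ m) *: 1).
    have := is_deriveX n (@is_derive_id _ _ x 1).
    by rewrite (_ : (id : R -> R) ^+ n = fun t => t ^+ n)//; apply/funext => t; rewrite exprfctE.
  have /(@is_deriveV _ _ _ _ _) := h1 => /(_ (expf_neq0 _ x0)) h2.
  have h3 := is_deriveN h2; apply: (is_derive_eq h3).
  rewrite /GRing.scale/= mulr1 !exprS.
  by field; rewrite x0 expf_neq0.
have nneg (x : R) : a <= x -> 0 < x by exact: lt_le_trans.
rewrite (@ge0_continuous_FTC2y _ _ (fun t => - (t ^+ n)^-1) a 0).
- by rewrite -EFinB sub0r opprK.
- by move=> x /nneg x0; rewrite divr_ge0// exprn_ge0// ltW.
- have cf (x : R) : 0 < x -> {for x, continuous (fun t : R => n%:R / t ^+ n.+1)}.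
    move=> x0; apply: continuousM; first exact: cst_continuous.
    apply: continuousV; first by rewrite expf_neq0// gt_eqF.
    exact: exprn_continuous.
  apply/continuous_within_itvcyP; split.
    by move=> x; rewrite in_itv/= andbT => /ltW/nneg; exact: cf.
  by apply: cvg_at_right_filter; exact: cf.
- rewrite -oppr0; apply: cvgN; apply/gtr0_cvgV0.
    by near=> x; rewrite exprn_gt0//; near: x; apply: nbhs_pinfty_gt; rewrite num_real.
  apply/cvgryPge => A; near=> x.
  have x1 : 1 <= x by near: x; apply: nbhs_pinfty_ge; rewrite num_real.
  have xA : A <= x by near: x; apply: nbhs_pinfty_ge; rewrite num_real.
  by rewrite (le_trans xA)// ler_eXnr.
- by move=> x /ltW/nneg x0; have [] := dF x (lt0r_neq0 x0).
- apply: cvg_at_right_filter; apply: cvgN; apply: (@cvgV _ _ _ _ (fun t : R => t ^+ n)).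
    by rewrite expf_neq0// gt_eqF.
  exact: exprn_continuous.
- move=> x; rewrite in_itv/= andbT => /ltW/nneg x0.
  by rewrite derive1E; have [_] := dF x (lt0r_neq0 x0).
Unshelve. all: by end_near. Qed.

Let pos : set R := `]0, +oo[%classic.

Let posE (t : R) : (t \in pos) = (0 < t).
Proof. by apply/idP/idP; rewrite /pos inE/= in_itv/= andbT. Qed.

Let BE (y : 'rV[R]_n) : (y \in B) = (0 < enorm y <= 1).
Proof. by apply/idP/idP; rewrite inE. Qed.

Let mpos : measurable_fun [set: R] (\1_pos : R -> R).
Proof. by apply: measurable_indic; exact: measurable_itv. Qed.

Local Open Scope ereal_scope.

(** By definition of the surface measure, the right side is the integral of n r^m f(r y/|y|) over r
    > 0 and y in the punctured ball ([P]). For fixed y put r = |y| t, which gives n t^m |y|^n f(t y)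
    ([P1]). For fixed t put x = t y, which gives n t^(-n-1) |x|^n f(x) on |x| <= t ([Q]).
    Integrating over t >= |x| leaves f(x). *)
Theorem polar (f : 'rV[R]_n -> R) :
  measurable_fun setT f -> (forall x, (0 <= f x)%R) ->
  \int[la]_x (f x)%:E =
  \int[mu]_(r in `]0%R, +oo[)
    ((r ^+ m)%:E * \int[@sph R n]_s (f (r *: s)%R)%:E).
Proof.
move=> mf f0.
pose P (p : measurableTypeR R * 'rV[R]_n) : R := (\1_pos p.1 * n%:R * p.1 ^+ m *
   (\1_B p.2 * f (p.1 *: normalize p.2)))%R.
pose P1 (p : measurableTypeR R * 'rV[R]_n) : R := (\1_pos p.1 * n%:R * p.1 ^+ m *
   (\1_B p.2 * enorm p.2 ^+ n * f (p.1 *: p.2)))%R.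
(* The constraint |x| <= t, as an indicator composed with a difference so that joint measurability
   is immediate. *)
pose E (p : measurableTypeR R * 'rV[R]_n) : R := (\1_[set q | 0 <= q] (p.1 - enorm p.2))%R.
pose Q (p : measurableTypeR R * 'rV[R]_n) : R := (\1_pos (enorm p.2) * \1_pos p.1 * E p * w p.1 *
   (enorm p.2 ^+ n * f p.2))%R.
have mE2 : measurable_fun setT (fun p : measurableTypeR R * 'rV[R]_n => enorm p.2).
  exact: measurableT_comp measurable_enorm measurable_snd.
have m1 : measurable_fun setT (fun p : measurableTypeR R * 'rV[R]_n => p.1 : R).
  exact: measurable_fst.
have m1p : measurable_fun setT (fun p : measurableTypeR R * 'rV[R]_n => \1_pos p.1 : R).
  exact: (measurableT_comp mpos measurable_fst).
have m2B : measurable_fun setT (fun p : measurableTypeR R * 'rV[R]_n => \1_B p.2 : R).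
  apply: (measurableT_comp _ measurable_snd).
  exact: measurable_indic measurable_punctured_unit_ball.
have mP : measurable_fun setT P.
  apply: measurable_funM; first apply: measurable_funM; first exact: measurable_funM.
    exact: measurable_funX.
  apply: measurable_funM => //; apply: measurableT_comp => //.
  apply: measurable_scale_pair => //.
  exact: measurableT_comp measurable_normalize measurable_snd.
have mP1 : measurable_fun setT P1.
  apply: measurable_funM; first apply: measurable_funM; first exact: measurable_funM.
    exact: measurable_funX.
  apply: measurable_funM; first by apply: measurable_funM => //; exact: measurable_funX.
  apply: measurableT_comp => //.
  by apply: measurable_scale_pair.
have mQ : measurable_fun setT Q.
  apply: measurable_funM; last first.
    apply: measurable_funM; first exact: measurable_funX.
    exact: measurableT_comp mf measurable_snd.
  apply: measurable_funM; last exact: measurableT_comp mw measurable_fst.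
  apply: measurable_funM; first apply: measurable_funM => //.
    exact: measurableT_comp mpos mE2.
  have mi : measurable_fun [set: R] (\1_[set q : R | (0 <= q)%R] : R -> R).
    apply: measurable_indic.
    by have := @measurable_itv R `[0%R, +oo[; congr measurable; apply/seteqP; split => x /=; rewrite in_itv/= andbT.
  exact: (measurableT_comp mi (measurable_funB m1 mE2)).
have ind0 (T : Type) (A : set T) x : (0 <= \1_A x :> R)%R by rewrite indicE.
have pos0 (x : R) k j : (0 <= \1_pos x * k%:R * x ^+ j :> R)%R.
  rewrite indicE posE; have [x0|_] := ltP; last by rewrite !mul0r.
  by rewrite mul1r mulr_ge0// exprn_ge0// ltW.
have P0 p : (0 <= P p)%R.
  by rewrite /P mulr_ge0//; apply: mulr_ge0.
have P10 p : (0 <= P1 p)%R.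
  by rewrite /P1 mulr_ge0//; apply: mulr_ge0 => //; apply: mulr_ge0 => //; rewrite exprn_ge0 ?enorm_ge0.
have Q0 p : (0 <= Q p)%R.
  rewrite /Q mulr_ge0//; last by rewrite mulr_ge0// exprn_ge0 ?enorm_ge0.
  by rewrite !mulr_ge0// powR_ge0.
rewrite ge0_integral_off_origin//.
transitivity (\int[mu]_r \int[la]_y (P (r, y))%:E); last first.
  rewrite [RHS]integral_mkcond; apply: eq_integral => r _.
  rewrite patchE posE; case: ifPn => [r0|]; last first.
    rewrite -posE => r0; apply: integral0_eq => y _.
    by rewrite /P/= indicE (negbTE r0) !mul0r.
  have mfr : measurable_fun setT (fun s : 'rV[R]_n => f (r *: s)%R).
    by apply: measurableT_comp => //; exact: measurable_scale_pair.
  rewrite ge0_integral_sph//=; last 2 first.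
  - exact/measurable_EFinP.
  - by move=> x; rewrite lee_fin.
  rewrite muleA -EFinM (integral_mkindic _ B) EFinZl_ge0_integral; last 3 first.
  - apply: measurable_funM; last exact: measurableT_comp mfr measurable_normalize.
    exact: measurable_indic measurable_punctured_unit_ball.
  - by move=> y; rewrite mulr_ge0.
  - by rewrite mulr_ge0// exprn_ge0// ltW.
  apply: eq_integral => y _; rewrite /P/= (@indicE _ _ pos) posE r0 mul1r.
  by congr EFin; ring.
have tonelli (g : measurableTypeR R * 'rV[R]_n -> R) : measurable_fun setT g -> (forall p, 0 <= g p)%R ->
    \int[mu]_r \int[la]_y (g (r, y))%:E = \int[la]_y \int[mu]_r (g (r, y))%:E.
  move=> mg g0; apply: (@fubini_tonelli _ _ _ _ R mu la (EFin \o g)).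
    exact/measurable_EFinP.
  by move=> p; rewrite lee_fin.
rewrite tonelli//.
transitivity (\int[la]_y \int[mu]_r (P1 (r, y))%:E); last first.
  apply: eq_integral => y _; have [yB|yB] := boolP (y \in B); last first.
    by apply: eq_integral => r _; rewrite /P /P1/= (@indicE _ _ B) (negbTE yB) !mul0r.
  move: (yB); rewrite BE => /andP[y0 y1].
  rewrite [RHS](ge0_integral_affine1 0 y0)//; last 2 first.
  - apply/measurable_EFinP; apply: (measurableT_comp mP); exact: measurable_pair2.
  - by move=> x; rewrite lee_fin.
  rewrite EFinZl_ge0_integral; last 3 first.
  - apply: (measurableT_comp mP).
    apply: (measurableT_comp (measurable_pair2 y)).
    exact: measurable_affine1.
  - by [].
  - exact: ltW.
  apply: eq_integral => t _; congr EFin.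
  rewrite /P /P1/= addr0 !indicE !posE yB pmulr_rgt0// !mul1r.
  rewrite [(enorm y * t)%R]mulrC -scalerA normalizeK// exprMn exprS.
  by rewrite -!mulrA; ring.
rewrite -tonelli//.
transitivity (\int[mu]_r \int[la]_y (Q (r, y))%:E); last first.
  apply: eq_integral => t _; have [tp|tp] := boolP (t \in pos); last first.
    by apply: eq_integral => r _; rewrite /Q /P1/= !(@indicE _ _ pos) (negbTE tp) mulr0 !mul0r.
  move: (tp); rewrite posE => t0.
  rewrite (ge0_integral_scale t0)//; last 2 first.
  - apply/measurable_EFinP; apply: (measurableT_comp mQ); exact: measurable_pair1.
  - by move=> x; rewrite lee_fin.
  rewrite EFinZl_ge0_integral; last 3 first.
  - apply: (measurableT_comp mQ).
    apply: (measurableT_comp (measurable_pair1 t)).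
    exact: measurable_scale_pair.
  - by [].
  - by rewrite exprn_ge0// ltW.
  apply: eq_integral => x _; congr EFin.
  rewrite /Q /P1 /E/= !indicE !posE BE wE// t0 enormZ (gtr0_norm t0) pmulr_rgt0//.
  rewrite (_ : (_ \in [set q | (0 <= q)%R]) = (enorm x <= 1)%R); last first.
    by apply/idP/idP; rewrite inE/= -{1}(mulr1 t) -mulrBr pmulr_rge0// subr_ge0.
  rewrite (_ : ((0 < enorm x <= 1)%R%:R = (0 < enorm x)%R%:R * (enorm x <= 1)%R%:R)%R); last first.
    by case: (0 < enorm x)%R; rewrite (mul1r, mul0r).
  rewrite exprMn !exprS; field.
  by rewrite expf_neq0 gt_eqF.
rewrite tonelli//; apply: eq_integral => x _.
rewrite indicE (_ : (x \in _) = (0 < enorm x)%R); last first.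
  by apply/idP/idP; rewrite inE.
have [x0|x0] := ltP; last first.
  rewrite mul0r integral0_eq// => t _.
  by rewrite /Q/= (@indicE _ _ pos) posE ltNge x0 !mul0r.
transitivity ((enorm x ^+ n * f x)%:E * \int[mu]_(t in `[enorm x, +oo[) (w t)%:E).
  by rewrite integral_w// -EFinM mul1r mulrAC mulfV ?mul1r// expf_neq0// gt_eqF.
rewrite (@integral_mkindic _ _ _ mu `[enorm x, +oo[%classic) EFinZl_ge0_integral; last 3 first.
- apply: measurable_funM => //; exact: measurable_indic.
- by move=> t; rewrite mulr_ge0// mulr_ge0// powR_ge0.
- by rewrite mulr_ge0// exprn_ge0// ltW.
apply: eq_integral => t _; rewrite /Q /E/= !indicE !posE x0 mul1r.
rewrite (_ : (_ \in [set q | (0 <= q)%R]) = (enorm x <= t)%R); last first.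
  by apply/idP/idP; rewrite inE/= subr_ge0.
rewrite (_ : (t \in _) = (enorm x <= t)%R); last first.
  by apply/idP/idP; rewrite inE/= in_itv/= andbT.
have [xt|xt] := leP (enorm x) t; last by rewrite !(mulr0, mul0r).
by rewrite (lt_le_trans x0 xt) !mul1r mulrC.
Qed.

End polar.

(** * Total mass of the unit sphere *)

Section sphere_area.
Context {R : realType} (m : nat).
Local Notation n := m.+1.
Notation mu := (@lebesgue_measure R).
Local Open Scope ereal_scope.

Let g (r : R) : R := (r ^+ m * expR (- r ^+ 2))%R.
Let G (t : R) : R := (t `^ (n%:R / 2 - 1) * expR (- t))%R.

Let itv k : set R := `[(k.+1%:R^-1 : R)%R, k.+1%:R]%classic.

Let itv_pos k (x : R) : (k.+1%:R^-1 <= x)%R -> (0 < x)%R.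
Proof. by apply: lt_le_trans; rewrite invr_gt0. Qed.

Let G_continuous (t : R) : (0 < t)%R -> {for t, continuous G}.
Proof.
move=> t0; apply: continuousM.
  apply/differentiable_continuous/derivable1_diffP/derivable_powR.
  by rewrite in_itv/= t0.
apply: (@continuous_comp _ _ _ (fun x : R => - x)%R expR).
  exact: opp_continuous.
exact: continuous_expR.
Qed.

Let G_sq (r : R) : (0 < r)%R -> (G (r ^+ 2) * (2 * r) = 2 * g r)%R.
Proof.
move=> r0; rewrite /G /g -powR_mulrn ?ltW// -powRrM.
rewrite (_ : 2%:R * (n%:R / 2 - 1) = m%:R - 1)%R; last by rewrite -(addn1 m) natrD; field.
rewrite -[in RHS](powR_mulrn _ (ltW r0)) powRD; last by rewrite (gt_eqF r0) implybT.
rewrite powR_inv1 ?ltW// powR_mulrn ?ltW//; field.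
by rewrite gt_eqF.
Qed.

(** The substitution t = r^2, done on compact intervals away from 0 because the Gamma integrand is
    unbounded near 0 when n = 1. *)
Let subst_itv k :
  \int[mu]_(t in `[((k.+1%:R^-1 : R) ^+ 2)%R, (k.+1%:R ^+ 2)%R]) (G t)%:E =
  \int[mu]_(r in itv k) (2 * g r)%:E.
Proof.
have k1 : (k.+1%:R^-1 <= k.+1%:R :> R)%R.
  by rewrite (@le_trans _ _ 1%R)// ?ler1n// invf_le1// ler1n.
have dsq : ((fun x : R => x ^+ 2)%R^`())%classic = (fun x => 2 * x)%R.
  by apply/funext => x; rewrite exp_derive1 expr1.
have c2 : continuous (fun x : R => 2 * x)%R.
  by move=> x; apply: (@continuousM _ _ (fun=> 2%R) id); [exact: cst_continuous|exact: cvg_id].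
rewrite (@integration_by_substitution_increasing _ (fun x => x ^+ 2)%R G)//.
- apply: eq_integral => r; rewrite inE/= in_itv/= => /andP[/itv_pos r0 _].
  by congr EFin; rewrite dsq -G_sq.
- move=> x y; rewrite !in_itv/= => /andP[/itv_pos x0 _] /andP[/itv_pos y0 _] xy.
  by rewrite ltrXn2r// ltW.
- by rewrite dsq => x _; exact: c2.
- by rewrite dsq; apply: cvgP; apply: cvg_at_right_filter; exact: c2.
- by rewrite dsq; apply: cvgP; apply: cvg_at_left_filter; exact: c2.
- split.
  + by move=> x _; exact: exprn_derivable.
  + by apply: cvg_at_right_filter; exact: exprn_continuous.
  + by apply: cvg_at_left_filter; exact: exprn_continuous.
- apply: continuous_in_subspaceT => x; rewrite inE/= in_itv/= => /andP[xk _].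
  by apply: G_continuous; apply: lt_le_trans xk; rewrite exprn_gt0// invr_gt0.
Qed.

Let mg : measurable_fun [set: R] g.
Proof.
apply: measurable_funM; first exact: measurable_funX.
exact: measurable_gauss_fun.
Qed.

Let mG : measurable_fun [set: R] G.
Proof.
apply: measurable_funM.
  exact: (@measurable_powR _ (n%:R / 2 - 1)%R).
by apply: measurableT_comp => //; exact: measurable_funN.
Qed.

Let g_ge0 r : (0 < r)%R -> (0 <= g r)%R.
Proof. by move=> r0; rewrite mulr_ge0 ?expR_ge0// exprn_ge0// ltW. Qed.

Let G_ge0 t : (0 <= G t)%R.
Proof. by rewrite mulr_ge0 ?expR_ge0// powR_ge0. Qed.

(** The exponent lets one exhaustion serve both sides of the substitution: p = 1 gives the intervals
    [itv k], p = 2 their images under squaring. *)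
Let cover p : (0 < p)%N ->
  \bigcup_k `[((k.+1%:R^-1 : R) ^+ p)%R, (k.+1%:R ^+ p)%R]%classic =
  `]0%R, +oo[%classic.
Proof.
move=> p0; apply/seteqP; split => [x [k _]|x].
  rewrite /= !in_itv/= andbT => /andP[+ _].
  by apply: lt_le_trans; rewrite exprn_gt0// invr_gt0.
rewrite /= in_itv/= andbT => x0.
pose k := maxn (Num.truncn x) (Num.truncn x^-1).
have kx : (x < k.+1%:R)%R.
  apply: (lt_le_trans (truncnS_gt x)).
  by rewrite ler_nat ltnS leq_maxl.
have kx' : (x^-1 < k.+1%:R)%R.
  apply: (lt_le_trans (truncnS_gt x^-1)).
  by rewrite ler_nat ltnS leq_maxr.
exists k => //=; rewrite in_itv/=; apply/andP; split.
  rewrite (@le_trans _ _ (k.+1%:R^-1)%R)//.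
    by rewrite -[leRHS]expr1 ler_wiXn2l// ?invr_ge0// invf_le1// ler1n.
  by rewrite ltW// -[ltRHS]invrK ltf_pV2 ?posrE// invr_gt0.
rewrite (le_trans (ltW kx))//.
by rewrite -[leLHS]expr1 ler_weXn2l// ler1n.
Qed.

Let cvg_itv (h : R -> R) p : (0 < p)%N -> measurable_fun setT h ->
  (forall r, (0 < r)%R -> (0 <= h r)%R) ->
  \int[mu]_(r in `[((k.+1%:R^-1 : R) ^+ p)%R, (k.+1%:R ^+ p)%R]) (h r)%:E
    @[k --> \oo] --> \int[mu]_(r in `]0%R, +oo[) (h r)%:E.
Proof.
move=> p0 mh h0; rewrite -(cover p0).
apply: ge0_nondecreasing_set_cvg_integral.
- move=> i j ij; apply/subsetPset => x /=; rewrite !in_itv/= => /andP[ix xi].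
  apply/andP; split.
    rewrite (le_trans _ ix)// lerXn2r ?nnegrE ?invr_ge0//.
    by rewrite lef_pV2 ?posrE// ler_nat.
  by rewrite (le_trans xi)// lerXn2r ?nnegrE// ler_nat.
- by move=> i; exact: measurable_itv.
- by move=> i; apply/measurable_EFinP/measurable_funTS.
- move=> i x /=; rewrite in_itv/= => /andP[ix _]; rewrite lee_fin h0//.
  by apply: lt_le_trans ix; rewrite exprn_gt0// invr_gt0.
Qed.

Let integral_G : \int[mu]_(t in `]0%R, +oo[) (G t)%:E =
  2%:E * \int[mu]_(r in `]0%R, +oo[) (g r)%:E.
Proof.
rewrite -ge0_integralZl//; last 2 first.
- by apply/measurable_EFinP/measurable_funTS.
- by move=> x /=; rewrite in_itv/= andbT lee_fin => x0; exact: g_ge0.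
have h1 := @cvg_itv G 2 isT mG (fun t _ => G_ge0 t).
have h2 : \int[mu]_(r in itv k) (2 * g r)%:E @[k --> \oo] -->
    \int[mu]_(r in `]0%R, +oo[) (2 * g r)%:E.
  apply: (@cvg_itv (fun r => (2 * g r)%R) 1) => //.
  - exact: measurable_funM.
  - by move=> r r0; rewrite mulr_ge0// g_ge0.
apply: (cvg_unique _ h1) => //; apply: cvg_trans h2.
by apply: near_eq_cvg; near=> k; rewrite subst_itv.
Unshelve. all: by end_near. Qed.

(** Let I be the integral of r^m exp(-r^2) over r > 0. The Gaussian in polar coordinates gives mass
    times I = pi^(n/2), and t = r^2 gives Gamma(n/2) = 2 I. *)
Theorem sph_setT : @sph R n setT = (sphere_area n)%:E.
Proof.
have gauss_sph (r : R) : (0 < r)%R ->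
    \int[@sph R n]_s (expR (- dotv (r *: s) (r *: s)))%:E =
    (expR (- r ^+ 2))%:E * @sph R n setT.
  move=> r0; rewrite -integral_cst//; apply: ge0_ae_eq_integral => //.
  - apply/measurable_EFinP; apply: measurableT_comp => //.
    apply: measurable_funN; apply: measurable_sum => i.
    under eq_fun do rewrite !mxE.
    by apply: measurable_funM; apply: measurable_funM => //; exact: measurable_rV_coord.
  - by move=> x _; rewrite lee_fin expR_ge0.
  exists [set s | enorm s <> 1%R]; split.
  - have := @measurable_enorm_itv R n `[1%R, 1%R] => /measurableC.
    congr measurable; apply/seteqP; split => x /= h e; apply: h.
      by rewrite in_itv/= e lexx.
    by apply/eqP; rewrite eq_le andbC; move: e; rewrite in_itv.
  - exact: sph_enorm1.
  - move=> x /= h x1; apply: h => _; congr (expR _)%:E.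
    by rewrite -sqr_enorm enormZ exprMn x1 expr1n mulr1 gtr0_norm.
have sE : @sph R n setT = (fine (@sph R n setT))%:E.
  by rewrite fineK// sph_fin.
have polar_gauss : @sph R n setT * \int[mu]_(r in `]0%R, +oo[) (g r)%:E =
    (Num.sqrt pi ^+ n)%:E.
  rewrite -(@integral_gauss R n) polar//; last first.
    apply: measurableT_comp => //.
    apply: measurable_funN; apply: measurable_sum => i.
    by apply: measurable_funM; exact: measurable_rV_coord.
  rewrite -ge0_integralZl//; last 2 first.
  - by apply/measurable_EFinP/measurable_funTS.
  - by move=> r /=; rewrite in_itv/= andbT lee_fin => r0; exact: g_ge0.
  apply: eq_integral => r; rewrite inE/= in_itv/= andbT => r0.
  by rewrite gauss_sph // /g [LHS]muleC EFinM -muleA.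
have iG := integral_G.
set I := \int[mu]_(r in `]0%R, +oo[) (g r)%:E in iG polar_gauss.
have I0 : 0 <= I.
  apply: integral_ge0 => r /=; rewrite in_itv/= andbT lee_fin => r0; exact: g_ge0.
have sqrtpi0 : (0 < Num.sqrt pi ^+ n :> R)%R.
  by rewrite exprn_gt0// sqrtr_gt0 pi_gt0.
have sp : (0 <= fine (@sph R n setT))%R by exact: fine_ge0.
move: polar_gauss; rewrite sE; move: sp; set c := fine _ => c0 cI.
(* [I] cannot be infinite: a positive mass would make the product infinite, and mass 0 would make
   the positive Gaussian integral 0. *)
have [i iE] : exists i : R, I = i%:E.
  move: I0 cI; case: I {iG} => [i _ _|_|//]; first by exists i.
  move: c0; rewrite le_eqVlt => /predU1P[<-|c0].
    by rewrite mul0e => -[h]; rewrite -h ltxx in sqrtpi0.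
  by rewrite gt0_muley ?lte_fin.
move: cI; rewrite iE -EFinM => -[ci].
have i0 : i != 0%R by apply: contraTneq sqrtpi0 => i0; rewrite -ci i0 mulr0 ltxx.
congr EFin; rewrite /sphere_area.
have -> : Gamma (n%:R / 2) = (2 * i)%R.
  by rewrite /Gamma /Rintegral [X in fine X]iG iE -EFinM.
have -> : (pi `^ (n%:R / 2) = c * i)%R.
  rewrite ci mulrC powRrM powR12_sqrt ?pi_ge0// powR_mulrn// sqrtr_ge0.
by field.
Qed.

End sphere_area.

(** * Square-integrable functions *)

Section L2.
Context d (T : measurableType d) (R : realType) (m : {measure set T -> \bar R}).
Implicit Types f g : T -> R.
Local Open Scope ereal_scope.

Definition L2 f := measurable_fun setT f /\ \int[m]_x (f x ^+ 2)%:E < +oo.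

(** [fine] gives the value 0 when the square integral diverges, so the norm inequalities below come
    with hypotheses ensuring finiteness. *)
Definition l2 f : R := Num.sqrt (fine (\int[m]_x (f x ^+ 2)%:E)).

Lemma integral_sqr_ge0 f : 0 <= \int[m]_x (f x ^+ 2)%:E.
Proof. by apply: integral_ge0 => x _; rewrite lee_fin sqr_ge0. Qed.

Lemma Lnorm2E f :
  'N[m]_2%:E[EFin \o f] = (\int[m]_x (f x ^+ 2)%:E) `^ 2^-1.
Proof.
rewrite unlock; congr (_ `^ _); apply: eq_integral => x _ /=.
by rewrite (@powR_mulrn _ _ 2)// real_normK// num_real.
Qed.

Lemma L2_Lnorm f : L2 f -> 'N[m]_2%:E[EFin \o f] = (l2 f)%:E.
Proof.
move=> [mf fy]; rewrite Lnorm2E poweR12_sqrt ?integral_sqr_ge0//.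
have : \int[m]_x (f x ^+ 2)%:E \is a fin_num.
  by rewrite ge0_fin_numE// integral_sqr_ge0.
by rewrite /l2; case: (\int[m]_x _).
Qed.

Lemma L2P f : L2 f <-> f \in Lfun m 2%:E.
Proof.
split=> [[mf fy]|].
  rewrite inE; apply/andP; split; rewrite inE//=.
  by rewrite /finite_norm Lnorm2E poweR_lty.
rewrite inE => /andP[]; rewrite !inE/= /finite_norm Lnorm2E => mf.
by move=> h; split=> //; apply: lty_poweRy h; rewrite invr_eq0.
Qed.

Lemma l2_ge0 f : (0 <= l2 f)%R. Proof. exact: sqrtr_ge0. Qed.

Lemma eq_l2 f g : \int[m]_x (f x ^+ 2)%:E = \int[m]_x (g x ^+ 2)%:E ->
  l2 f = l2 g.
Proof. by rewrite /l2 => ->. Qed.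

Lemma L2_0 : L2 (fun=> 0%R).
Proof.
split=> //; rewrite integral0_eq// => x _; by rewrite expr0n.
Qed.

Lemma L2D f g : L2 f -> L2 g -> L2 (fun x => f x + g x)%R.
Proof.
move=> Lf Lg; have [mf _] := Lf; have [mg _] := Lg.
split; first exact: measurable_funD.
apply: (@lty_poweRy _ _ 2^-1); first by rewrite invr_eq0.
rewrite -(Lnorm2E (fun x => f x + g x)%R).
apply: le_lt_trans (minkowski_EFin m mf mg _) _; first by rewrite ler1n.
by rewrite !L2_Lnorm// -EFinD ltry.
Qed.

Lemma L2Z c f : L2 f -> L2 (fun x => c * f x)%R.
Proof.
move=> [mf fy]; split; first exact: measurable_funM.
under eq_integral do rewrite exprMn.
rewrite -EFinZl_ge0_integral ?sqr_ge0//; last 2 first.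
- exact: measurable_funX.
- by move=> x; exact: sqr_ge0.
by rewrite lte_mul_pinfty ?lee_fin ?sqr_ge0.
Qed.

Lemma l2Z c f : L2 f -> l2 (fun x => c * f x)%R = (`|c| * l2 f)%R.
Proof.
move=> [mf fy]; rewrite /l2; under eq_integral do rewrite exprMn.
rewrite -EFinZl_ge0_integral ?sqr_ge0//; last 2 first.
- exact: measurable_funX.
- by move=> x; exact: sqr_ge0.
rewrite fineM ?fin_numE//=; last by rewrite -fin_numE ge0_fin_numE// integral_sqr_ge0.
by rewrite sqrtrM ?sqr_ge0// sqrtr_sqr.
Qed.

Lemma L2N f : L2 f -> L2 (fun x => - f x)%R.
Proof.
by move=> /(L2Z (-1)); under eq_fun do rewrite mulN1r.
Qed.

Lemma L2B f g : L2 f -> L2 g -> L2 (fun x => f x - g x)%R.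
Proof. by move=> Lf Lg; apply: L2D => //; exact: L2N. Qed.

Lemma l2_le_add f g : L2 f -> L2 g -> (l2 (fun x => f x + g x) <= l2 f + l2 g)%R.
Proof.
move=> Lf Lg; rewrite -lee_fin EFinD -!L2_Lnorm//; last exact: L2D.
by apply: minkowski_EFin; [exact: Lf.1|exact: Lg.1|rewrite ler1n].
Qed.

Lemma l2_le_sub f g : L2 f -> L2 g -> (l2 (fun x => f x - g x) <= l2 f + l2 g)%R.
Proof.
move=> Lf Lg; rewrite (_ : l2 g = l2 (fun x => - g x)%R).
  by apply: l2_le_add => //; exact: L2N.
by apply: eq_l2; apply: eq_integral => x _; rewrite sqrrN.
Qed.

Lemma cauchy_schwarz f g : L2 f -> L2 g ->
  \int[m]_x `|f x * g x|%:E <= (l2 f * l2 g)%:E.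
Proof.
move=> Lf Lg; rewrite EFinM -!L2_Lnorm//.
have := @hoelder _ T R m f g 2 2 Lf.1 Lg.1 (ltr0n _ 2) (ltr0n _ 2).
by rewrite Lnorm1; apply; field.
Qed.

Lemma L2M_integrable f g : L2 f -> L2 g ->
  m.-integrable setT (fun x => (f x * g x)%:E).
Proof.
move=> Lf Lg; apply/integrableP; split.
  by apply/measurable_EFinP/measurable_funM; [exact: Lf.1|exact: Lg.1].
by apply: le_lt_trans (ltry (l2 f * l2 g)%R); exact: cauchy_schwarz.
Qed.

Lemma cauchy_schwarz_Rintegral f g : L2 f -> L2 g ->
  (`|\int[m]_x (f x * g x)| <= l2 f * l2 g)%R.
Proof.
move=> Lf Lg.
have h := cauchy_schwarz Lf Lg.
apply: le_trans (le_normr_Rintegral measurableT (L2M_integrable Lf Lg)) _.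
rewrite -lee_fin fineK//; apply/integrable_fin_num => //.
exact: integrable_norm (L2M_integrable Lf Lg).
Qed.

Lemma le_l2 f g : L2 g -> measurable_fun setT f ->
  (forall x, `|f x| <= `|g x|)%R -> L2 f /\ (l2 f <= l2 g)%R.
Proof.
move=> [mg gy] mf fg.
have le : \int[m]_x (f x ^+ 2)%:E <= \int[m]_x (g x ^+ 2)%:E.
  apply: ge0_le_integral => //.
  - by move=> x _; rewrite lee_fin sqr_ge0.
  - by apply/measurable_EFinP; exact: measurable_funX.
  - by apply/measurable_EFinP; exact: measurable_funX.
  - by move=> x _; rewrite lee_fin -real_normK ?num_real// -[leRHS]real_normK ?num_real// lerXn2r// nnegrE.
have Lf : L2 f by split=> //; exact: le_lt_trans gy.
split=> //; rewrite ler_sqrt ?fine_ge0 ?integral_sqr_ge0//.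
apply: fine_le => //; rewrite ge0_fin_numE ?integral_sqr_ge0//.
by case: Lf.
Qed.

Lemma l2_le f (c : R) : (0 <= c)%R ->
  \int[m]_x (f x ^+ 2)%:E <= (c ^+ 2)%:E -> (l2 f <= c)%R.
Proof.
move=> c0 fc; rewrite -(ger0_norm c0) -sqrtr_sqr ler_sqrt ?sqr_ge0//.
by rewrite -lee_fin fineK// ge0_fin_numE ?integral_sqr_ge0// (le_lt_trans fc) ?ltry.
Qed.

Lemma L2_sum (I : Type) (s : seq I) (F : I -> T -> R) :
  (forall i, L2 (F i)) -> L2 (fun x => \sum_(i <- s) F i x)%R.
Proof.
move=> LF; elim: s => [|i s IH].
  by under eq_fun do rewrite big_nil; exact: L2_0.
by under eq_fun do rewrite big_cons; exact: L2D.
Qed.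

Lemma l2_0 : l2 (fun=> 0%R) = 0%R.
Proof.
by rewrite /l2 integral0_eq ?sqrtr0// => x _; rewrite expr0n.
Qed.

Lemma l2_sum (I : Type) (s : seq I) (F : I -> T -> R) :
  (forall i, L2 (F i)) ->
  (l2 (fun x => \sum_(i <- s) F i x) <= \sum_(i <- s) l2 (F i))%R.
Proof.
move=> LF; elim: s => [|i s IH].
  by under eq_fun do rewrite big_nil; rewrite big_nil l2_0.
under eq_fun do rewrite big_cons; rewrite big_cons.
by apply: (le_trans (l2_le_add (LF i) (L2_sum s LF))); rewrite lerD2l.
Qed.

Lemma L2_indic (A : set T) : measurable A -> m A < +oo -> L2 (\1_A).
Proof.
move=> mA Ay; split; first exact: measurable_indic.
rewrite (eq_integral (fun x => (\1_A x)%:E)) ?integral_indic ?setIT//.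
by move=> x _; rewrite indicE; case: (_ \in _); rewrite ?expr1n ?expr0n.
Qed.

Lemma l2_ae_eq f g : measurable_fun setT f -> measurable_fun setT g ->
  {ae m, forall x, f x = g x} -> l2 f = l2 g.
Proof.
move=> mf mg fg; apply: eq_l2; apply: ae_eq_integral => //.
- by apply/measurable_EFinP; exact: measurable_funX.
- by apply/measurable_EFinP; exact: measurable_funX.
by apply: filterS fg => x /= -> _.
Qed.

End L2.

(** * Continuity of translations in mean square *)

Section open_measurable.
Context {R : realType} (n : nat).

Let box (p : 'rV[rat]_n * nat) : set 'rV[R]_n :=
  [set x | forall i, `|x ord0 i - ratr (p.1 ord0 i)| < p.2.+1%:R^-1].

Let mbox p : measurable (box p).
Proof.
rewrite (_ : box p = \bigcap_(i in [set: 'I_n])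
    [set x : 'rV[R]_n | `|x ord0 i - ratr (p.1 ord0 i)| < p.2.+1%:R^-1]).
  apply: fin_bigcap_measurable; first exact: finite_finset.
  move=> i _; set c := ratr _; set e := _^-1.
  have := @measurable_rV_coord R n i measurableT `]c - e, c + e[%classic
    (measurable_itv _).
  rewrite setTI; congr measurable; apply/seteqP; split => x /=;
    by rewrite in_itv/= ltr_distl.
by apply/seteqP; split => x /= h i; [move=> _|]; exact: h.
Qed.

(** Reconciles the coordinate sigma-algebra with the sup-norm topology: an open set is the union of
    the boxes with rational centre and half-width 1/(k+1) that it contains, and these are enumerated
    by [unpickle]. *)
Lemma open_rV_measurable (U : set 'rV[R]_n) : open U -> measurable U.
Proof.
move=> oU.
pose F (j : nat) : set 'rV[R]_n :=
  if unpickle j is Some p then (if `[< box p `<=` U >] then box p else set0)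
  else set0.
rewrite (_ : U = \bigcup_j F j).
  apply: bigcupT_measurable => j; rewrite /F; case: (unpickle j) => // p.
  by case: ifP => // _; exact: mbox.
apply/seteqP; split => [x Ux|x [j _]]; last first.
  by rewrite /F; case: (unpickle j) => // p; case: ifP => // /asboolP; apply.
have /nbhs_ballP[e /= e0 xe] : nbhs x U by exact: open_nbhs_nbhs.
have [k ke] : exists k : nat, k.+1%:R^-1 < e / 2.
  have := @near_infty_natSinv_lt R (PosNum (divr_gt0 e0 (ltr0n _ 2))).
  by move=> [k _ /(_ k (leqnn k)) ?]; exists k.
have qk i : exists q : rat, `|x ord0 i - ratr q| < k.+1%:R^-1.
  have : x ord0 i - k.+1%:R^-1 < x ord0 i + k.+1%:R^-1.
    by rewrite ltrBlDr -addrA ltrDl addr_gt0// invr_gt0.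
  move=> /rat_in_itvoo[q]; rewrite in_itv/= => xq; exists q.
  by rewrite distrC ltr_distl.
pose q : 'rV[rat]_n := \row_i projT1 (cid (qk i)).
have qE i : `|x ord0 i - ratr (q ord0 i)| < k.+1%:R^-1.
  by rewrite mxE; case: cid.
exists (pickle (q, k)) => //; rewrite /F pickleK.
rewrite asboolT//= => y yq; apply: xe; rewrite mx_norm_ball /ball_/=.
rewrite [ltLHS]mx_normrE; apply: bigmax_lt => //= -[i j] _ /=; rewrite ord1 !mxE.
have -> : x ord0 j - y ord0 j = (x ord0 j - ratr (q ord0 j)) - (y ord0 j - ratr (q ord0 j)) by ring.
apply: le_lt_trans (ler_normB _ _) _; rewrite (splitr e) ltrD//.
  exact: lt_trans (qE j) ke.
exact: lt_trans (yq j) ke.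
Qed.

Lemma continuous_rV_measurable (f : 'rV[R]_n -> R) :
  continuous f -> measurable_fun setT f.
Proof.
move=> cf; apply: (measurability _ (RGenOpens.measurableE R)).
move=> _ [_ [a [b ->]] <-]; rewrite setTI; apply: open_rV_measurable.
by apply: open_comp => // x _; exact: cf.
Qed.

(** Exhibits a generating family stable under intersection, which is what the Dynkin argument in
    [tcont_indic] starts from. *)
Lemma measurable_rV_open : @measurable _ 'rV[R]_n = <<s (@open 'rV[R]_n) >>.
Proof.
apply/seteqP; split; last first.
  by apply: smallest_sub; [exact: sigma_algebra_measurable|exact: open_rV_measurable].
apply: smallest_sub; first exact: smallest_sigma_algebra.
move=> A; rewrite -bigcup_seq/= => -[i _] [B mB <-].
pose T := g_sigma_algebraType (@open 'rV[R]_n).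
have mi : measurable_fun [set: T] (fun x : T => (x : 'rV[R]_n) ord0 i).
  apply: (measurability _ (RGenOpens.measurableE R)).
  move=> _ [_ [a [b ->]] <-]; rewrite setTI; apply: sub_sigma_algebra.
  by apply: open_comp => // x _; exact: coord_continuous.
exact: (mi measurableT B mB).
Qed.

End open_measurable.

Section translation.
Context {R : realType} (n : nat).
Notation la := (@lebesgue_rV R n).
Implicit Types (f g : 'rV[R]_n -> R) (h : 'rV[R]_n).
Local Open Scope ereal_scope.

Lemma measurable_shift h : measurable_fun [set: 'rV[R]_n] (fun x => x + h)%R.
Proof. exact: measurable_add_pair. Qed.

Lemma integral_translation h (f : 'rV[R]_n -> \bar R) :
  measurable_fun setT f -> \int[la]_x f (x + h)%R = \int[la]_x f x.
Proof.
move=> mf; rewrite [in LHS]integralE [in RHS]integralE.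
have mp := measurable_funepos mf; have mn := measurable_funeneg mf.
congr (_ - _).
- rewrite -(ge0_integral_translation h mp)//.
  by apply: eq_integral => x _; rewrite !funeposE.
- rewrite -(ge0_integral_translation h mn)//.
  by apply: eq_integral => x _; rewrite !funenegE.
Qed.

Lemma L2_shift h f : L2 la f -> L2 la (fun x => f (x + h)%R).
Proof.
move=> [mf fy]; split; first exact: measurableT_comp mf (measurable_shift h).
rewrite (ge0_integral_translation h (f := fun x => (f x ^+ 2)%:E))//.
  by apply/measurable_EFinP; exact: measurable_funX.
by move=> x; rewrite lee_fin sqr_ge0.
Qed.

Lemma l2_shift h f : measurable_fun setT f -> l2 la (fun x => f (x + h)%R) = l2 la f.
Proof.
move=> mf; apply: eq_l2.
rewrite (ge0_integral_translation h (f := fun x => (f x ^+ 2)%:E))//.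
  by apply/measurable_EFinP; exact: measurable_funX.
by move=> x; rewrite lee_fin sqr_ge0.
Qed.

(* continuity at 0 of the translations of f, in the square mean *)
Definition tcont f := measurable_fun setT f /\
  forall e : R, (0 < e)%R -> exists2 eta : R, (0 < eta)%R &
    forall h, (`|h| < eta)%R ->
      \int[la]_x ((f (x + h) - f x) ^+ 2)%:E <= e%:E.

Let msqB (u v : 'rV[R]_n -> R) : measurable_fun setT u -> measurable_fun setT v ->
  measurable_fun setT (fun x : 'rV[R]_n => (u x - v x) ^+ 2)%R.
Proof. by move=> mu mv; apply: measurable_funX; exact: measurable_funB. Qed.

Let mshift f h : measurable_fun setT f -> measurable_fun setT (fun x : 'rV[R]_n => f (x + h)%R).
Proof. by move=> mf; exact: measurableT_comp mf (measurable_shift h). Qed.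

(** Closure under mean-square limits. The difference of [g] splits into three; the shifted error has
    the same integral as the unshifted one by translation invariance. Three terms and the factor 3
    from squaring a sum of three explain e / 9. *)
Lemma tcont_approx g : measurable_fun setT g ->
  (forall e : R, (0 < e)%R -> exists2 f, tcont f &
     \int[la]_x ((f x - g x) ^+ 2)%:E <= e%:E) -> tcont g.
Proof.
move=> mg appr; split=> // e e0.
have e9 : (0 < e / 9)%R by rewrite divr_gt0.
have [f [mf /(_ _ e9)[eta eta0 fe]] fg] := appr _ e9.
exists eta => // h /fe fh.
pose a x := ((f (x + h) - g (x + h)) ^+ 2)%R.
pose b x := ((f (x + h) - f x) ^+ 2)%R.
pose c x := ((f x - g x) ^+ 2)%R.
have ma : measurable_fun setT a by apply: msqB; exact: mshift.
have mb : measurable_fun setT b by apply: msqB => //; exact: mshift.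
have mc : measurable_fun setT c by apply: msqB.
have a0 x : (0 <= a x)%R by exact: sqr_ge0.
have b0 x : (0 <= b x)%R by exact: sqr_ge0.
have c0 x : (0 <= c x)%R by exact: sqr_ge0.
have ca : \int[la]_x (a x)%:E = \int[la]_x (c x)%:E.
  by rewrite -(ge0_integral_translation h (f := fun x => (c x)%:E))//; exact/measurable_EFinP.
apply: (@le_trans _ _ (\int[la]_x (3 * (a x + b x + c x))%:E)).
  apply: le_ge0_integral_EFin.
  - by apply: msqB => //; exact: mshift.
  - by apply: measurable_funM => //; do 2 apply: measurable_funD => //.
  - by move=> x; exact: sqr_ge0.
  - move=> x; rewrite /a /b /c.
    have -> : (g (x + h) - g x = - (f (x + h) - g (x + h)) + (f (x + h) - f x) + (f x - g x))%R by ring.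
    set p := (_ - _)%R; set q := (_ - _)%R; set r := (_ - _)%R.
    (* The sum of these three squares is exactly 3(p^2 + q^2 + r^2) - (-p + q + r)^2. *)
    by have := sqr_ge0 (p + q)%R; have := sqr_ge0 (p + r)%R; have := sqr_ge0 (q - r)%R; nra.
rewrite -EFinZl_ge0_integral//; last 2 first.
- by do 2 apply: measurable_funD => //.
- by move=> x; rewrite !addr_ge0.
rewrite EFinD_ge0_integral//; last 2 first.
- exact: measurable_funD.
- by move=> x; rewrite addr_ge0.
rewrite EFinD_ge0_integral// ca.
apply: (@le_trans _ _ (3%:E * ((e / 9)%:E + (e / 9)%:E + (e / 9)%:E))).
  by rewrite lee_pmul2l// !leeD.
by rewrite -!EFinD -EFinM lee_fin; lra.
Qed.

Lemma tcontD f g : tcont f -> tcont g -> tcont (fun x => f x + g x)%R.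
Proof.
move=> [mf cf] [mg cg]; split=> [|e e0]; first exact: measurable_funD.
have e4 : (0 < e / 4)%R by rewrite divr_gt0.
have [a a0 fa] := cf _ e4; have [b b0 gb] := cg _ e4.
exists (Num.min a b) => [|h]; first by rewrite lt_min a0 b0.
rewrite lt_min => /andP[/fa {}fa /gb {}gb].
have m1 : measurable_fun setT (fun x : 'rV[R]_n => (f (x + h) - f x) ^+ 2)%R.
  by apply: msqB => //; exact: mshift.
have m2 : measurable_fun setT (fun x : 'rV[R]_n => (g (x + h) - g x) ^+ 2)%R.
  by apply: msqB => //; exact: mshift.
apply: (@le_trans _ _ (\int[la]_x (2 * ((f (x + h) - f x) ^+ 2 + (g (x + h) - g x) ^+ 2))%:E)).
  apply: le_ge0_integral_EFin.
  - by apply: msqB; [apply: measurable_funD; exact: mshift|exact: measurable_funD].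
  - by apply: measurable_funM => //; exact: measurable_funD.
  - by move=> x; exact: sqr_ge0.
  - move=> x; have := sqr_ge0 (f (x + h) - f x - (g (x + h) - g x))%R; nra.
rewrite -EFinZl_ge0_integral//; last 2 first.
- exact: measurable_funD.
- by move=> x; rewrite addr_ge0// sqr_ge0.
rewrite EFinD_ge0_integral//; try by move=> x; exact: sqr_ge0.
apply: (@le_trans _ _ (2%:E * ((e / 4)%:E + (e / 4)%:E))).
  by rewrite lee_pmul2l// !leeD.
by rewrite -!EFinD -EFinM lee_fin; lra.
Qed.

Lemma tcontZ c f : tcont f -> tcont (fun x => c * f x)%R.
Proof.
move=> [mf cf]; split=> [|e e0]; first exact: measurable_funM.
have c0 : (0 < c ^+ 2 + 1)%R by rewrite ltr_wpDl ?sqr_ge0.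
have [a a0 fa] := cf _ (divr_gt0 e0 c0); exists a => // h /fa {}fa.
under eq_integral => x _ do rewrite -mulrBr exprMn.
have m1 : measurable_fun setT (fun x : 'rV[R]_n => (f (x + h) - f x) ^+ 2)%R.
  by apply: msqB => //; exact: mshift.
rewrite -EFinZl_ge0_integral ?sqr_ge0//; last by move=> x; exact: sqr_ge0.
apply: le_trans (_ : (c ^+ 2)%:E * (e / (c ^+ 2 + 1))%:E <= _).
  by rewrite lee_wpmul2l// lee_fin sqr_ge0.
rewrite -EFinM lee_fin mulrCA ler_piMr ?(ltW e0)//.
by rewrite ler_pdivrMr// mul1r lerDl.
Qed.

Lemma tcontB f g : tcont f -> tcont g -> tcont (fun x => f x - g x)%R.
Proof.
move=> cf cg; have := tcontD cf (tcontZ (-1) cg).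
by under eq_fun do rewrite mulN1r.
Qed.

Lemma tcont0 : tcont (fun=> 0%R).
Proof.
split=> // e e0; exists 1%R => // h _; rewrite integral0_eq ?lee_fin ?ltW// => x _.
by rewrite subrr expr0n.
Qed.

Lemma tcont_sum (I : Type) (s : seq I) (F : I -> 'rV[R]_n -> R) :
  (forall i, tcont (F i)) -> tcont (fun x => \sum_(i <- s) F i x)%R.
Proof.
move=> cF; elim: s => [|i s IH].
  by under eq_fun do rewrite big_nil; exact: tcont0.
by under eq_fun do rewrite big_cons; exact: tcontD.
Qed.

(** With majorant 4 g^2, dominated convergence upgrades pointwise to mean-square convergence, and
    [tcont_approx] concludes. It handles both disjoint unions of sets and limits of simple
    functions. *)
Lemma tcont_dominated (F : nat -> 'rV[R]_n -> R) f g : L2 la g ->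
  (forall k, tcont (F k)) -> (forall x, F k x @[k --> \oo] --> f x) ->
  (forall k x, `|F k x| <= g x)%R -> tcont f.
Proof.
move=> [mg gy] cF Ff Fg.
have mf : measurable_fun setT f.
  by apply: (measurable_fun_cvg (h := F)) => [k|x _]; [exact: (cF k).1|exact: Ff].
have fg x : (`|f x| <= g x)%R.
  apply/ler_addgt0Pr => e e0.
  have /cvgrPdist_lt/(_ _ e0)[k _ /(_ k (leqnn k)) /= ke] := Ff x.
  rewrite (_ : f x = (f x - F k x) + F k x)%R; last by ring.
  by rewrite (le_trans (ler_normD _ _))// addrC lerD// ltW.
apply: tcont_approx => // e e0.
have [] := @dominated_convergence _ _ R la setT measurableT
  (fun k x => ((F k x - f x) ^+ 2)%:E) (fun=> 0) (fun x => (4 * g x ^+ 2)%:E).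
- by move=> k; apply/measurable_EFinP; apply: msqB => //; exact: (cF k).1.
- by [].
- apply: aeW => x _; apply/fine_cvgP; split; first exact: nearW.
  have h : ((F k x - f x) * (F k x - f x))%R @[k --> \oo] --> ((f x - f x) * (f x - f x))%R.
    by apply: cvgM; (apply: cvgB; [exact: Ff|exact: cvg_cst]).
  by rewrite subrr mulr0 in h.
- apply/integrableP; split.
    by apply/measurable_EFinP; apply: measurable_funM => //; exact: measurable_funX.
  rewrite (eq_integral (fun x => (4 * g x ^+ 2)%:E)); last first.
    by move=> x _; rewrite gee0_abs// lee_fin mulr_ge0// sqr_ge0.
  rewrite -EFinZl_ge0_integral//; last 2 first.
  - exact: measurable_funX.
  - by move=> x; exact: sqr_ge0.
  by rewrite lte_mul_pinfty.
- apply: aeW => x k _ /=; rewrite lee_fin ger0_norm ?sqr_ge0//.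
  rewrite -[leLHS]real_normK ?num_real// (_ : 4 * g x ^+ 2 = (g x + g x) ^+ 2)%R; last by ring.
  have gx0 : (0 <= g x)%R by rewrite (le_trans _ (fg x)).
  rewrite lerXn2r ?nnegrE ?addr_ge0//.
  by rewrite (le_trans (ler_normB _ _))// lerD.
move=> _ _; rewrite integral0 => h.
have /fine_cvgP[hf /cvgrPdist_lt/(_ _ e0) he] := h.
have : \forall k \near \oo, \int[la]_x ((F k x - f x) ^+ 2)%:E <= e%:E.
  near=> k; have fk : \int[la]_x ((F k x - f x) ^+ 2)%:E \is a fin_num by near: k.
  rewrite -(fineK fk) lee_fin; apply/ltW/(le_lt_trans (ler_norm _)).
  by rewrite -[ltLHS]normrN -sub0r; near: k.
by move=> [k _ /(_ k (leqnn k)) /= ke]; exists (F k).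
Unshelve. all: by end_near. Qed.

End translation.

Section tcont_L2.
Context {R : realType} (n : nat).
Notation la := (@lebesgue_rV R n).
Implicit Types (f g : 'rV[R]_n -> R) (h : 'rV[R]_n).
Local Open Scope ereal_scope.

Lemma lebesgue_rV_bounded_fin (A : set 'rV[R]_n) (c : R) : measurable A ->
  (forall x, A x -> `|x| <= c)%R -> la A < +oo.
Proof.
move=> mA Ac; apply: le_lt_trans (@lebesgue_rV_ball_fin R n (n%:R * c)).
apply: le_measure; rewrite ?inE//.
  have := @measurable_enorm_itv R n `]-oo, (n%:R * c)%R].
  by congr measurable; apply/seteqP; split => x /=; rewrite in_itv.
move=> x /Ac xc /=; apply: (le_trans (enorm_le_norm x)).
by rewrite ler_wpM2l.
Qed.

(** A shift shorter than 1/(j+1) changes the indicator at x only if x or x + h lies in the strip of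
    points of [U] closer than 1/(j+1) to the complement. As [U] is open these strips shrink to the
    empty set, and finite measure makes their volumes tend to 0. *)
Lemma tcont_open (U : set 'rV[R]_n) : open U -> la U < +oo -> tcont (\1_U : _ -> R).
Proof.
move=> oU Uy; have mU := open_rV_measurable oU.
split; first exact: measurable_indic.
move=> e e0.
pose W j : set 'rV[R]_n := \bigcup_(y in ~` U) ball y (j.+1%:R^-1)%R.
have oW j : open (W j).
  by apply: bigcup_open => y _; apply: ball_open.
have mD j : measurable (U `&` W j).
  by apply: measurableI => //; exact: open_rV_measurable.
have WU : \bigcap_j (U `&` W j) = set0.
  apply/seteqP; split => // x /= Wx.
  have [Ux _] := Wx 0%N I.
  have /nbhs_ballP[r /= r0 xr] : nbhs x U by exact: open_nbhs_nbhs.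
  have := @near_infty_natSinv_lt R (PosNum r0).
  move=> [k _ /(_ k (leqnn k)) /= kr].
  have [_ [y yU]] := Wx k I.
  rewrite -ball_normE /= => yx; apply: yU; apply: xr.
  by rewrite -ball_normE /= distrC (lt_trans yx).
have cvgW : la (U `&` W j) @[j --> \oo] --> 0.
  rewrite -(@measure0 _ _ _ la) -WU; apply: nonincreasing_cvg_mu => //.
  - by apply: le_lt_trans Uy; apply: le_measure; rewrite ?inE//; exact: subIsetl.
  - by apply: bigcapT_measurable.
  - move=> i j ij; apply/subsetPset => x [Ux [y yU xy]]; split=> //; exists y => //.
    by apply: le_ball xy; rewrite lef_pV2 ?posrE// ler_nat.
have e2 : (0 < e / 2)%R by rewrite divr_gt0.
have /fine_cvgP[hf /cvgrPdist_lt/(_ _ e2) he] := cvgW.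
have [j je] : exists j, la (U `&` W j) <= (e / 2)%:E.
  have : \forall j \near \oo, la (U `&` W j) <= (e / 2)%:E.
    near=> j; have fk : la (U `&` W j) \is a fin_num by near: j.
    rewrite -(fineK fk) lee_fin; apply/ltW/(le_lt_trans (ler_norm _)).
    by rewrite -[ltLHS]normrN -sub0r; near: j.
  by move=> [j _ /(_ j (leqnn j)) ?]; exists j.
exists (j.+1%:R^-1)%R => // h hj.
have m1 : measurable_fun setT (fun x : 'rV[R]_n => \1_(U `&` W j) x : R).
  exact: measurable_indic.
have m2 : measurable_fun setT (fun x : 'rV[R]_n => \1_(U `&` W j) (x + h)%R : R).
  exact: measurableT_comp m1 (measurable_shift h).
have inW (x : 'rV[R]_n) k : (`|k| < j.+1%:R^-1)%R -> U x -> ~ U (x + k)%R -> W j x.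
  move=> kj Ux Uxk; exists (x + k)%R => //.
  by rewrite -ball_normE /= addrC addKr.
apply: (@le_trans _ _ (\int[la]_x (\1_(U `&` W j) x + \1_(U `&` W j) (x + h)%R)%:E)).
  apply: le_ge0_integral_EFin.
  - apply: measurable_funX; apply: measurable_funB; last exact: measurable_indic.
    by apply: measurableT_comp (measurable_shift h); exact: measurable_indic.
  - exact: measurable_funD.
  - by move=> x; exact: sqr_ge0.
  - move=> x; rewrite !indicE !in_setI.
    have [Uxh|Uxh] := boolP ((x + h)%R \in U); have [Ux|Ux] := boolP (x \in U);
      rewrite /= ?subrr ?expr0n ?subr0 ?sub0r ?sqrrN ?expr1n ?addr_ge0//.
    + rewrite mem_set ?add0r//; apply: (inW _ (- h)%R); rewrite ?normrN//.
        by rewrite inE in Uxh.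
      by rewrite addrK; move/negP: Ux; rewrite inE.
    + rewrite mem_set ?addr0//.
      apply: (inW _ h) => //; first by rewrite inE in Ux.
      by move/negP: Uxh; rewrite inE.
rewrite EFinD_ge0_integral//.
rewrite (ge0_integral_translation h (f := fun x => (\1_(U `&` W j) x)%:E)) => [||x]; last 2 first.
- exact/measurable_EFinP.
- by rewrite lee_fin.
rewrite integral_indic// setIT (le_trans (leeD je je))//.
by rewrite -EFinD lee_fin -splitr.
Unshelve. all: by end_near. Qed.

(** A ball for the sup norm, that is an open cube. Cutting with it keeps complements of finite
    measure in the Dynkin induction. *)
Let Q (N : nat) : set 'rV[R]_n := ball 0%R N.+1%:R.

Let oQ N : open (Q N).
Proof. by apply: ball_open. Qed.

Let QE N x : Q N x = (`|x| < N.+1%:R)%R.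
Proof. by rewrite /Q -ball_normE /ball_/= sub0r normrN. Qed.

Let mQ N : measurable (Q N).
Proof. exact: open_rV_measurable (@oQ N). Qed.

Let Q_fin N : la (Q N) < +oo.
Proof.
apply: (@lebesgue_rV_bounded_fin _ N.+1%:R); first exact: mQ.
by move=> x; rewrite QE => /ltW.
Qed.

Let L2_Q N : L2 la (\1_(Q N)).
Proof.
split; first by apply: measurable_indic; exact: mQ.
rewrite (eq_integral (fun x => (\1_(Q N) x)%:E)); last first.
  by move=> x _; rewrite indicE; case: (_ \in _); rewrite ?expr1n ?expr0n.
by rewrite integral_indic ?setIT//; exact: Q_fin.
Qed.

(** Dynkin induction from the open sets: inside the cube a complement is a difference of indicators,
    and partial sums over disjoint sets are dominated by the indicator of the cube. *)
Lemma tcont_indic (A : set 'rV[R]_n) N : measurable A ->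
  tcont (\1_(A `&` Q N) : _ -> R).
Proof.
rewrite measurable_rV_open; move: A.
apply: (dynkin_induction (G := @open 'rV[R]_n)).
- exact: measurable_rV_open.
- by move=> ? ? ? ?; exact: openI.
- by rewrite setTI; exact: tcont_open.
- move=> U oU; apply: tcont_open; first exact: openI.
  apply: le_lt_trans (Q_fin N); apply: le_measure; rewrite ?inE//.
    by apply: measurableI; [exact: open_rV_measurable|exact: mQ].
- move=> S mS cS.
  rewrite (_ : \1__ = fun x => \1_(Q N) x - \1_(S `&` Q N) x :> R)%R; last first.
    apply/funext => x; rewrite !indicE !in_setI in_setC.
    by case: (x \in Q N); case: (x \in S); rewrite /= ?subrr ?subr0.
  by apply: tcontB => //; exact: tcont_open.
- move=> F mF tF cF.
  apply: (@tcont_dominated _ _ (fun K x => \sum_(k < K) \1_(F k `&` Q N) x)%R _ (\1_(Q N))) => //.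
  + by move=> K; apply: tcont_sum.
  + move=> x; have [[k0 _ xk]|xF] := pselect ((\bigcup_k F k) x); last first.
      rewrite indicE memNset; last by move=> [].
      rewrite (_ : (fun _ => _) = fun=> 0%R); first exact: cvg_cst.
      apply/funext => K; rewrite big1// => k _; rewrite indicE memNset// => -[Fk _].
      by apply: xF; exists k.
    have sumE K : (k0 < K)%N ->
        (\sum_(k < K) \1_(F k `&` Q N) x = \1_(\bigcup_k F k `&` Q N) x :> R)%R.
      move=> kK; rewrite (bigD1 (Ordinal kK))//= big1 ?addr0.
        rewrite !indicE !in_setI mem_set// [X in (_ = (X && _)%:R)%R]mem_set//.
        by exists k0.
      move=> i ik; rewrite indicE memNset// => -[Fi _].
      move/eqP: ik; apply; apply/val_inj => /=.
      by apply: tF => //; exists x.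
    apply: cvg_near_cst; near=> K; apply: sumE.
    by near: K; exact: nbhs_infty_gt.
  + move=> K x; rewrite ger0_norm ?sumr_ge0//.
    have [k0|nk] := pselect (exists k0, F k0 x).
      have [k xk] := k0.
      have [kK|Kk] := ltnP k K.
        rewrite (bigD1 (Ordinal kK))//= big1 ?addr0.
          by rewrite !indicE in_setI ler_nat; case: (_ \in _).
        move=> i ik; rewrite indicE memNset// => -[Fi _].
        move/eqP: ik; apply; apply/val_inj => /=.
        by apply: tF => //; exists x.
      rewrite big1// => i _; rewrite indicE memNset// => -[Fi _].
      have : k = i by apply: tF => //; exists x.
      by move=> ki; move: Kk; rewrite ki leqNgt ltn_ord.
    rewrite big1// => i _; rewrite indicE memNset// => -[Fi _].
    by apply: nk; exists i.
Unshelve. all: by end_near. Qed.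

Import HBSimple HBNNSimple.

(** Simple functions increase to [f]; cut off by [Q k], each is a finite combination of indicators
    of level sets in a cube, and [f] itself dominates them. *)
Let tcont_ge0 (f : 'rV[R]_n -> R) : L2 la f -> (forall x, 0 <= f x)%R -> tcont f.
Proof.
move=> Lf f0; have [mf _] := Lf.
have mEf : measurable_fun setT (EFin \o f) by exact/measurable_EFinP.
pose F k : {nnsfun 'rV[R]_n >-> R} := nnsfun_approx measurableT mEf k.
have Ff x : (F k x : R) @[k --> \oo] --> f x.
  have /fine_cvgP[_] := @cvg_nnsfun_approx _ _ _ setT measurableT (EFin \o f)
    mEf (fun x _ => ltac:(by rewrite lee_fin)) x I.
  exact.
have Fle k x : (F k x <= f x)%R.
  rewrite -(cvg_lim (@Rhausdorff R) (Ff x)).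
  apply: (@nondecreasing_cvgn_le _ (fun k => F k x : R)).
    by move=> i j ij; exact/lefP/nd_nnsfun_approx.
  by apply/cvg_ex; exists (f x); exact: Ff.
apply: (@tcont_dominated _ _ (fun k x => F k x * \1_(Q k) x)%R _ f) => //.
- move=> k; pose s : seq R := finmap.enum_fset (fset_set (range (F k))).
  rewrite (_ : (fun _ => _) = fun x => \sum_(i < size s)
      s`_i * \1_(F k @^-1` [set s`_i] `&` Q k) x)%R.
    apply: tcont_sum => i; apply: tcontZ; apply: tcont_indic.
    by rewrite -[X in measurable X]setTI; exact: (measurable_funP (F k)).
  apply/funext => x; rewrite [in LHS](fimfunEord (F k)) mulr_suml.
  apply: eq_bigr => i _; rewrite -mulrA; congr (_ * _)%R.
  by rewrite !indicE in_setI; case: (_ \in _); rewrite /= ?mul1r ?mul0r.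
- move=> x; rewrite -[X in _ --> X]mulr1; apply: cvgM; first exact: Ff.
  apply: cvg_near_cst; near=> k; rewrite indicE mem_set// QE.
  have : (`|x| < k%:R)%R by near: k; exact: nbhs_infty_gtr.
  by move=> /lt_le_trans; apply; rewrite ler_nat.
- move=> k x; rewrite ger0_norm; last by rewrite mulr_ge0.
  by rewrite indicE; case: (_ \in _); rewrite ?mulr1 ?mulr0.
Unshelve. all: by end_near. Qed.

Theorem tcont_L2 (f : 'rV[R]_n -> R) : L2 la f -> tcont f.
Proof.
move=> Lf.
have mpos : measurable_fun setT (fun x : 'rV[R]_n => Num.max (f x) 0)%R.
  by apply: measurable_maxr => //; exact: Lf.1.
have mneg : measurable_fun setT (fun x : 'rV[R]_n => Num.max (- f x) 0)%R.
  by apply: measurable_maxr => //; apply: measurable_funN; exact: Lf.1.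
rewrite (_ : f = fun x => Num.max (f x) 0 - Num.max (- f x) 0)%R; last first.
  by apply/funext => x; rewrite /Num.max oppr_lt0; case: ltgtP => [||->]; lra.
apply: tcontB; apply: tcont_ge0.
- by apply: (le_l2 Lf mpos _).1 => x; rewrite ger0_norm ?le_max ?lexx ?orbT//
    ge_max ler_norm normr_ge0.
- by move=> x; rewrite le_max lexx orbT.
- by apply: (le_l2 Lf mneg _).1 => x; rewrite ger0_norm ?le_max ?lexx ?orbT//
    ge_max -normrN ler_norm normr_ge0.
- by move=> x; rewrite le_max lexx orbT.
Qed.

End tcont_L2.

(** * Translations of H^1_0 functions *)

Section test_functions.
Context {R : realType} (n : nat).
Implicit Types (f g : 'rV[R]_n -> R) (x y h : 'rV[R]_n).

Local Notation e_ i := (delta_mx ord0 i : 'rV[R]_n).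

Lemma derive_line f x i (t : R) : derivable f (x + t *: e_ i) (e_ i) ->
  is_derive t 1 (fun s : R => f (x + s *: e_ i)) (partial i f (x + t *: e_ i)).
Proof.
move=> df.
have E : (fun s : R => s^-1 *: (f (x + (s *: 1 + t) *: e_ i) - f (x + t *: e_ i))) =
         (fun s : R => s^-1 *: (f (s *: e_ i + (x + t *: e_ i)) - f (x + t *: e_ i))).
  apply/funext => s; congr (_ *: (f _ - _)).
  by rewrite -[s *: 1]/(s * 1) mulr1 scalerDl addrCA.
apply: DeriveDef.
  by rewrite /derivable /=; move: df; rewrite /derivable -E.
by rewrite /partial /derive -E.
Qed.

(** The one-variable mean value theorem along a coordinate line. Bounding [c] by the size of [a],
    rather than placing it between 0 and [a], covers both signs at once. *)
Lemma MVT_coord f i : continuous f ->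
  (forall x, derivable f x (e_ i)) -> forall x (a : R), exists2 c : R, `|c| <= `|a| &
    f (x + a *: e_ i) - f x = a * partial i f (x + c *: e_ i).
Proof.
move=> cf df x a.
pose psi (s : R) := f (x + s *: e_ i).
have dpsi (t : R) : is_derive t 1 psi (partial i f (x + t *: e_ i)) by exact: derive_line.
have cpsi (A : set R) : {within A, continuous psi}.
  apply: continuous_subspaceT => t.
  by apply/differentiable_continuous/derivable1_diffP; have [] := dpsi t.
have psi0 : psi 0 = f x by rewrite /psi scale0r addr0.
have [a0|a0] := leP 0 a.
  have [c] := MVT_segment a0 (fun t _ => dpsi t) (cpsi _).
  rewrite in_itv/= => /andP[c0 ca]; rewrite psi0 subr0 => ->.
  by exists c; [rewrite !ger0_norm|rewrite mulrC].
have [c] := MVT_segment (ltW a0) (fun t _ => dpsi t) (cpsi _).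
rewrite in_itv/= => /andP[ac c0]; rewrite psi0 sub0r => h.
exists c; first by rewrite !ler0_norm ?lerN2// ltW.
by rewrite -[LHS]opprB h; ring.
Qed.

(** The near-covering form of compactness gives one radius valid around all of [K]; if neither point
    is in [K], both values are 0. *)
Lemma compact_unif g (K : set 'rV[R]_n) : compact K -> continuous g ->
  (forall x, ~ K x -> g x = 0) -> forall e : R, 0 < e ->
  exists2 d : R, 0 < d & forall x y, `|x - y| < d -> `|g x - g y| < e.
Proof.
move=> cK cg gK e e0.
have := (compact_near_coveringP K).1 cK R (0^'+ : set_system R)
  (fun d x => forall y, `|x - y| < d -> `|g x - g y| < e) _.
case.
  move=> x Kx.
  have e2 : 0 < e / 2 by rewrite divr_gt0.
  have /cvgrPdist_lt/(_ _ e2)/nbhs_ballP[r /= r0 xr] := cg x.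
  exists (ball x (r / 2), [set d | d < r / 2]) => /=.
    split; first by apply: nbhsx_ballx; rewrite divr_gt0.
    by apply: nbhs_right_lt; rewrite divr_gt0.
  move=> [x' d] /= [xx' dr] y x'y.
  move: xx'; rewrite -ball_normE /= => xx'.
  have xy : `|x - y| < r.
    rewrite (splitr r) (_ : x - y = (x - x') + (x' - y)); last by rewrite addrA subrK.
    by rewrite (le_lt_trans (ler_normD _ _))// ltrD// (lt_trans x'y).
  have gx : `|g x - g x'| < e / 2.
    apply: xr; rewrite -ball_normE /= (lt_trans xx')//.
    by rewrite ltr_pdivrMr// ltr_pMr// ltr1n.
  have gy : `|g x - g y| < e / 2 by apply: xr; rewrite -ball_normE.
  rewrite (splitr e) (_ : g x' - g y = (g x' - g x) + (g x - g y)); last by ring.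
  by rewrite (le_lt_trans (ler_normD _ _))// ltrD// distrC.
move=> d0 /= d0p Kd.
pose d := d0 / 2.
have d00 : 0 < d by rewrite divr_gt0.
have {}Kd x : K x -> forall y, `|x - y| < d -> `|g x - g y| < e.
  move=> Kx; apply: (Kd d) => //.
  by rewrite /= sub0r normrN gtr0_norm// ltr_pdivrMr// ltr_pMr// ltr1n.
exists d => // x y xy.
have [Kx|nKx] := pselect (K x); first exact: Kd.
have [Ky|nKy] := pselect (K y); first by rewrite distrC; apply: Kd => //; rewrite distrC.
by rewrite !gK// subrr normr0.
Qed.

Lemma partial_out f (K : set 'rV[R]_n) i : closed K ->
  (forall x, ~ K x -> f x = 0) -> forall x, ~ K x -> partial i f x = 0.
Proof.
move=> cK fK x nKx; rewrite /partial /derive; apply/cvg_lim => //.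
have oK : open (~` K) by exact: closed_openC.
have /nbhs_ballP[r /= r0 xr] : nbhs x (~` K) by exact: open_nbhs_nbhs.
apply: cvg_near_cst; near=> s => /=.
rewrite (fK x nKx) subr0 fK ?scaler0//; apply: xr.
rewrite -ball_normE /= opprD addrCA subrr addr0 normrN normrZ.
have e1 : `|e_ i| <= 1.
  rewrite [leLHS]mx_normrE; apply: bigmax_le => // -[a b] _ /=.
  by rewrite mxE; case: (_ && _); rewrite ?normr1 ?normr0.
rewrite (le_lt_trans (ler_wpM2l (normr_ge0 _) e1))// mulr1.
by near: s; exact: dnbhs0_lt.
Unshelve. all: by end_near. Qed.

Lemma bounded_support (K : set 'rV[R]_n) : compact K ->
  exists2 c : R, 0 <= c & forall x, K x -> `|x| <= c.
Proof.
move=> /compact_bounded [c0 [c0r Kc]]; exists (Num.max 0 (c0 + 1)).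
  by rewrite le_max lexx.
by move=> x; apply: Kc; rewrite lt_max ltrDl ltr01 orbT.
Qed.

Let path x h (k : nat) : 'rV[R]_n :=
  \row_i (if (i < k)%N then x ord0 i + h ord0 i else x ord0 i).

(* telescoping along the coordinate directions *)
Lemma test_fun_expansion f (d e : R) h : continuous f ->
  (forall i x, derivable f x (e_ i)) ->
  (forall i x y, `|x - y| < d -> `|partial i f x - partial i f y| <= e) ->
  `|h| < d -> forall x,
  `|f (x + h) - f x - \sum_i h ord0 i * partial i f x| <= (\sum_i `|h ord0 i|) * e.
Proof.
move=> cf df ce hd x.
have -> : f (x + h) - f x = \sum_(i < n) (f (path x h i.+1) - f (path x h i)).
  rewrite -(big_mkord xpredT (fun i => f (path x h i.+1) - f (path x h i))).
  rewrite telescope_sumr//; congr (f _ - f _); apply/rowP => i; rewrite !mxE//.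
  by rewrite ltn_ord.
rewrite -sumrB mulr_suml; apply: le_trans (ler_norm_sum _ _ _) _.
apply: ler_sum => i _.
have pathS : path x h i.+1 = path x h i + h ord0 i *: e_ i.
  apply/rowP => j; rewrite !mxE eqxx/= ltnS.
  have [ji|ij|/val_inj->] := ltngtP j i; rewrite ?eqxx ?leqnn ?mulr1//.
  - by rewrite (_ : j == i = false) ?mulr0 ?addr0//; apply/eqP => e1; rewrite e1 ltnn in ji.
  - by rewrite (_ : j == i = false) ?mulr0 ?addr0//; apply/eqP => e1; rewrite e1 ltnn in ij.
have [c ch] := MVT_coord cf (df i) (path x h i) (h ord0 i).
rewrite -pathS => ->; rewrite -mulrBr normrM ler_wpM2l//.
apply: ce; apply: le_lt_trans hd.
rewrite [leLHS]mx_normrE; apply: bigmax_le => // -[a j] _ /=; rewrite (ord1 a) !mxE eqxx /=.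
have hj : `|h ord0 j| <= `|h|.
  rewrite [leRHS]mx_normrE.
  exact: (@le_bigmax _ _ _ _ (fun ij : 'I_1 * 'I_n => `|h ij.1 ij.2|) (ord0, j)).
have [ji|ij|/val_inj ji] := ltngtP j i.
- rewrite (_ : j == i = false) ?mulr0 ?addr0; last by apply/eqP => e1; rewrite e1 ltnn in ji.
  by rewrite addrAC subrr add0r.
- rewrite (_ : j == i = false) ?mulr0 ?addr0 ?subrr ?normr0//.
  by apply/eqP => e1; rewrite e1 ltnn in ij.
- by subst j; rewrite eqxx mulr1 addrAC subrr add0r (le_trans ch).
Qed.

End test_functions.

Section test_function_L2.
Context {R : realType} (n : nat).
Notation la := (@lebesgue_rV R n).
Implicit Types (f g : 'rV[R]_n -> R) (x y h z : 'rV[R]_n).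

Lemma le_enorm_sum h : `|h| <= \sum_i `|h ord0 i|.
Proof.
rewrite [leLHS]mx_normrE; apply: bigmax_le; first exact: sumr_ge0.
move=> [a i] _ /=; rewrite (ord1 a) (bigD1 i)//= lerDl; exact: sumr_ge0.
Qed.

Lemma measurable_cube (c : R) : measurable [set x : 'rV[R]_n | `|x| <= c].
Proof.
have mn : measurable_fun [set: 'rV[R]_n] (fun x => `|x|).
  by apply: continuous_rV_measurable; exact: norm_continuous.
have := mn measurableT `]-oo, c]%classic (measurable_itv _).
by rewrite setTI; congr measurable; apply/seteqP; split => x /=; rewrite in_itv.
Qed.

Lemma cube_fin (c : R) : (la [set x : 'rV[R]_n | (`|x| <= c)%R] < +oo)%E.
Proof. by apply: (@lebesgue_rV_bounded_fin _ _ _ c) => //; exact: measurable_cube. Qed.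

Lemma L2_compact_support g (K : set 'rV[R]_n) : compact K -> continuous g ->
  (forall x, ~ K x -> g x = 0) -> L2 la g.
Proof.
move=> cK cg gK.
have [c c0 Kc] := bounded_support cK.
have := continuous_compact (continuous_subspaceT cg) cK.
move=> /compact_bounded[M0 [M0r gM]].
pose M := Num.max 0 (M0 + 1).
have {}gM x : K x -> `|g x| <= M.
  by move=> Kx; apply: gM; [rewrite lt_max ltrDl ltr01 orbT|exists x].
apply: (le_l2 (L2Z M (L2_indic (measurable_cube c) (cube_fin c))) _ _).1.
  exact: continuous_rV_measurable.
move=> x; rewrite [leRHS]ger0_norm ?mulr_ge0// ?le_max ?lexx//.
have [Kx|nKx] := pselect (K x); last first.
  by rewrite gK// normr0 mulr_ge0// le_max lexx.
by rewrite indicE mem_set ?mulr1; [exact: gM|exact: Kc].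
Qed.

(** The shift by [z *+ k] telescopes into [k] shifts by [z], all of the same norm by translation
    invariance. This lets a first-order expansion be used only for short steps. *)
Lemma l2_shift_muln f z (k : nat) : L2 la f ->
  l2 la (fun x => f (x + z *+ k) - f x) <= l2 la (fun x => f (x + z) - f x) *+ k.
Proof.
move=> Lf; elim: k => [|k IH].
  by under eq_fun do rewrite mulr0n addr0 subrr; rewrite l2_0.
rewrite (_ : (fun _ => _) = fun x => (f (x + z *+ k + z) - f (x + z *+ k)) +
  (f (x + z *+ k) - f x)); last first.
  by apply/funext => x; rewrite addrA subrK mulrSr addrA.
apply: le_trans (l2_le_add _ _) _.
- by apply: (L2_shift (z *+ k) (f := fun x => f (x + z) - f x)); apply: L2B => //; exact: L2_shift.
- by apply: L2B => //; exact: L2_shift.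
rewrite mulrS lerD// (l2_shift (z *+ k) (f := fun x => f (x + z) - f x))//.
by apply: measurable_funB; [exact: (L2_shift z Lf).1|exact: Lf.1].
Qed.

Lemma common_modulus f (K : set 'rV[R]_n) : compact K ->
  (forall i, continuous (partial i f)) ->
  (forall i x, ~ K x -> partial i f x = 0) -> forall e : R, 0 < e ->
  exists2 d : R, 0 < d &
    forall i x y, `|x - y| < d -> `|partial i f x - partial i f y| <= e.
Proof.
move=> cK cf fK e e0.
have h i := compact_unif cK (cf i) (fK i) e0.
pose d i := projT1 (cid2 (h i)).
have d0 i : 0 < d i by rewrite /d; case: cid2.
have dP i x y : `|x - y| < d i -> `|partial i f x - partial i f y| <= e.
  by rewrite /d; case: cid2 => r r0 hr /= /hr /ltW.
exists (\big[Num.min/1]_i d i); first by apply: lt_bigmin.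
by move=> i x y /lt_le_trans xy; apply: (dP i); apply: xy; exact: bigmin_le_cond.
Qed.

(** Cut [h] into [k] equal steps z. On one step the first-order remainder is uniformly at most eta
    times |h|_1 / k and lives in a fixed cube, so the [k] remainders together stay below any
    prescribed [e], while the linear parts add up to the right-hand side. *)
Lemma l2_shift_test f (K : set 'rV[R]_n) h : compact K -> continuous f ->
  (forall i x, derivable f x (delta_mx ord0 i)) ->
  (forall i, continuous (partial i f)) ->
  (forall x, ~ K x -> f x = 0) ->
  l2 la (fun x => f (x + h) - f x) <=
  l2 la (fun x => \sum_i h ord0 i * partial i f x).
Proof.
move=> cK cf df cdf fK.
have clK : closed K by exact: compact_closed (@norm_hausdorff _ _) cK.
have pK i x : ~ K x -> partial i f x = 0 by exact: partial_out.
have Lf : L2 la f by exact: L2_compact_support cK cf fK.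
have Lp i : L2 la (partial i f) by exact: L2_compact_support cK (cdf i) (pK i).
have [c c0 Kc] := bounded_support cK.
(* One unit of margin: the step [z] is shorter than 1, so for x outside [B] neither x nor x + z
   meets [K] and the remainder vanishes. *)
pose B := [set x : 'rV[R]_n | `|x| <= c + 1].
have LB : L2 la \1_B by apply: L2_indic; [exact: measurable_cube|exact: cube_fin].
pose S := \sum_i `|h ord0 i|.
have S0 : 0 <= S by exact: sumr_ge0.
have b0 := l2_ge0 la \1_B.
apply/ler_addgt0Pr => e e0.
(* The [k] remainders sum to S * eta * l2 of the indicator of [B], hence to at most [e]; the 1 keeps
   the denominator positive. *)
pose eta := e / (S * l2 la \1_B + 1).
have eta0 : 0 < eta by rewrite divr_gt0// ltr_wpDl// mulr_ge0.
have [d d0 dP] := common_modulus cK cdf pK eta0.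
have [M Mh] : exists M : nat, `|h| / M.+1%:R < Num.min d 1.
  have m0 : 0 < Num.min d 1 by rewrite lt_min d0 ltr01.
  exists (Num.truncn (`|h| / Num.min d 1)).
  rewrite ltr_pdivrMr// mulrC -ltr_pdivrMr//; exact: truncnS_gt.
move: Mh; rewrite lt_min => /andP[Md M1].
pose k := M.+1; pose z := k%:R^-1 *: h.
have k0 : 0 < k%:R :> R by rewrite ltr0n.
have zk : z *+ k = h by rewrite -scaler_nat scalerA mulfV ?scale1r// gt_eqF.
have zn : `|z| = `|h| / k%:R by rewrite normrZ mulrC gtr0_norm// invr_gt0.
pose rem x := f (x + z) - f x - \sum_i z ord0 i * partial i f x.
have Lsum (w : 'rV[R]_n) : L2 la (fun x => \sum_i w ord0 i * partial i f x).
  by apply: L2_sum => i; exact: L2Z.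
have remB x : `|rem x| <= `|S / k%:R * eta * \1_B x|.
  rewrite [leRHS]ger0_norm; last first.
    by rewrite mulr_ge0//; apply: mulr_ge0; [exact: divr_ge0|exact: ltW].
  rewrite indicE; have [xB|xB] := boolP (x \in B).
    rewrite mulr1; apply: le_trans (test_fun_expansion cf df dP _ x) _.
      by rewrite zn.
    rewrite ler_wpM2r ?(ltW eta0)// /S mulr_suml; apply: ler_sum => i _.
    by rewrite mxE normrM mulrC normfV normr_nat.
  rewrite mulr0 /rem.
  have xc : c + 1 < `|x| by rewrite ltNge; apply: contra xB => ?; rewrite inE.
  have nKx : ~ K x by move=> /Kc; rewrite leNgt (lt_trans _ xc)// ltrDl.
  have nKxz : ~ K (x + z).
    move=> /Kc xzc; move: xc; rewrite ltNge => /negP; apply.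
    rewrite -(addrK z x) (le_trans (ler_normB _ _))// lerD//.
    by rewrite zn ltW.
  rewrite !fK// big1 ?subrr ?normr0//.
  by move=> i _; rewrite pK// mulr0.
have mrem : measurable_fun setT rem.
  have [mz _] := Lsum z; have [mfz _] := L2_shift z Lf; have [mf _] := Lf.
  by apply: measurable_funB mz; exact: measurable_funB.
have [Lrem lrem] := le_l2 (L2Z (S / k%:R * eta) LB) mrem remB.
rewrite -{1}zk; apply: le_trans (l2_shift_muln z k Lf) _.
have step : l2 la (fun x => f (x + z) - f x) <=
    k%:R^-1 * l2 la (fun x => \sum_i h ord0 i * partial i f x) +
    S / k%:R * eta * l2 la \1_B.
  rewrite (_ : (fun x => f (x + z) - f x) =
    fun x => \sum_i z ord0 i * partial i f x + rem x); last first.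
    by apply/funext => x; rewrite /rem [RHS]addrC subrK.
  apply: le_trans (l2_le_add (Lsum z) Lrem) _; apply: lerD.
    rewrite -[k%:R^-1]gtr0_norm ?invr_gt0// -l2Z//.
    rewrite le_eqVlt; apply/orP; left; apply/eqP; congr (l2 _ _).
    apply/funext => x; rewrite mulr_sumr; apply: eq_bigr => i _.
    by rewrite mxE mulrA.
  apply: (le_trans lrem); rewrite l2Z// ger0_norm//.
  by apply: mulr_ge0; [exact: divr_ge0|exact: ltW].
rewrite -mulr_natl.
apply: (@le_trans _ _ (k%:R * (k%:R^-1 * l2 la (fun x => \sum_i h ord0 i * partial i f x) +
    S / k%:R * eta * l2 la \1_B))).
  by rewrite ler_wpM2l// ltW.
rewrite mulrDr mulrA mulfV ?gt_eqF// mul1r lerD2l.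
rewrite (_ : k%:R * _ = (S * l2 la \1_B) * eta); last first.
  by field; rewrite gt_eqF.
rewrite /eta mulrCA ler_piMr ?(ltW e0)//.
by rewrite ler_pdivrMr ?mul1r ?lerDl// ltr_wpDl// mulr_ge0.
Qed.

End test_function_L2.

Section zero_extension.
Context {R : realType} (n : nat).
Notation la := (@lebesgue_rV R n).
Implicit Types (u v : 'rV[R]_n -> R) (Omega : set 'rV[R]_n).

Lemma L2normE Omega u : L2 la (u \_ Omega) -> L2norm Omega u = l2 la (u \_ Omega).
Proof. by move=> Lu; rewrite /L2norm L2_Lnorm. Qed.

Lemma L2_zero_L2 Omega u : L2_zero Omega u -> L2 la u.
Proof. by move=> [/L2P]. Qed.

Lemma ae_zero_restrict Omega u : L2_zero Omega u ->
  {ae la, forall x, (u \_ Omega) x = u x}.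
Proof.
move=> [_ u0]; apply: filterS u0 => x /= ux0; rewrite patchE.
by case: ifPn => // xO; rewrite ux0//; move/negP: xO; rewrite inE.
Qed.

Lemma L2_restrict Omega u : measurable Omega -> L2 la u -> L2 la (u \_ Omega).
Proof.
move=> mO Lu; apply: (le_l2 Lu _ _).1.
  by apply/(measurable_restrictT _ mO)/measurable_funTS; exact: Lu.1.
by move=> x; rewrite patchE; case: ifP => _ //; rewrite normr0.
Qed.

(** Outside [Omega] the function is 0 almost everywhere, so restriction changes it only on a null
    set. This allows working with translation-invariant norms on the whole space. *)
Lemma L2norm_zero Omega u : measurable Omega -> L2_zero Omega u ->
  L2norm Omega u = l2 la u.
Proof.
move=> mO Lu; have LLu := L2_zero_L2 Lu; have LuO := L2_restrict mO LLu.
rewrite L2normE//; apply: l2_ae_eq (ae_zero_restrict Lu).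
  exact: LuO.1.
exact: LLu.1.
Qed.

End zero_extension.

Section H10_translation.
Context {R : realType} (n : nat).
Notation la := (@lebesgue_rV R n).

Lemma enorm_le_sum (y : 'rV[R]_n) : enorm y <= n%:R * \sum_i `|y ord0 i|.
Proof. by apply: (le_trans (enorm_le_norm y)); rewrite ler_wpM2l// le_enorm_sum. Qed.

(** Passage to the limit in [l2_shift_test] along the approximating test functions; the pointwise
    bound [dotv_le] turns the sum of h_i g_i into |h| times the length of the gradient. *)
Lemma H10_shift (Omega : set 'rV[R]_n) u (h : 'rV[R]_n) : open Omega ->
  H10 Omega u ->
  l2 la (fun x => u (x + h) - u x) <= enorm h * H10norm Omega u.
Proof.
move=> oO [Lu wg [f [tf fu fg]]].
have mO := open_rV_measurable oO.
have LLu := L2_zero_L2 Lu.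
pose G := weak_gradient Omega u.
pose g i : 'rV[R]_n -> R := (fun x => G x ord0 i) \_ Omega.
have Lg i : L2 la (g i) by have [/L2P] := wg i.
have Labs i : L2 la (fun x => `|g i x|).
  apply: (le_l2 (Lg i) _ _).1 => [|x]; last by rewrite normr_id.
  by apply: measurableT_comp => //; exact: (Lg i).1.
have EG x : ((fun x => enorm (G x)) \_ Omega) x = enorm (\row_i g i x).
  rewrite patchE; case: ifPn => xO.
    by congr enorm; apply/rowP => i; rewrite mxE /g patchE xO.
  rewrite (_ : \row_i _ = 0 *: (0 : 'rV[R]_n)); first by rewrite enormZ normr0 mul0r.
  by rewrite scale0r; apply/rowP => i; rewrite !mxE /g patchE (negbTE xO).
have LG : L2 la ((fun x => enorm (G x)) \_ Omega).
  have Ls : L2 la (fun x => n%:R * \sum_i `|g i x|) by apply: L2Z; exact: L2_sum.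
  apply: (le_l2 Ls _ _).1.
    rewrite (_ : _ \_ _ = fun x => enorm (\row_i g i x)); last exact/funext.
    apply: measurableT_comp measurable_enorm _; apply: measurable_fun_rVP => i.
    by under eq_fun do rewrite mxE; exact: (Lg i).1.
  move=> x; rewrite EG ger0_norm ?enorm_ge0// ger0_norm; last first.
    by rewrite mulr_ge0// sumr_ge0.
  apply: (le_trans (enorm_le_sum _)); rewrite ler_wpM2l//.
  by apply: ler_sum => i _; rewrite mxE.
have EH : H10norm Omega u = l2 la ((fun x => enorm (G x)) \_ Omega) by exact: L2normE.
have Ltest k : exists K, [/\ compact K, K `<=` Omega, forall x, ~ K x -> f k x = 0 & continuous (f k)]
   /\ [/\ forall i x, derivable (f k) x (delta_mx ord0 i), forall i, continuous (partial i (f k)) &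
     L2 la (f k)].
  have [sm [K [cK KO fK]]] := tf k.
  have [cf df] := sm [::].
  exists K; split; split=> //.
  - by move=> i; have [] := sm [:: i].
  - exact: L2_compact_support cK cf fK.
pose a k := L2norm Omega (fun x => f k x - u x).
pose b i k := L2norm Omega (fun x => partial i (f k) x - G x ord0 i).
(* The two terms [a k] pay for replacing [u] by [f k] at x and at x + h, the terms [b i k] for
   replacing the weak gradient by the partial derivatives of [f k]. *)
have key k : l2 la (fun x => u (x + h) - u x) <=
   enorm h * H10norm Omega u + \sum_i `|h ord0 i| * b i k + (a k + a k).
  have [K [[cK KO fK cf] [df cdf Lf]]] := Ltest k.
  have pK i x : ~ K x -> partial i (f k) x = 0.
    by apply: partial_out => //; exact: compact_closed (@norm_hausdorff _ _) cK.
  have Lp i : L2 la (partial i (f k)) by exact: L2_compact_support cK (cdf i) (pK i).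
  have LfuL : L2 la (fun x => f k x - u x) by exact: L2B.
  have aE : a k = l2 la (fun x => f k x - u x).
    rewrite /a L2normE; last exact: L2_restrict.
    apply: l2_ae_eq; [exact: (L2_restrict mO LfuL).1|exact: LfuL.1|].
    apply: filterS (ae_zero_restrict Lu) => x /=; rewrite !patchE.
    case: ifPn => // xO <-; rewrite fK ?subr0// => /KO.
    by move/negP: xO; rewrite inE.
  (* The support of [f k] lies in [Omega], so restriction cuts nothing off its partial derivatives
     and norms over [Omega] become norms over the whole space. *)
  have pgE i : (fun x => partial i (f k) x - G x ord0 i) \_ Omega =
      fun x => partial i (f k) x - g i x.
    apply/funext => x; rewrite /g !patchE; case: ifPn => // xO.
    rewrite pK ?subrr// => /KO.
    by move/negP: xO; rewrite inE.
  have Lpg i : L2 la (fun x => partial i (f k) x - g i x) by exact: L2B.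
  have bE i : b i k = l2 la (fun x => partial i (f k) x - g i x).
    by rewrite /b L2normE pgE.
  have Lg' : L2 la (fun x => \sum_i h ord0 i * g i x).
    by apply: L2_sum => i; exact: L2Z.
  have lg : l2 la (fun x => \sum_i h ord0 i * g i x) <= enorm h * H10norm Omega u.
    rewrite EH -(ger0_norm (enorm_ge0 h)) -l2Z//.
    apply: (le_l2 (L2Z _ LG) Lg'.1 _).2 => x.
    rewrite EG normrM ger0_norm ?enorm_ge0// ger0_norm ?enorm_ge0//.
    have := dotv_le h (\row_i g i x); rewrite /dotv.
    by under eq_bigr do rewrite mxE.
  have lp : l2 la (fun x => \sum_i h ord0 i * partial i (f k) x) <=
      enorm h * H10norm Omega u + \sum_i `|h ord0 i| * b i k.
    rewrite (_ : (fun x => _) = fun x => \sum_i h ord0 i * g i x +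
        \sum_i h ord0 i * (partial i (f k) x - g i x)); last first.
      apply/funext => x; rewrite -big_split/=; apply: eq_bigr => i _.
      by rewrite -mulrDr [X in _ = _ * X]addrC subrK.
    apply: le_trans (l2_le_add Lg' _) _; first by apply: L2_sum => i; exact: L2Z.
    apply: lerD => //; apply: le_trans (l2_sum _ _) _ => [i|]; first exact: L2Z.
    by apply: ler_sum => i _; rewrite l2Z// bE.
  have Lfh : L2 la (fun x => f k (x + h) - f k x) by apply: L2B => //; exact: L2_shift.
  have Lfus : L2 la (fun x => f k (x + h) - u (x + h)).
    exact: (L2_shift h (f := fun x => f k x - u x)).
  rewrite (_ : (fun x => _) = fun x => (f k (x + h) - f k x + (f k x - u x)) -
     (f k (x + h) - u (x + h))); last by apply/funext => x; ring.
  apply: le_trans (l2_le_sub (L2D Lfh LfuL) Lfus) _.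
  rewrite (l2_shift h (f := fun x => f k x - u x)) -?aE; last exact: LfuL.1.
  rewrite addrA lerD// aE; apply: le_trans (l2_le_add Lfh LfuL) _.
  rewrite lerD//; apply: le_trans lp.
  exact: l2_shift_test cK cf df cdf fK.
have lim : (enorm h * H10norm Omega u + \sum_i `|h ord0 i| * b i k + (a k + a k)) @[k --> \oo] -->
   enorm h * H10norm Omega u + \sum_(i < n) `|h ord0 i| * 0 + (0 + 0).
  apply: cvgD; last by apply: cvgD.
  apply: cvgD; first exact: cvg_cst.
  apply: cvg_big => [|i _]; first exact: add_continuous. apply: cvgM; first exact: cvg_cst.
  exact: fg.
rewrite big1 ?addr0 in lim; last by move=> i _; rewrite mulr0.
apply: (ler_cvg_to (cvg_cst _) lim); exact: nearW.
Qed.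

End H10_translation.

(** * The translation form and its spherical means *)

Section correlation.
Context {R : realType} (n : nat).
Notation la := (@lebesgue_rV R n).
Implicit Types (u v w : 'rV[R]_n -> R) (x z s : 'rV[R]_n).

(** Agrees with the H of the overview: translating x by z turns x - z into x + z up to a sign change
    in both factors. *)
Definition Hf u v z : R := \int[la]_x ((u x - u (x + z)) * (v x - v (x + z))).

Lemma L2_diff u z : L2 la u -> L2 la (fun x => u x - u (x + z)).
Proof. by move=> Lu; apply: L2B => //; exact: L2_shift. Qed.

Lemma l2_diff u z : L2 la u -> l2 la (fun x => u x - u (x + z)) <= 2 * l2 la u.
Proof.
move=> Lu; apply: (le_trans (l2_le_sub Lu (L2_shift z Lu))).
by rewrite (l2_shift z Lu.1) mulrDl mul1r.
Qed.

Lemma l2_diff_diff u z z' : L2 la u ->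
  l2 la (fun x => u (x + z) - u (x + z')) = l2 la (fun x => u (x + (z - z')) - u x).
Proof.
move=> Lu; rewrite -(l2_shift z' (f := fun x => u (x + (z - z')) - u x)).
  by congr (l2 _ _); apply/funext => x; rewrite -addrA [z' + _]addrC subrK.
by apply: measurable_funB; [exact: (L2_shift (z - z') Lu).1|exact: Lu.1].
Qed.

Lemma Hf_integrable u v z : L2 la u -> L2 la v ->
  la.-integrable setT (fun x => ((u x - u (x + z)) * (v x - v (x + z)))%:E).
Proof.
by move=> Lu Lv; apply: L2M_integrable; exact: L2_diff.
Qed.

(** Each difference has norm at most twice that of its function, whence 4. The absolute value stands
    inside the integral because this version feeds the Tonelli integrability arguments. *)
Lemma Hf_norm u v z : L2 la u -> L2 la v ->
  (\int[la]_x (`|(u x - u (x + z)) * (v x - v (x + z))|)%:E <=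
  (4 * l2 la u * l2 la v)%:E)%E.
Proof.
move=> Lu Lv; apply: (le_trans (cauchy_schwarz (L2_diff z Lu) (L2_diff z Lv))).
rewrite lee_fin (_ : 4 * _ * _ = (2 * l2 la u) * (2 * l2 la v)); last by ring.
by apply: ler_pM; rewrite ?l2_ge0// l2_diff.
Qed.

Lemma Hf_le u v z : L2 la u -> L2 la v -> `|Hf u v z| <= 4 * l2 la u * l2 la v.
Proof.
move=> Lu Lv; apply: (le_trans (cauchy_schwarz_Rintegral (L2_diff z Lu) (L2_diff z Lv))).
rewrite (_ : 4 * _ * _ = (2 * l2 la u) * (2 * l2 la v)); last by ring.
by apply: ler_pM; rewrite ?l2_ge0// l2_diff.
Qed.

(** One factor is changed at a time. The bound depends on z and z' only through z' - z, which is why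
    [Hf_unif] gets a uniform modulus. *)
Lemma Hf_sub u v z z' : L2 la u -> L2 la v ->
  `|Hf u v z - Hf u v z'| <=
   l2 la (fun x => u (x + (z' - z)) - u x) * (2 * l2 la v) +
   (2 * l2 la u) * l2 la (fun x => v (x + (z' - z)) - v x).
Proof.
move=> Lu Lv.
have Luz : L2 la (fun x => u (x + z') - u (x + z)) by apply: L2B; exact: L2_shift.
have Lvz : L2 la (fun x => v (x + z') - v (x + z)) by apply: L2B; exact: L2_shift.
rewrite /Hf -RintegralB//; [|exact: Hf_integrable..].
rewrite (_ : \int[la]_x _ =
  \int[la]_x ((u (x + z') - u (x + z)) * (v x - v (x + z)) +
     (u x - u (x + z')) * (v (x + z') - v (x + z)))); last first.
  by apply: eq_Rintegral => x _; ring.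
rewrite RintegralD//; [|exact: L2M_integrable Luz (L2_diff z Lv)
                       |exact: L2M_integrable (L2_diff z' Lu) Lvz].
apply: le_trans (ler_normD _ _) _; apply: lerD.
  apply: (le_trans (cauchy_schwarz_Rintegral Luz (L2_diff z Lv))).
  by rewrite -l2_diff_diff// ler_wpM2l ?l2_ge0// l2_diff.
apply: (le_trans (cauchy_schwarz_Rintegral (L2_diff z' Lu) Lvz)).
by rewrite -l2_diff_diff// ler_wpM2r ?l2_ge0// l2_diff.
Qed.

Lemma l2_shift_cvg u : L2 la u -> forall e : R, 0 < e ->
  exists2 d : R, 0 < d & forall z, `|z| < d -> l2 la (fun x => u (x + z) - u x) <= e.
Proof.
move=> Lu e e0; have [_ /(_ (e ^+ 2))] := tcont_L2 Lu.
rewrite exprn_gt0// => /(_ isT)[d d0 h]; exists d => // z /h.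
by apply: l2_le; exact: ltW.
Qed.

Lemma Hf_unif u v : L2 la u -> L2 la v -> forall e : R, 0 < e ->
  exists2 d : R, 0 < d & forall z z', `|z - z'| < d -> `|Hf u v z - Hf u v z'| <= e.
Proof.
move=> Lu Lv e e0.
have cu : 0 < 4 * l2 la v + 1 by rewrite ltr_wpDl// mulr_ge0// l2_ge0.
have cv : 0 < 4 * l2 la u + 1 by rewrite ltr_wpDl// mulr_ge0// l2_ge0.
have [d1 d10 h1] := l2_shift_cvg Lu (divr_gt0 e0 cu).
have [d2 d20 h2] := l2_shift_cvg Lv (divr_gt0 e0 cv).
exists (Num.min d1 d2); first by rewrite lt_min d10 d20.
move=> z z'; rewrite distrC lt_min => /andP[/h1 {}h1 /h2 {}h2].
apply: (le_trans (Hf_sub z z' Lu Lv)); rewrite (splitr e); apply: lerD.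
  apply: (@le_trans _ _ (e / (4 * l2 la v + 1) * (2 * l2 la v))).
    by rewrite ler_wpM2r// mulr_ge0// l2_ge0.
  rewrite mulrAC ler_pdivrMr//.
  by have := l2_ge0 la v; nra.
apply: (@le_trans _ _ (2 * l2 la u * (e / (4 * l2 la u + 1)))).
  by rewrite ler_wpM2l// mulr_ge0// l2_ge0.
rewrite mulrA ler_pdivrMr//.
by have := l2_ge0 la u; nra.
Qed.

Lemma Hf_measurable u v : L2 la u -> L2 la v -> measurable_fun setT (Hf u v).
Proof.
move=> Lu Lv; apply: continuous_rV_measurable => z.
move=> A /nbhs_ballP[e /= e0 eA].
have [d d0 h] := Hf_unif Lu Lv (divr_gt0 e0 (ltr0n _ 2)).
apply/nbhs_ballP; exists d => // z'; rewrite -ball_normE => /h {}h.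
by apply: eA; rewrite -ball_normE; apply: le_lt_trans h _; rewrite ltr_pdivrMr// ltr_pMr// ltr1n.
Qed.

Lemma Hf_linearl c u w v z : L2 la u -> L2 la w -> L2 la v ->
  Hf (fun x => c * u x + w x) v z = c * Hf u v z + Hf w v z.
Proof.
move=> Lu Lw Lv; rewrite /Hf -RintegralZl//; last exact: Hf_integrable.
rewrite -RintegralD//; [|exact: integrableZl (Hf_integrable z Lu Lv)|exact: Hf_integrable].
by apply: eq_Rintegral => x _; ring.
Qed.

Lemma HfC u v z : Hf u v z = Hf v u z.
Proof. by apply: eq_Rintegral => x _; rewrite mulrC. Qed.

(* Expanding the product and translating, H(z) = 2<u,v> - <u(. - z) + u(. + z), v>. *)
Lemma HfE u v z : L2 la u -> L2 la v ->
  Hf u v z = \int[la]_x (2 * (u x * v x)) -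
    \int[la]_x ((u (x - z) + u (x + z)) * v x).
Proof.
move=> Lu Lv.
have Luz := L2_shift z Lu; have Lvz := L2_shift z Lv; have LuNz := L2_shift (- z) Lu.
have i1 := L2M_integrable Lu Lv; have i2 := L2M_integrable Lu Lvz.
have i3 := L2M_integrable Luz Lv; have i4 := L2M_integrable Luz Lvz.
have i5 := L2M_integrable LuNz Lv.
have t1 : \int[la]_x (u x * v (x + z)) = \int[la]_x (u (x - z) * v x).
  rewrite /Rintegral -(integral_translation z (f := fun x => (u (x - z) * v x)%:E)); last first.
    by apply/measurable_EFinP; apply: measurable_funM; [exact: LuNz.1|exact: Lv.1].
  by congr fine; apply: eq_integral => x _; rewrite addrK.
have t2 : \int[la]_x (u (x + z) * v (x + z)) = \int[la]_x (u x * v x).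
  rewrite /Rintegral -(integral_translation z (f := fun x => (u x * v x)%:E))//.
  by apply/measurable_EFinP; apply: measurable_funM; [exact: Lu.1|exact: Lv.1].
transitivity (\int[la]_x ((u x * v x + u (x + z) * v (x + z)) -
    (u x * v (x + z) + u (x + z) * v x))).
  by apply: eq_Rintegral => x _; ring.
rewrite RintegralB//; [|exact: (integrableD measurableT i1 i4)|exact: (integrableD measurableT i2 i3)].
rewrite !RintegralD// t1 t2 RintegralZl// mulrDl mul1r; congr (_ - _).
rewrite -RintegralD//; apply: eq_Rintegral => x _; ring.
Qed.

(** In the expansion [HfE] the first integral cancels and all translates fall on [u], so [v]
    contributes only its norm. The two translates of [u] each move by z - z', whence the factor
    2. *)
Lemma Hf_lipschitz u v z z' (D : R) : L2 la u -> L2 la v ->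
  (forall h, l2 la (fun x => u (x + h) - u x) <= enorm h * D) ->
  `|Hf u v z - Hf u v z'| <= 2 * enorm (z - z') * D * l2 la v.
Proof.
move=> Lu Lv uD; rewrite !HfE//.
have sub3 (a b c : R) : a - b - (a - c) = c - b by ring.
rewrite sub3 -RintegralB//; last 2 first.
- by apply: L2M_integrable => //; apply: L2D; exact: L2_shift.
- by apply: L2M_integrable => //; apply: L2D; exact: L2_shift.
have L1 : L2 la (fun x => u (x - z') - u (x - z)) by apply: L2B; exact: L2_shift.
have L2' : L2 la (fun x => u (x + z') - u (x + z)) by apply: L2B; exact: L2_shift.
rewrite (_ : \int[la]_x _ =
  \int[la]_x (((u (x - z') - u (x - z)) + (u (x + z') - u (x + z))) * v x)); last first.
  by apply: eq_Rintegral => x _; ring.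
apply: (le_trans (cauchy_schwarz_Rintegral (L2D L1 L2') Lv)).
rewrite ler_wpM2r ?l2_ge0//; apply: (le_trans (l2_le_add L1 L2')).
rewrite (_ : 2 * _ * D = enorm (z - z') * D + enorm (z - z') * D); last by ring.
apply: lerD.
  rewrite (l2_diff_diff (- z') (- z) Lu); apply: (le_trans (uD _)).
  by rewrite opprK addrC.
rewrite l2_diff_diff//; apply: (le_trans (uD _)).
by rewrite -enormN opprB.
Qed.

End correlation.

Lemma bounded_integrable d (T : measurableType d) (R : realType)
    (m : {measure set T -> \bar R}) (w f : T -> R) (C : R) :
  m.-integrable setT (EFin \o w) -> measurable_fun setT f ->
  (forall x, `|f x| <= C) -> m.-integrable setT (fun x => (w x * f x)%:E).
Proof.
move=> iw mf fC; have mw : measurable_fun setT w.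
  by apply/measurable_EFinP; case/integrableP : iw.
apply: (le_integrable measurableT (g := fun x => (C%:E * (w x)%:E)%E)).
- by apply/measurable_EFinP; exact: measurable_funM.
- move=> x _; rewrite -EFinM !abse_EFin lee_fin !normrM mulrC ler_wpM2r//.
  exact: le_trans (ler_norm _).
- exact: integrableZl.
Qed.

Lemma finite_bounded_integrable d (T : measurableType d) (R : realType)
    (m : {finite_measure set T -> \bar R}) (f : T -> R) (C : R) :
  measurable_fun setT f -> (forall x, `|f x| <= C) ->
  m.-integrable setT (EFin \o f).
Proof.
move=> mf fC; have i1 : m.-integrable setT (EFin \o cst 1).
  by apply: finite_measure_integrable_cst.
have := bounded_integrable i1 mf fC; under eq_fun do rewrite mul1r.
by [].
Qed.

Section sphere_mean.
Context {R : realType} (m : nat).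
Local Notation n := m.+1.
Notation la := (@lebesgue_rV R n).
Notation sg := (@sph R n).
Notation omega := (@sphere_area R n).
Implicit Types (u v w : 'rV[R]_n -> R) (s : 'rV[R]_n).

Definition Gf u v (r : R) : R := \int[sg]_s Hf u v (r *: s).

Lemma sph_cst (c : R) : \int[sg]_s c = c * omega.
Proof. by rewrite Rintegral_cst// -[X in fine X]/(sg setT) sph_setT. Qed.

Lemma omega_ge0 : 0 <= omega.
Proof. by rewrite -lee_fin -sph_setT. Qed.

Lemma Hf_sph_measurable u v r : L2 la u -> L2 la v ->
  measurable_fun setT (fun s => Hf u v (r *: s)).
Proof.
by move=> Lu Lv; apply: measurableT_comp (Hf_measurable Lu Lv) _;
  exact: measurable_scale_pair.
Qed.

Lemma Hf_sph_integrable u v r : L2 la u -> L2 la v ->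
  sg.-integrable setT (fun s => (Hf u v (r *: s))%:E).
Proof.
move=> Lu Lv.
apply: (@finite_bounded_integrable _ _ R sg _ (4 * l2 la u * l2 la v)).
  exact: Hf_sph_measurable.
by move=> s; exact: Hf_le.
Qed.

Lemma sph_ae1 : {ae sg, forall s, enorm s = 1}.
Proof.
exists [set s | enorm s <> 1]; split; last by [].
- have := @measurable_enorm_itv R n `[1, 1] => /measurableC.
  congr measurable; apply/seteqP; split => x /= h e; apply: h.
    by rewrite in_itv/= e lexx.
  by apply/eqP; rewrite eq_le andbC; move: e; rewrite in_itv.
- exact: sph_enorm1.
Qed.

(** The bound is asked for unit vectors only, since [sph] gives no mass to the others. *)
Lemma sph_le (f : 'rV[R]_n -> R) (C : R) : 0 <= C ->
  sg.-integrable setT (EFin \o f) -> (forall s, enorm s = 1 -> `|f s| <= C) ->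
  `|\int[sg]_s f s| <= C * omega.
Proof.
move=> C0 fi fC; apply: (le_trans (le_normr_Rintegral measurableT fi)).
rewrite -sph_cst -lee_fin.
have ni : sg.-integrable setT (EFin \o (fun s => `|f s|)).
  exact: integrable_norm.
rewrite /Rintegral !fineK; last 2 first.
- by apply: integrable_fin_num => //; exact: finite_measure_integrable_cst.
- exact: integrable_fin_num.
apply: ae_ge0_le_integral => //.
- by case/integrableP : ni.
- by apply: filterS sph_ae1 => s /fC fs _; rewrite lee_fin.
Qed.

Lemma Gf_le u v r : L2 la u -> L2 la v ->
  `|Gf u v r| <= 4 * l2 la u * l2 la v * omega.
Proof.
move=> Lu Lv; apply: sph_le; first by rewrite !mulr_ge0 ?l2_ge0.
  exact: Hf_sph_integrable.
by move=> s _; exact: Hf_le.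
Qed.

Lemma Gf_linearl c u w v r : L2 la u -> L2 la w -> L2 la v ->
  Gf (fun x => c * u x + w x) v r = c * Gf u v r + Gf w v r.
Proof.
move=> Lu Lw Lv; have i1 := Hf_sph_integrable r Lu Lv.
have i2 := Hf_sph_integrable r Lw Lv.
rewrite /Gf -RintegralZl// -RintegralD//; last exact: integrableZl i1.
by apply: eq_Rintegral => s _; rewrite Hf_linearl.
Qed.

Lemma GfC u v r : Gf u v r = Gf v u r.
Proof. by apply: eq_Rintegral => s _; rewrite HfC. Qed.

Lemma Gf_lipschitz u v r r' (D : R) : L2 la u -> L2 la v -> 0 <= D ->
  (forall h, l2 la (fun x => u (x + h) - u x) <= enorm h * D) ->
  `|Gf u v r - Gf u v r'| <= 2 * `|r - r'| * D * l2 la v * omega.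
Proof.
move=> Lu Lv D0 uD; have i1 := Hf_sph_integrable r Lu Lv.
have i2 := Hf_sph_integrable r' Lu Lv.
rewrite /Gf -RintegralB//; apply: sph_le.
- by rewrite !mulr_ge0 ?l2_ge0.
- exact: (integrableB measurableT i1 i2).
- move=> s s1; apply: (le_trans (Hf_lipschitz _ _ Lu Lv uD)).
  by rewrite -scalerBl enormZ s1 mulr1.
Qed.

End sphere_mean.

(** * Increments of the energy form *)

Section shear.
Context {R : realType} (n : nat).
Notation la := (@lebesgue_rV R n).
Notation rV := 'rV[R]_n.
Local Open Scope ereal_scope.

Lemma measurable_shear :
  measurable_fun setT (fun p : rV * rV => (p.1, p.1 + p.2)%R).
Proof.
apply/measurable_fun_pairP; split; first exact: measurable_fst.
by apply: measurable_add_pair; [exact: measurable_fst|exact: measurable_snd].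
Qed.

Lemma integral_shift_pair (h : rV * rV -> \bar R) x : measurable_fun setT h ->
  \int[la]_z h (x, x + z)%R = \int[la]_y h (x, y).
Proof.
move=> mh; have mhx := measurableT_comp mh (measurable_pair1 x).
have <- := integral_translation x mhx.
by apply: eq_integral => z _; rewrite addrC.
Qed.

(** Puts the displacement z = x' - x in the outer integral; a radial kernel depends on z alone and
    so leaves the inner one. *)
Lemma ge0_integral_shear (f : rV * rV -> \bar R) : measurable_fun setT f ->
  (forall p, 0 <= f p) ->
  \int[la \x la]_p f p = \int[la]_z \int[la]_x f (x, x + z)%R.
Proof.
move=> mf f0; rewrite (@fubini_tonelli1 _ _ _ _ R la la f)//.
transitivity (\int[la]_x \int[la]_z f (x, x + z)%R).
  by apply: eq_integral => x _; rewrite integral_shift_pair.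
rewrite (@fubini_tonelli _ _ _ _ R la la (fun p => f (p.1, p.1 + p.2)%R))//.
exact: measurableT_comp mf measurable_shear.
Qed.

Lemma integral_shear (f : rV * rV -> \bar R) :
  (la \x la).-integrable setT f ->
  \int[la \x la]_p f p = \int[la]_z \int[la]_x f (x, x + z)%R.
Proof.
move=> fi; have mf : measurable_fun setT f by case/integrableP : fi.
pose g (p : rV * rV) := f (p.1, p.1 + p.2)%R.
have mg : measurable_fun setT g by exact: measurableT_comp mf measurable_shear.
have gi : (la \x la).-integrable setT g.
  apply/(@integrable12ltyP _ _ _ _ R la la g mg); move/(@integrable12ltyP _ _ _ _ R la la f mf) : fi.
  apply: le_lt_trans; rewrite le_eqVlt; apply/orP; left; apply/eqP.
  apply: eq_integral => x _; rewrite /g/=.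
  by apply: (integral_shift_pair (h := fun p => `|f p|)); exact: measurableT_comp.
rewrite -(integral12_prod_meas1 fi) -(Fubini gi).
by apply: eq_integral => x _; rewrite /fubini_F -integral_shift_pair.
Qed.

End shear.

Section annulus.
Context {R : realType} (m : nat).
Local Notation n := m.+1.
Notation mu := (@lebesgue_measure R).
Notation la := (@lebesgue_rV R n).
Notation sg := (@sph R n).
Notation omega := (@sphere_area R n).
Variables (ghat : R -> R) (dmin dmax : R).
Hypothesis dmin0 : 0 < dmin.
Hypothesis g0 : forall x, 0 <= x -> 0 <= ghat x.
Hypothesis mg : measurable_fun setT (fun z : 'rV[R]_n => ghat (enorm z)).
Hypothesis ik : mu.-integrable `]dmin, dmax[ (fun r => (r ^+ m * ghat r)%:E).

(** Cut off to the open interval, where integrability is given. The extension by 0 is integrable on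
    the whole line, so its primitive can be differentiated there; its values at the two endpoints
    are artificial. *)
Definition kap : R -> R := (fun r => r ^+ m * ghat r) \_ `]dmin, dmax[.

Lemma kap_integrable : mu.-integrable setT (EFin \o kap).
Proof.
rewrite (_ : EFin \o kap = (fun r => (r ^+ m * ghat r)%:E) \_ `]dmin, dmax[).
  by rewrite -integrable_mkcond.
by apply/funext => r; rewrite /kap /= !patchE; case: ifP.
Qed.

Definition Kint (d h : R) : R := \int[mu]_(r in `]d, h]) kap r.

(** Restricts the radial function on the space to a coordinate axis, where |r e1| = |r|; hence the
    absolute value. *)
Let mgabs : measurable_fun [set: R] (fun r => ghat `|r|).
Proof.
pose e1 : 'rV[R]_n := delta_mx ord0 ord0.
have e11 : enorm e1 = 1.
  rewrite /enorm /dotv big_ord_recl big1 ?addr0.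
    by rewrite !mxE !eqxx mulr1 sqrtr1.
  by move=> i _; rewrite !mxE /= mulr0.
have me : measurable_fun [set: measurableTypeR R] (fun r : measurableTypeR R => (r : R) *: e1).
  by apply: measurable_scale_pair.
rewrite (_ : (fun r => _) = fun r : R => ghat (enorm (r *: e1))).
  exact: (measurableT_comp mg me).
by apply/funext => r; rewrite enormZ e11 mulr1.
Qed.

(** Half-open like the set difference of [S_set h] and [S_set d]. *)
Definition wgt (d h : R) (z : 'rV[R]_n) : R :=
  \1_(`]d, h]%classic : set R) (enorm z) * ghat (enorm z).

Lemma wgt_ge0 d h z : 0 <= wgt d h z.
Proof. by rewrite mulr_ge0// g0// enorm_ge0. Qed.

Lemma wgt_measurable d h : measurable_fun setT (wgt d h).
Proof.
apply: measurable_funM => //.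
have mi : measurable_fun [set: R] (\1_(`]d, h]%classic : set R) : R -> R).
  by apply: measurable_indic; exact: measurable_itv.
exact: (measurableT_comp mi measurable_enorm).
Qed.

(** A radial weight times a function of the direction: in polar coordinates the two variables
    separate. *)
Lemma annulus_integral (phi : 'rV[R]_n -> R) d h :
  measurable_fun setT phi -> (forall s, 0 <= phi s) ->
  dmin <= d -> h <= dmax ->
  (\int[la]_z (wgt d h z * phi (normalize z))%:E =
  (Kint d h)%:E * \int[sg]_s (phi s)%:E)%E.
Proof.
move=> mphi phi0 dd hh.
have mf : measurable_fun setT (fun z : 'rV[R]_n => wgt d h z * phi (normalize z)).
  apply: measurable_funM; first exact: wgt_measurable.
  exact: measurableT_comp mphi measurable_normalize.
rewrite polar//; last by move=> z; rewrite mulr_ge0// wgt_ge0.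
have mi : measurable_fun [set: R] (\1_(`]d, h]%classic : set R) : R -> R).
  by apply: measurable_indic; exact: measurable_itv.
pose q r := \1_(`]d, h]%classic : set R) r * (r ^+ m * ghat `|r|).
have q0 r : 0 <= q r.
  rewrite /q indicE; have [|_] := boolP (r \in _); last by rewrite mul0r.
  rewrite inE/= in_itv/= mul1r => /andP[dr _].
  by rewrite mulr_ge0 ?g0// exprn_ge0// ltW// (le_lt_trans _ dr)// (le_trans _ dd)// ltW.
have mk : measurable_fun [set: R] (fun r => r ^+ m * ghat `|r|).
  by apply: measurable_funM => //; exact: measurable_funX.
have mq : measurable_fun [set: R] q by exact: measurable_funM.
transitivity (\int[mu]_(r in `]0%R, +oo[) ((q r)%:E * \int[sg]_s (phi s)%:E))%E.
  apply: eq_integral => r; rewrite inE/= in_itv/= andbT => r0.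
  rewrite (_ : q r = r ^+ m * (\1_(`]d, h]%classic : set R) r * ghat r)); last first.
    by rewrite /q gtr0_norm//; ring.
  rewrite [in RHS]EFinM -muleA; congr (_ * _)%E.
  have c0 : 0 <= \1_(`]d, h]%classic : set R) r * ghat r.
    by rewrite mulr_ge0// g0// ltW.
  rewrite EFinZl_ge0_integral//; apply: ge0_ae_eq_integral => //.
  - apply/measurable_EFinP; apply: (measurableT_comp mf).
    exact: measurable_scale_pair.
  - by apply/measurable_EFinP; exact: measurable_funM.
  - by move=> s _; rewrite lee_fin mulr_ge0// wgt_ge0.
  - by move=> s _; rewrite lee_fin mulr_ge0.
  apply: filterS (@sph_ae1 R m) => s s1 _.
  rewrite /wgt /normalize enormZ s1 mulr1 gtr0_norm// scalerA mulVf ?gt_eqF//.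
  by rewrite scale1r.
rewrite ge0_integralZr//; last 3 first.
- by apply/measurable_EFinP/measurable_funTS.
- by move=> r _; rewrite lee_fin.
- by apply: integral_ge0 => s _; rewrite lee_fin.
congr (_ * _)%E.
transitivity (\int[mu]_(r in `]d, h]) (r ^+ m * ghat `|r|)%:E)%E.
  rewrite (@integral_mkindic _ _ _ mu `]0, +oo[%classic).
  rewrite (@integral_mkindic _ _ _ mu `]d, h]%classic).
  apply: eq_integral => r _; congr EFin; rewrite /q !indicE.
  have [|_] := boolP (r \in (`]d, h]%classic : set R)); last by rewrite !mul0r mulr0.
  rewrite inE/= in_itv/= => /andP[dr _]; rewrite mem_set ?mul1r//=.
  by rewrite in_itv/= andbT (le_lt_trans _ dr)// (le_trans _ dd)// ltW.
have ikd : mu.-integrable `]d, h] (EFin \o kap).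
  apply: integrableS kap_integrable => //; exact: measurable_itv.
rewrite /Kint /Rintegral fineK; last first.
  by apply: integrable_fin_num => //; exact: measurable_itv.
(* The endpoint [h] may be [dmax], where [kap] is cut to 0; dropping this null point makes the two
   integrands agree. *)
rewrite -integral_itv_bndo_bndc; last first.
  by apply/measurable_EFinP/measurable_funTS.
rewrite -[RHS]integral_itv_bndo_bndc; last first.
  by case/integrableP : kap_integrable => + _; exact: measurable_funTS.
apply: eq_integral => r; rewrite inE/= in_itv/= => /andP[dr rh].
have r1 : dmin < r by exact: le_lt_trans dr.
rewrite /kap patchE mem_set/=; last by rewrite in_itv/= r1 (lt_le_trans rh).
by rewrite gtr0_norm// (lt_trans dmin0).
Qed.

Lemma integral_wgt d h : dmin <= d -> h <= dmax ->
  (\int[la]_z (wgt d h z)%:E = (Kint d h * omega)%:E)%E.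
Proof.
move=> dd hh; have mc : measurable_fun setT (cst 1 : 'rV[R]_n -> R) by [].
have := @annulus_integral (cst 1) d h mc (fun=> ler01) dd hh.
rewrite (_ : \int[sg]_s _ = omega%:E)%E; last first.
  transitivity (\int[sg]_s (cst 1%:E s))%E; first by [].
  by rewrite integral_cst// mul1e -[LHS]/(sg setT) sph_setT.
rewrite -EFinM => <-.
by apply: eq_integral => z _; rewrite mulr1.
Qed.

Lemma wgt_integrable d h : dmin <= d -> h <= dmax ->
  la.-integrable setT (EFin \o wgt d h).
Proof.
move=> dd hh; apply/integrableP; split.
  by apply/measurable_EFinP; exact: wgt_measurable.
rewrite (eq_integral (fun z => (wgt d h z)%:E)); last first.
  by move=> z _ /=; rewrite ger0_norm// wgt_ge0.
by rewrite integral_wgt// ltry.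
Qed.

Lemma integral_wgt_mean u v (delta d h : R) : L2 la u -> L2 la v ->
  dmin <= d -> h <= dmax ->
  \int[la]_z (wgt d h z * Hf u v (delta *: normalize z)) =
  Kint d h * Gf u v delta.
Proof.
move=> Lu Lv dd hh.
pose C := 4 * l2 la u * l2 la v.
have C0 : 0 <= C by rewrite !mulr_ge0 ?l2_ge0.
(* [annulus_integral] concerns nonnegative functions. The bound [C] is added to reach that case and
   subtracted again by linearity. *)
pose phi s := Hf u v (delta *: s) + C.
have phi0 s : 0 <= phi s.
  have := Hf_le (delta *: s) Lu Lv; rewrite -/C ler_norml => /andP[h1 _].
  by rewrite /phi -lerBlDr sub0r.
have mH : measurable_fun setT (fun s : 'rV[R]_n => Hf u v (delta *: s)).
  exact: Hf_sph_measurable.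
have mHn : measurable_fun setT (fun z : 'rV[R]_n => Hf u v (delta *: normalize z)).
  exact: measurableT_comp mH measurable_normalize.
have mphi : measurable_fun setT phi by exact: measurable_funD.
have iw := wgt_integrable dd hh.
have iwH : la.-integrable setT (fun z => (wgt d h z * Hf u v (delta *: normalize z))%:E).
  by apply: (bounded_integrable iw mHn) => z; exact: Hf_le.
have e1 := annulus_integral mphi phi0 dd hh.
have iH := Hf_sph_integrable delta Lu Lv.
have iC : sg.-integrable setT (EFin \o cst C) by apply: finite_measure_integrable_cst.
have ephi : \int[sg]_s phi s = Gf u v delta + C * omega.
  by rewrite /phi RintegralD// sph_cst.
have ephiE : (\int[sg]_s (phi s)%:E)%E = (Gf u v delta + C * omega)%:E.
  rewrite -ephi /Rintegral fineK//; apply: integrable_fin_num => //.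
  exact: (integrableD measurableT iH iC).
have e2 : \int[la]_z (wgt d h z * phi (normalize z)) = Kint d h * (Gf u v delta + C * omega).
  by rewrite /Rintegral e1 ephiE -EFinM.
have e3 : \int[la]_z (wgt d h z * C) = Kint d h * omega * C.
  by rewrite RintegralZr// /Rintegral integral_wgt.
have : \int[la]_z (wgt d h z * phi (normalize z)) =
    \int[la]_z (wgt d h z * Hf u v (delta *: normalize z)) + \int[la]_z (wgt d h z * C).
  rewrite -RintegralD//.
    by apply: eq_Rintegral => z _; rewrite mulrDr.
  by apply: (bounded_integrable (C := C) iw) => // z; rewrite ger0_norm.
by rewrite e2 e3 => h1; apply: (addIr (Kint d h * omega * C)); rewrite -h1; ring.
Qed.

End annulus.

Section annulus_form.
Context {R : realType} (m : nat).
Local Notation n := m.+1.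
Notation mu := (@lebesgue_measure R).
Notation la := (@lebesgue_rV R n).
Notation sg := (@sph R n).
Notation omega := (@sphere_area R n).
Variables (ghat : R -> R) (dmin dmax : R).
Hypothesis dmin0 : 0 < dmin.
Hypothesis g0 : forall x, 0 <= x -> 0 <= ghat x.
Hypothesis mg : measurable_fun setT (fun z : 'rV[R]_n => ghat (enorm z)).
Hypothesis ik : mu.-integrable `]dmin, dmax[ (fun r => (r ^+ m * ghat r)%:E).
Variables (u v : 'rV[R]_n -> R).
Hypotheses (Lu : L2 la u) (Lv : L2 la v).

Definition form_fun (p : 'rV[R]_n * 'rV[R]_n) : R :=
  (u p.1 - u p.2) * (v p.1 - v p.2) * ghat (enorm (p.1 - p.2)).

Definition ring_fun (d h : R) (p : 'rV[R]_n * 'rV[R]_n) : R :=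
  \1_(`]d, h]%classic : set R) (enorm (p.1 - p.2)) * form_fun p.

Lemma measurable_pair_dist :
  measurable_fun setT (fun p : 'rV[R]_n * 'rV[R]_n => enorm (p.1 - p.2)).
Proof.
apply: measurableT_comp measurable_enorm _; apply: measurable_fun_rVP => i.
under eq_fun do rewrite !mxE.
by apply: measurable_funB;
  [exact: measurableT_comp (measurable_rV_coord i) measurable_fst
  |exact: measurableT_comp (measurable_rV_coord i) measurable_snd].
Qed.

Lemma form_fun_measurable : measurable_fun setT form_fun.
Proof.
apply: measurable_funM; last first.
  pose sub (p : 'rV[R]_n * 'rV[R]_n) := p.1 - p.2.
  have ms : measurable_fun setT sub.
    apply: measurable_fun_rVP => i; under eq_fun do rewrite !mxE.
    by apply: measurable_funB;
      [exact: measurableT_comp (measurable_rV_coord i) measurable_fst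
      |exact: measurableT_comp (measurable_rV_coord i) measurable_snd].
  exact: (measurableT_comp mg ms).
apply: measurable_funM; apply: measurable_funB.
- exact: measurableT_comp Lu.1 measurable_fst.
- exact: measurableT_comp Lu.1 measurable_snd.
- exact: measurableT_comp Lv.1 measurable_fst.
- exact: measurableT_comp Lv.1 measurable_snd.
Qed.

Lemma ring_fun_measurable d h : measurable_fun setT (ring_fun d h).
Proof.
apply: measurable_funM form_fun_measurable.
have mi : measurable_fun [set: R] (\1_(`]d, h]%classic : set R) : R -> R).
  by apply: measurable_indic; exact: measurable_itv.
exact: (measurableT_comp mi measurable_pair_dist).
Qed.

Lemma ring_fun_shear d h x z : ring_fun d h (x, x + z) =
  wgt ghat d h z * ((u x - u (x + z)) * (v x - v (x + z))).
Proof.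
rewrite /ring_fun /form_fun /wgt /= opprD addrA subrr sub0r enormN.
by ring.
Qed.

(** The annulus stays away from the diagonal, where the kernel may be singular. After the shear,
    [Hf_norm] bounds the inner integral uniformly and the weight has finite mass, so square
    integrability of [u] and [v] suffices. *)
Lemma ring_fun_integrable d h : dmin <= d -> h <= dmax ->
  (la \x la)%E.-integrable setT (EFin \o ring_fun d h).
Proof.
move=> dd hh; apply/integrableP; split.
  by apply/measurable_EFinP; exact: ring_fun_measurable.
rewrite ge0_integral_shear//; last first.
  by apply/measurableT_comp => //; apply/measurable_EFinP; exact: ring_fun_measurable.
pose C := 4 * l2 la u * l2 la v.
have C0 : 0 <= C by rewrite !mulr_ge0 ?l2_ge0.
apply: (@le_lt_trans _ _ (\int[la]_z (C * wgt ghat d h z)%:E)%E); last first.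
  rewrite -EFinZl_ge0_integral//; last 2 first.
  - exact: wgt_measurable.
  - by move=> z; exact: wgt_ge0.
  by rewrite (integral_wgt dmin0 g0 mg ik)// -EFinM ltry.
apply: ge0_le_integral => //.
- by move=> z _; exact: integral_ge0.
- apply: (@measurable_fun_fubini_tonelli_F _ _ _ _ R la
    (fun p : 'rV[R]_n * 'rV[R]_n => `|(ring_fun d h (p.2, p.2 + p.1)%R)%:E|)%E) => //.
  apply/measurableT_comp => //; apply/measurable_EFinP.
  apply: (measurableT_comp (ring_fun_measurable d h)).
  apply/measurable_fun_pairP; split; first exact: measurable_snd.
  by apply: measurable_add_pair; [exact: measurable_snd|exact: measurable_fst].
- by apply/measurable_EFinP; apply: measurable_funM => //; exact: wgt_measurable.
move=> z _.
rewrite (eq_integral (fun x => (wgt ghat d h z *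
    `|(u x - u (x + z)) * (v x - v (x + z))|)%:E)); last first.
  move=> x _; rewrite /= ring_fun_shear normrM.
  by rewrite ger0_norm// wgt_ge0.
rewrite -EFinZl_ge0_integral ?wgt_ge0//; last first.
  apply: measurableT_comp => //.
  by apply: measurable_funM; [exact: (L2_diff z Lu).1|exact: (L2_diff z Lv).1].
rewrite [leRHS](_ : _ = (wgt ghat d h z)%:E * C%:E)%E; last first.
  by rewrite -EFinM mulrC.
by rewrite lee_wpmul2l ?lee_fin ?wgt_ge0// Hf_norm.
Qed.

Lemma wgt_Hf_integrable d h : dmin <= d -> h <= dmax ->
  la.-integrable setT (fun z => (wgt ghat d h z * Hf u v z)%:E).
Proof.
move=> dd hh.
apply: (bounded_integrable (wgt_integrable dmin0 g0 mg ik dd hh) (Hf_measurable Lu Lv)) => z.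
exact: Hf_le.
Qed.

Lemma integral_ring_fun d h : dmin <= d -> h <= dmax ->
  \int[(la \x la)%E]_p ring_fun d h p = \int[la]_z (wgt ghat d h z * Hf u v z).
Proof.
move=> dd hh; congr fine; rewrite (integral_shear (ring_fun_integrable dd hh)).
apply: eq_integral => z _.
rewrite (eq_integral (fun x => ((wgt ghat d h z)%:E *
    ((u x - u (x + z)) * (v x - v (x + z)))%:E)%E)); last first.
  by move=> x _; rewrite /= ring_fun_shear EFinM.
have iz := Hf_integrable z Lu Lv.
rewrite integralZl// [RHS]EFinM; congr (_ * _)%E.
by rewrite /Hf /Rintegral fineK//; exact: integrable_fin_num.
Qed.

(* On the annulus H(z) is close to H(delta z / |z|), whose integral factors in polar coordinates. *)
Lemma ring_fun_estimate (delta d h e eta : R) :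
  dmin <= d -> d <= delta -> delta <= h -> h <= dmax -> h - d < eta -> 0 <= e ->
  (forall z z', `|z - z'| < eta -> `|Hf u v z - Hf u v z'| <= e) ->
  `|\int[(la \x la)%E]_p ring_fun d h p - Kint m ghat dmin dmax d h * Gf u v delta| <=
   e * omega * Kint m ghat dmin dmax d h.
Proof.
move=> dd ddel delh hh hd e0 He.
rewrite integral_ring_fun// -(integral_wgt_mean dmin0 g0 mg ik delta Lu Lv dd hh).
have iw := wgt_integrable dmin0 g0 mg ik dd hh.
have iwH := wgt_Hf_integrable dd hh.
have mHn : measurable_fun setT (fun z : 'rV[R]_n => Hf u v (delta *: normalize z)).
  exact: measurableT_comp (Hf_sph_measurable delta Lu Lv) measurable_normalize.
have iwHn : la.-integrable setT (fun z => (wgt ghat d h z * Hf u v (delta *: normalize z))%:E).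
  by apply: (bounded_integrable iw mHn) => z; exact: Hf_le.
rewrite -RintegralB//.
have ie : la.-integrable setT (EFin \o (fun z => wgt ghat d h z * e)).
  by apply: (bounded_integrable (C := e) iw) => // z; rewrite ger0_norm.
have iB := integrableB measurableT iwH iwHn.
apply: (le_trans (le_normr_Rintegral measurableT iB)).
have -> : e * omega * Kint m ghat dmin dmax d h = \int[la]_z (wgt ghat d h z * e).
  by rewrite RintegralZr// /Rintegral (integral_wgt dmin0 g0 mg ik)//=; ring.
apply: le_Rintegral => //; first exact: integrable_norm iB.
move=> z _; rewrite /= -mulrBr normrM ger0_norm ?wgt_ge0//.
have [->|wz] := eqVneq (wgt ghat d h z) 0; first by rewrite !mul0r.
rewrite ler_wpM2l ?wgt_ge0//; apply: He.
have : enorm z \in (`]d, h]%classic : set R).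
  by apply: contraNT wz => zdh; rewrite /wgt indicE (negbTE zdh) mul0r.
rewrite inE/= in_itv/= => /andP[dz zh].
have z0 : 0 < enorm z by rewrite (le_lt_trans _ dz)// (le_trans _ dd)// ltW.
(* The points z and delta z / |z| lie on one ray, so their distance is the gap between |z| and
   [delta], at most h - d. *)
rewrite -{1}(normalizeK z0) -scalerBl.
apply: le_lt_trans (norm_le_enorm _) _.
rewrite enormZ enorm_normalize// mulr1; apply: le_lt_trans hd.
by rewrite ler_norml; apply/andP; split; lra.
Qed.

End annulus_form.

(** * Differentiability in the horizon *)

Section form_derivative.
Context {R : realType} (m : nat).
Local Notation n := m.+1.
Notation mu := (@lebesgue_measure R).
Notation la := (@lebesgue_rV R n).
Notation omega := (@sphere_area R n).
Variables (ghat : R -> R) (dmin dmax : R).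
Hypothesis dmin0 : 0 < dmin.
Hypothesis g0 : forall x, 0 <= x -> 0 <= ghat x.
Hypothesis mg : measurable_fun setT (fun z : 'rV[R]_n => ghat (enorm z)).
Hypothesis ik : mu.-integrable `]dmin, dmax[ (fun r => (r ^+ m * ghat r)%:E).
Variables (dstar : R).
Hypothesis hdstar : dstar \in `[dmin, dmax].

Implicit Types (u v w : 'rV[R]_n -> R) (p : 'rV[R]_n * 'rV[R]_n) (d h e eta delta k : R).
Local Notation K := (Kint m ghat dmin dmax).
Local Notation kap := (kap m ghat dmin dmax).

Definition S_fun u v (d : R) (p : 'rV[R]_n * 'rV[R]_n) : R :=
  \1_(S_set d) p * form_fun ghat u v p.

(** What membership in [Vspace] at the reference horizon supplies to the differentiation
    argument. *)
Definition finite_energy u := L2 la u /\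
  (\int[(la \x la)%E]_(p in S_set dstar) (form_fun ghat u u p)%:E < +oo)%E.

Lemma S_set_measurable (d : R) : measurable (S_set d : set ('rV[R]_n * 'rV[R]_n)).
Proof.
have := @measurable_pair_dist R m measurableT `]-oo, d]%classic (measurable_itv _).
by rewrite setTI; congr measurable; apply/seteqP; split => x /=; rewrite in_itv.
Qed.

Lemma S_fun_measurable u v d : L2 la u -> L2 la v -> measurable_fun setT (S_fun u v d).
Proof.
move=> Lu Lv; apply: measurable_funM; last exact: form_fun_measurable.
exact: measurable_indic (S_set_measurable d).
Qed.

Lemma S_fun_split u v d h p : d <= h ->
  S_fun u v h p = S_fun u v d p + ring_fun ghat u v d h p.
Proof.
move=> dh; rewrite /S_fun /ring_fun -mulrDl; congr (_ * _); rewrite !indicE.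
rewrite (_ : (p \in S_set h) = (enorm (p.1 - p.2) <= h)); last first.
  by apply/idP/idP; rewrite inE.
rewrite (_ : (p \in S_set d) = (enorm (p.1 - p.2) <= d)); last first.
  by apply/idP/idP; rewrite inE.
rewrite (_ : (_ \in (`]d, h]%classic : set R)) = (d < enorm (p.1 - p.2) <= h)); last first.
  by apply/idP/idP; rewrite inE/= in_itv.
have [xd|dx] := leP; last by rewrite /= add0r.
by rewrite (le_trans xd dh)/= addr0.
Qed.

Lemma form_fun_ge0 u p : 0 <= form_fun ghat u u p.
Proof. by rewrite /form_fun mulr_ge0 ?g0 ?enorm_ge0// -expr2 sqr_ge0. Qed.

Lemma S_fun_ge0 u d p : 0 <= S_fun u u d p.
Proof. by rewrite /S_fun mulr_ge0// form_fun_ge0. Qed.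

(** The horizon [d] may exceed [dstar]. An integrable annulus extends finite energy from [dstar] up
    to [dmax], and |ab| <= a^2 + b^2 passes from the quadratic to the bilinear integrand. *)
Lemma S_fun_integrable u v d : finite_energy u -> finite_energy v ->
  d <= dmax -> (la \x la)%E.-integrable setT (EFin \o S_fun u v d).
Proof.
have [ds1 ds2] : dmin <= dstar /\ dstar <= dmax.
  by move: hdstar; rewrite in_itv/= => /andP.
have star w : finite_energy w ->
    (la \x la)%E.-integrable setT (EFin \o S_fun w w dmax).
  move=> [Lw wy].
  have i1 : (la \x la)%E.-integrable setT (EFin \o S_fun w w dstar).
    apply/integrableP; split; first by apply/measurable_EFinP; exact: S_fun_measurable.
    rewrite (eq_integral (fun p => (S_fun w w dstar p)%:E)); last first.
      by move=> p _ /=; rewrite ger0_norm// S_fun_ge0.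
    by rewrite /S_fun -integral_mkindic.
  have i2 := ring_fun_integrable dmin0 g0 mg ik Lw Lw ds1 (lexx dmax).
  rewrite (_ : EFin \o _ = (EFin \o S_fun w w dstar) \+
      (EFin \o ring_fun ghat w w dstar dmax))%E.
    exact: integrableD.
  by apply/funext => p; rewrite /= (S_fun_split _ _ _ ds2).
move=> Vu Vv dd.
apply: (le_integrable measurableT _ _ (integrableD measurableT (star _ Vu) (star _ Vv))).
  by apply/measurable_EFinP; apply: S_fun_measurable; [exact: Vu.1|exact: Vv.1].
move=> p _ /=; rewrite lee_fin [leRHS]ger0_norm ?addr_ge0 ?S_fun_ge0//.
have g1 : 0 <= ghat (enorm (p.1 - p.2)) by rewrite g0// enorm_ge0.
rewrite /S_fun -mulrDr normrM ger0_norm//.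
apply: (@le_trans _ _ (\1_(S_set d) p * (form_fun ghat u u p + form_fun ghat v v p))).
  rewrite ler_wpM2l// /form_fun -mulrDl normrM (ger0_norm g1) ler_wpM2r//.
  rewrite ler_norml.
  set a := u _ - u _; set b := v _ - v _.
  by have := sqr_ge0 (a + b); have := sqr_ge0 (a - b); nra.
rewrite ler_wpM2r ?addr_ge0 ?form_fun_ge0// !indicE.
have [pd|_] := boolP (p \in S_set d); last by [].
by rewrite mem_set//=; move: pd; rewrite inE => /le_trans; apply.
Qed.

Definition nonlocal_form u v d := \int[(la \x la)%E]_(p in S_set d) form_fun ghat u v p.

Lemma nonlocal_formE u v d : nonlocal_form u v d = \int[(la \x la)%E]_p S_fun u v d p.
Proof. by rewrite /nonlocal_form /Rintegral integral_mkindic. Qed.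

Lemma nonlocal_form_diff u v d h : finite_energy u -> finite_energy v ->
  dmin <= d -> d <= h -> h <= dmax ->
  nonlocal_form u v h - nonlocal_form u v d = \int[(la \x la)%E]_p ring_fun ghat u v d h p.
Proof.
move=> Vu Vv dd dh hh; rewrite !nonlocal_formE.
have i1 := S_fun_integrable Vu Vv (le_trans dh hh).
have i2 := ring_fun_integrable dmin0 g0 mg ik Vu.1 Vv.1 dd hh.
rewrite (_ : \int[_]_p S_fun u v h p =
   \int[(la \x la)%E]_p (S_fun u v d p + ring_fun ghat u v d h p)).
  by rewrite RintegralD// addrC addKr.
by apply: eq_Rintegral => p _; exact: S_fun_split.
Qed.

(* difference quotient at [delta] of a primitive of [kap] *)
Definition Kquot (delta h : R) : R :=
  K (Num.min delta h) (Num.max delta h) / `|h - delta|.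

Lemma form_quotient u v (delta e eta h : R) : finite_energy u -> finite_energy v ->
  0 <= e ->
  (forall z z', `|z - z'| < eta -> `|Hf u v z - Hf u v z'| <= e) ->
  delta \in `[dmin, dmax] -> h \in `[dmin, dmax] -> h != delta -> `|h - delta| < eta ->
  `|(nonlocal_form u v h - nonlocal_form u v delta) / (h - delta) - Kquot delta h * Gf u v delta|
    <= e * omega * Kquot delta h.
Proof.
move=> Vu Vv e0 He; rewrite !in_itv/= => /andP[d1 d2] /andP[h1 h2] hd hdeta.
have hd0 : 0 < `|h - delta| by rewrite normr_gt0 subr_eq0.
rewrite /Kquot; have [dh|hd'] := leP delta h.
  have est := ring_fun_estimate dmin0 g0 mg ik Vu.1 Vv.1 d1 (lexx delta) dh h2
    (le_lt_trans (ler_norm _) hdeta) e0 He.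
  rewrite -nonlocal_form_diff// in est.
  have p : `|h - delta| = h - delta by rewrite ger0_norm// subr_ge0.
  rewrite p in hd0 *; rewrite mulrAC -mulrBl normrM [`|_^-1|]gtr0_norm ?invr_gt0//.
  by rewrite mulrA ler_wpM2r// invr_ge0 ltW.
have est := ring_fun_estimate (delta := delta) (h := delta) (d := h) (e := e) (eta := eta)
   dmin0 g0 mg ik Vu.1 Vv.1 h1 (ltW hd') (lexx _) d2.
have p : `|h - delta| = delta - h by rewrite distrC ger0_norm// subr_ge0 ltW.
rewrite -p in est; have {}est := est hdeta e0 He.
rewrite -nonlocal_form_diff// in est; last exact: ltW.
have -> : (nonlocal_form u v h - nonlocal_form u v delta) / (h - delta) =
   (nonlocal_form u v delta - nonlocal_form u v h) / `|h - delta|.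
  by rewrite p -[in LHS]opprB -(opprB delta h) invrN mulrNN.
rewrite mulrAC -mulrBl normrM [`|_^-1|]gtr0_norm ?invr_gt0//.
by rewrite mulrA ler_wpM2r// invr_ge0 ltW.
Qed.

(** All dependence on the regularity of the kernel is isolated in the convergence of [Kquot] to [k],
    so continuity points and almost every point are treated by the same argument. *)
Lemma form_derivative u v (delta k : R) : finite_energy u -> finite_energy v ->
  delta \in `[dmin, dmax] ->
  (forall e : R, 0 < e -> exists2 eta : R, 0 < eta & forall h, h \in `[dmin, dmax] ->
     h != delta -> `|h - delta| < eta -> `|Kquot delta h - k| <= e) ->
  has_derivative_within dmin dmax (nonlocal_form u v) delta (k * Gf u v delta).
Proof.
move=> Vu Vv hdelta Hk; apply/cvgrPdist_le => e e0.
have c1 : 0 < 2 * (omega * (`|k| + 1) + 1).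
  by rewrite mulr_gt0// ltr_wpDl// mulr_ge0 ?omega_ge0// addr_ge0.
have c2 : 0 < 2 * (`|Gf u v delta| + 1) by rewrite mulr_gt0// ltr_wpDl.
have [r1 r10 H1] := Hf_unif Vu.1 Vv.1 (divr_gt0 e0 c1).
(* The 1 in the minimum yields Kquot <= |k| + 1, the bound built into the first constant above. *)
have e20 : 0 < Num.min 1 (e / (2 * (`|Gf u v delta| + 1))).
  by rewrite lt_min ltr01 divr_gt0.
have [r2 r20 H2] := Hk _ e20.
rewrite near_withinE; apply/nbhs_ballP; exists (Num.min r1 r2) => /=.
  by rewrite lt_min r10 r20.
move=> h; rewrite -ball_normE/= distrC lt_min => /andP[hr1 hr2] hd /= hI.
have hI' : h \in `[dmin, dmax] by rewrite in_itv.
have A1 := form_quotient Vu Vv (ltW (divr_gt0 e0 c1)) H1 hdelta hI' hd hr1.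
have A2 := H2 h hI' hd hr2.
move: A2; rewrite le_min => /andP[A2 A3].
have Kq : Kquot delta h <= `|k| + 1.
  by move: A2; rewrite ler_norml => /andP[_]; have := ler_norm k; lra.
set q := (nonlocal_form u v h - nonlocal_form u v delta) / (h - delta) in A1 *.
have -> : k * Gf u v delta - q =
   (k - Kquot delta h) * Gf u v delta - (q - Kquot delta h * Gf u v delta) by ring.
apply: le_trans (ler_normB _ _) _; rewrite (splitr e); apply: lerD.
  rewrite normrM distrC.
  apply: (@le_trans _ _ (e / (2 * (`|Gf u v delta| + 1)) * `|Gf u v delta|)).
    by rewrite ler_wpM2r.
  rewrite mulrAC ler_pdivrMr//; have := normr_ge0 (Gf u v delta); nra.
apply: (le_trans A1).
apply: (@le_trans _ _ (e / (2 * (omega * (`|k| + 1) + 1)) * omega * (`|k| + 1))).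
  by rewrite ler_wpM2l// mulr_ge0 ?omega_ge0// ltW// divr_gt0.
rewrite -mulrA mulrAC ler_pdivrMr//.
have := @omega_ge0 R m; have := normr_ge0 k; nra.
Qed.

End form_derivative.

(** * Differentiating the primitive of the kernel weight *)

Section primitive_derivative.
Context {R : realType} (m : nat).
Notation mu := (@lebesgue_measure R).
Variables (ghat : R -> R) (dmin dmax : R).
Hypothesis ik : mu.-integrable `]dmin, dmax[ (fun r => (r ^+ m * ghat r)%:E).

Local Notation K := (Kint m ghat dmin dmax).
Local Notation kap := (kap m ghat dmin dmax).

(** On the open interval between [delta] and [h] the weight is within [e] of its value at [delta],
    hence so is its mean. Since that interval omits its ends, the limit is the true value even when
    [delta] is [dmin] or [dmax], where [kap] is 0. *)
Lemma Kquot_cont (delta : R) : delta \in `[dmin, dmax] ->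
  continuous_within dmin dmax ghat delta ->
  forall e : R, 0 < e -> exists2 eta : R, 0 < eta & forall h, h \in `[dmin, dmax] ->
     h != delta -> `|h - delta| < eta ->
     `|Kquot m ghat dmin dmax delta h - delta ^+ m * ghat delta| <= e.
Proof.
rewrite in_itv/= => /andP[d1 d2] gc e e0.
set k := delta ^+ m * ghat delta.
have kc : (h ^+ m * ghat h) @[h --> within `[dmin, dmax]%classic (nbhs delta)] --> k.
  apply: cvgM gc; apply: cvg_within_filter; exact: exprn_continuous.
move/cvgrPdist_le : kc => /(_ _ e0); rewrite near_withinE => /nbhs_ballP[eta /= eta0 H].
exists eta => // h; rewrite in_itv/= => /andP[h1 h2] hd hdeta.
pose a := Num.min delta h; pose b := Num.max delta h.
have ab : b - a = `|h - delta|.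
  rewrite /a /b; have [dh|hd'] := leP delta h; first by rewrite ger0_norm// subr_ge0.
  by rewrite distrC ger0_norm// subr_ge0 ltW.
have ab0 : 0 < b - a by rewrite ab normr_gt0 subr_eq0.
have da : dmin <= a by rewrite le_min d1 h1.
have bd : b <= dmax by rewrite ge_max d2 h2.
have kapk r : r \in `]a, b[ -> `|kap r - k| <= e.
  rewrite in_itv/= => /andP[ar rb].
  have r1 : dmin < r by exact: le_lt_trans ar.
  have r2 : r < dmax by exact: lt_le_trans bd.
  rewrite /kap patchE mem_set/=; last by rewrite in_itv/= r1 r2.
  rewrite distrC; apply: H; last by rewrite /= in_itv/= !ltW.
  rewrite -ball_normE/=; apply: lt_trans hdeta; rewrite -ab.
  have adel : a <= delta by rewrite ge_min lexx.
  have delb : delta <= b by rewrite le_max lexx.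
  by rewrite ltr_norml; apply/andP; split; lra.
have mI : measurable (`]a, b[%classic : set (measurableTypeR R)) by exact: measurable_itv.
have ki : mu.-integrable `]a, b[ (EFin \o kap).
  exact: integrableS (kap_integrable ik).
have muI : mu `]a, b[%classic = (b - a)%:E.
  by rewrite lebesgue_measure_itv/= lte_fin -subr_gt0 ab0 EFinB.
have ci (c : R) : mu.-integrable `]a, b[ (EFin \o cst c).
  apply/integrableP; split; first exact/measurable_EFinP.
  rewrite (eq_integral (cst `|c|%:E))// integral_cst//.
  by rewrite -[X in (_ * X)%E]/(mu `]a, b[%classic) muI -EFinM ltry.
have cE (c : R) : \int[mu]_(r in `]a, b[) c = c * (b - a).
  by rewrite Rintegral_cst// -[X in fine X]/(mu `]a, b[%classic) muI.
have KE : K a b = \int[mu]_(r in `]a, b[) kap r by rewrite Rintegral_itv_bndo_bndc.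
have B : K a b - k * (b - a) = \int[mu]_(r in `]a, b[) (kap r - k).
  by rewrite RintegralB//; [rewrite cE KE|exact: (ci k)].
have iB := integrableB mI ki (ci k).
have le : `|K a b - k * (b - a)| <= e * (b - a).
  rewrite B; apply: (le_trans (le_normr_Rintegral mI iB)); rewrite -cE.
  apply: le_Rintegral => //; [exact: integrable_norm iB|exact: (ci e)].
rewrite /Kquot -/a -/b -ab.
have -> : K a b / (b - a) - k = (K a b - k * (b - a)) / (b - a).
  by field; rewrite gt_eqF.
by rewrite normrM [`|_^-1|]gtr0_norm ?invr_gt0// ler_pdivrMr.
Qed.

(** Lebesgue differentiation of the primitive of [kap] from minus infinity. The two endpoints are
    discarded because the cutoff falsifies the weight there. *)
Lemma Kquot_ae :
  {ae mu, forall delta, delta \in `[dmin, dmax] ->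
  forall e : R, 0 < e -> exists2 eta : R, 0 < eta & forall h, h \in `[dmin, dmax] ->
     h != delta -> `|h - delta| < eta ->
     `|Kquot m ghat dmin dmax delta h - delta ^+ m * ghat delta| <= e}.
Proof.
have ki := kap_integrable ik.
have kiy y : mu.-integrable `]-oo, y] (EFin \o kap).
  by apply: integrableS ki => //; exact: measurable_itv.
have kloc : locally_integrable [set: R] kap.
  exact: open_integrable_locally openT ki.
have D := FTC1Ny kiy kloc.
have ne (c : R) : {ae mu, forall x : R, x <> c}.
  exists [set c]; split.
  - exact: measurable_set1.
  - exact: lebesgue_measure_set1.
  - by move=> x /= h; apply: contrapT => xc; apply: h.
apply: filterS3 D (ne dmin) (ne dmax); first exact: (ae_filter_ringOfSetsType mu).
move=> x [dF F'x] xmin xmax; rewrite in_itv/= => /andP[x1 x2] e e0.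
have {}x1 : dmin < x by rewrite lt_neqAle x1 andbT; apply/eqP => /esym.
have {}x2 : x < dmax by rewrite lt_neqAle x2 andbT; apply/eqP.
pose F (y : R) := \int[mu]_(t in `]-oo, y]) kap t.
have KF a b : a <= b -> K a b = F b - F a.
  move=> ab; rewrite /Kint /F.
  by rewrite -(@Rintegral_itvB R kap -oo%O (BRight b) a (kiy b)).
have kx : kap x = x ^+ m * ghat x.
  by rewrite /kap patchE mem_set//= in_itv/= x1 x2.
have /cvg_ex[l Fl] := dF.
have lk : l = kap x.
  rewrite -F'x derive1E; apply/esym/cvg_lim; [exact: Rhausdorff|exact: Fl].
rewrite lk in Fl; move/cvgrPdist_le : Fl => /(_ _ e0)/nbhs_ballP[eta /= eta0 H].
exists eta => // h _ hx hxe.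
have hx0 : h - x != 0 by rewrite subr_eq0.
have := H (h - x) _ hx0; rewrite -ball_normE/= sub0r normrN => /(_ hxe).
rewrite /GRing.scale/= mulr1 subrK -/(F h) -/(F x) kx distrC.
congr (`|_ - _| <= _); rewrite /Kquot.
have [xh|hx'] := leP x h.
  by rewrite ger0_norm ?subr_ge0// KF// mulrC.
rewrite distrC gtr0_norm ?subr_gt0// KF ?ltW//.
by rewrite -[in LHS](opprB x h) -[in LHS](opprB (F x)) invrN mulrNN mulrC.
Qed.

End primitive_derivative.

(** Applied at every x, including those where the surface integral diverges, so infinite values must
    be covered; k > 0 preserves the sign of infinities. *)
Lemma integral_mscale_gt0 d (T : measurableType d) (R : realType)
    (mu : {measure set T -> \bar R}) (k : {nonneg R}) (f : T -> \bar R) :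
  (0 < k%:num) -> measurable_fun setT f ->
  (\int[mscale k mu]_x f x = k%:num%:E * \int[mu]_x f x)%E.
Proof.
move=> k0 mf; rewrite [in LHS]integralE [in RHS]integralE.
rewrite !ge0_integral_mscale//; last 2 first.
- exact: measurable_funeneg.
- exact: measurable_funepos.
have : (0 <= \int[mu]_x f^\- x)%E by exact: integral_ge0.
have : (0 <= \int[mu]_x f^\+ x)%E by exact: integral_ge0.
case: (\int[mu]_x f^\+ x)%E => [a| |//] _; case: (\int[mu]_x f^\- x)%E => [b| |//] _;
  rewrite ?gt0_muley ?lte_fin//=.
- exact: (congr1 EFin (esym (mulrBr _ _ _))).
- by rewrite !addeNy gt0_muleNy ?lte_fin.
- by rewrite ?addeNy gt0_muleNy ?lte_fin.
Qed.

(** * The derivative as an iterated surface integral *)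

Section surface_integral.
Context {R : realType} (m : nat).
Local Notation n := m.+1.
Notation la := (@lebesgue_rV R n).
Notation sg := (@sph R n).
Variable (ghat : R -> R).
Hypothesis g0 : forall x, 0 <= x -> 0 <= ghat x.
Hypothesis mg : measurable_fun setT (fun z : 'rV[R]_n => ghat (enorm z)).
Variables (u v : 'rV[R]_n -> R).
Hypotheses (Lu : L2 la u) (Lv : L2 la v).
Variable (delta : R).
Hypothesis delta0 : 0 < delta.

Let f (p : 'rV[R]_n * 'rV[R]_n) : R := ghat delta *
  ((u p.1 - u (p.1 + delta *: p.2)) * (v p.1 - v (p.1 + delta *: p.2))).

Let mf : measurable_fun setT f.
Proof.
have mt : measurable_fun setT (fun p : 'rV[R]_n * 'rV[R]_n => p.1 + delta *: p.2).
  apply: measurable_add_pair; first exact: measurable_fst.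
  by apply: measurable_scale_pair => //; exact: measurable_snd.
apply: measurable_funM => //; apply: measurable_funM; apply: measurable_funB.
- exact: measurableT_comp Lu.1 measurable_fst.
- exact: measurableT_comp Lu.1 mt.
- exact: measurableT_comp Lv.1 measurable_fst.
- exact: measurableT_comp Lv.1 mt.
Qed.

Let gd0 : 0 <= ghat delta. Proof. by rewrite g0// ltW. Qed.

(** Integrating in x first, [Hf_norm] bounds the result uniformly in the direction, and the sphere
    has finite mass. *)
Let fi : (la \x sg)%E.-integrable setT (EFin \o f).
Proof.
have mEf : measurable_fun setT (EFin \o f) by exact/measurable_EFinP.
apply/(@integrable21ltyP _ _ _ _ R la sg (EFin \o f) mEf).
pose C := 4 * l2 la u * l2 la v.
have C0 : 0 <= C by rewrite !mulr_ge0 ?l2_ge0.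
apply: (@le_lt_trans _ _ (\int[sg]_s cst (ghat delta * C)%:E s)%E); last first.
  rewrite integral_cst// -[X in (_ * X)%E]/(sg setT) sph_setT.
  by rewrite -EFinM ltry.
apply: ge0_le_integral => //.
- by move=> s _; exact: integral_ge0.
- apply: (@measurable_fun_fubini_tonelli_G _ _ _ _ R la (fun p => `|(f p)%:E|)%E) => //.
  exact: measurableT_comp.
move=> s /=.
rewrite (eq_integral (fun x => (ghat delta *
    `|(u x - u (x + delta *: s)) * (v x - v (x + delta *: s))|)%:E)); last first.
  by move=> x _; rewrite /f /= normrM ger0_norm.
rewrite -EFinZl_ge0_integral//; last first.
  apply: measurableT_comp => //.
  by apply: measurable_funM; [exact: (L2_diff _ Lu).1|exact: (L2_diff _ Lv).1].
by rewrite EFinM lee_wpmul2l ?lee_fin// Hf_norm.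
Qed.

(** The sphere is parametrised by x + delta s, with Jacobian delta^m. For almost every s the vector
    has length 1, so the indicator is 1 and the kernel is the constant ghat(delta). *)
Let inner x : (\int[sphere_measure x delta]_(x' in sphere x delta)
   ((u x - u x') * (v x - v x') * ghat (enorm (x - x')))%:E =
   (delta ^+ m)%:E * \int[sg]_s (f (x, s))%:E)%E.
Proof.
have md : measurable_fun setT (fun x' : 'rV[R]_n => enorm (x - x')).
  exact: measurableT_comp (@measurable_pair_dist R m) (measurable_pair1 x).
have mS : measurable (sphere x delta).
  have := md measurableT `[delta, delta]%classic (measurable_itv _).
  rewrite setTI; congr measurable; apply/seteqP; split => y; rewrite /sphere /= in_itv/=.
    by rewrite -eq_le => /eqP.
  by move=> ->; rewrite lexx.
have mform : measurable_fun setT (fun x' : 'rV[R]_n =>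
    (u x - u x') * (v x - v x') * ghat (enorm (x - x'))).
  exact: measurableT_comp (form_fun_measurable mg Lu Lv) (measurable_pair1 x).
have mI : measurable_fun setT (fun x' : 'rV[R]_n => \1_(sphere x delta) x' *
    ((u x - u x') * (v x - v x') * ghat (enorm (x - x')))).
  by apply: measurable_funM => //; exact: measurable_indic.
have mEI := (measurable_EFinP _ _).2 mI.
rewrite integral_mkindic.
have k0 : 0 < (`|delta| ^+ n.-1)%:nng%:num by rewrite /= exprn_gt0// normr_gt0 gt_eqF.
rewrite [LHS](integral_mscale_gt0 (image_measure unit_sphere_measure
  (measurable_sphere_param x delta)) k0 mEI).
rewrite integral_image; last exact: mEI.
rewrite [X in (X%:E * _)%E](_ : _ = delta ^+ m); last by rewrite /= gtr0_norm.
congr (_ * _)%E.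
rewrite integral_sph; apply: ae_eq_integral => //.
- apply/measurable_EFinP; apply: (measurableT_comp mI).
  exact: measurable_sphere_param.
- by apply/measurable_EFinP; exact: measurableT_comp mf (measurable_pair1 x).
apply: filterS (@sph_ae1 R m) => s s1 _.
have e : enorm (x - (x + delta *: s)) = delta.
  by rewrite opprD addrA subrr sub0r enormN enormZ s1 mulr1 gtr0_norm.
by rewrite /= indicE mem_set// mul1r e /f/= mulrC.
Qed.

(** Fubini: with x integrated first, each direction s contributes H(delta s), and the remaining
    integral over s is the mean [Gf]. *)
Lemma surface_integral :
  \int[la]_x \int[sphere_measure x delta]_(x' in sphere x delta)
    ((u x - u x') * (v x - v x') * ghat (enorm (x - x'))) =
  delta ^+ m * ghat delta * Gf u v delta.
Proof.
have iX := integrable_fubini_F fi.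
have iY := integrableZl measurableT (delta ^+ m) iX.
have Hi := Hf_sph_integrable delta Lu Lv.
have XE : (\int[la]_x fubini_F sg (EFin \o f) x = (ghat delta * Gf u v delta)%:E)%E.
  rewrite [LHS](Fubini fi).
  rewrite (eq_integral (fun s : 'rV[R]_n => ((ghat delta)%:E * (Hf u v (delta *: s))%:E)%E)); last first.
    move=> s _; rewrite /f/=.
    under eq_integral do rewrite EFinM.
    have iz := Hf_integrable (delta *: s) Lu Lv.
    rewrite integralZl//; congr (_ * _)%E.
    by rewrite /Hf /Rintegral fineK//; exact: integrable_fin_num.
  rewrite integralZl// [RHS]EFinM; congr (_ * _)%E.
  by rewrite /Gf /Rintegral fineK//; exact: integrable_fin_num.
transitivity (fine (\int[la]_x ((delta ^+ m)%:E * fubini_F sg (EFin \o f) x))%E); last first.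
  by rewrite integralZl// XE -EFinM mulrA.
congr fine; rewrite /Rintegral; under eq_integral do rewrite inner.
have mY : measurable_fun setT (fun x => ((delta ^+ m)%:E * fubini_F sg (EFin \o f) x)%E).
  by case/integrableP : iY.
apply: ae_eq_integral => //.
  by apply/measurable_EFinP; exact: measurableT_comp mY.
(* The inner integral is finite for almost every x, and there [fine] loses nothing. *)
apply: filterS (integrable_ae measurableT iY) => x /(_ I) Yx _.
by rewrite fineK.
Qed.

End surface_integral.

(** The mean value bound for the k-th power, with b^(k-1) written as b^-1 b^k: this also covers k =
    0 and yields the term (n-1)/delta_2 of the Lipschitz constant. *)
Lemma subrXX_le (R : realFieldType) (a b : R) (k : nat) : 0 <= a -> a <= b -> 0 < b ->
  b ^+ k - a ^+ k <= k%:R * b^-1 * b ^+ k * (b - a).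
Proof.
move=> a0 ab b0; elim: k => [|k IH]; first by rewrite !expr0 subrr !mul0r.
have -> : k.+1%:R * b^-1 * b ^+ k.+1 * (b - a) =
    b * (k%:R * b^-1 * b ^+ k * (b - a)) + b ^+ k * (b - a).
  by rewrite -natr1 exprS; field; rewrite gt_eqF.
have -> : b ^+ k.+1 - a ^+ k.+1 = b * (b ^+ k - a ^+ k) + a ^+ k * (b - a).
  by rewrite !exprS; ring.
apply: lerD; first by rewrite ler_wpM2l// ltW.
by rewrite ler_wpM2r ?subr_ge0// lerXn2r// nnegrE ltW.
Qed.

(** Here [P] is d2^(n-1), [q] is d2 - d1, and [l], [N], [D] are the norms of [u], of [v] and of the
    gradient of [u]. The increment of the weight meets the size of G1, where Poincare turns 4 l into
    4 CP D; the increment of G meets the weight at d2. *)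
Lemma product_increment_le (R : realFieldType) (k1 P g2 G1 G2 c q l N omega CP D : R) :
  0 <= P -> 0 <= g2 -> 0 <= N -> 0 <= omega ->
  `|k1 - P * g2| <= P * c * q -> `|G1| <= 4 * l * N * omega -> l <= CP * D ->
  `|G1 - G2| <= 2 * q * D * N * omega ->
  `|k1 * G1 - P * g2 * G2| <= 2 * omega * P * (2 * CP * c + g2) * D * N * q.
Proof.
move=> P0 g0 N0 o0 k12 G1l lD G12.
have -> : k1 * G1 - P * g2 * G2 = (k1 - P * g2) * G1 + P * g2 * (G1 - G2) by ring.
have -> : 2 * omega * P * (2 * CP * c + g2) * D * N * q =
  P * c * q * (4 * (CP * D) * N * omega) + P * g2 * (2 * q * D * N * omega) by ring.
apply: le_trans (ler_normD _ _) _; apply: lerD; last first.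
  by rewrite normrM ger0_norm ?ler_wpM2l// mulr_ge0.
rewrite normrM ler_pM//; apply: (le_trans G1l).
by rewrite !ler_wpM2r// ler_wpM2l.
Qed.

Theorem theorem3p3 (R : realType) (n : nat) (hn : (0 < n)%N)
  (Omega : set 'rV[R]_n) (hOmega : bounded_lipschitz_domain Omega)
  (dmin dmax : R) (hdmin : 0 < dmin) (hdmax : dmin < dmax)
  (gamma : 'rV[R]_n -> 'rV[R]_n -> R)
  (hgamma_ge0 : forall x x', 0 <= gamma x x')
  (hgamma_sym : forall x x', gamma x x' = gamma x' x)
  (hgamma_meas : measurable_fun [set: 'rV[R]_n * 'rV[R]_n]
                   (fun p => gamma p.1 p.2))
  (ghat : R -> R)
  (hradial : forall x x', gamma x x' = ghat (enorm (x - x')))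
  (hH1 : kernel_H1 gamma dmin dmax)
  (hH2 : kernel_H2 gamma ghat dmin dmax)
  (hH3 : kernel_H3 n ghat dmin dmax)
  (dstar : R) (hdstar : dstar \in `[dmin, dmax])
  (CP : R) (hCP : 0 < CP)
  (hPoincare : forall delta, delta \in `[dmin, dmax] ->
     forall v, Vspace Omega gamma delta v ->
       L2norm Omega v <= CP * Vnorm gamma delta v)
  (hPoincare_H10 : forall v, H10 Omega v ->
     L2norm Omega v <= CP * H10norm Omega v) :
  let V := Vspace Omega gamma dstar in
  let normV := Vnorm gamma dstar in
  let omega := sphere_area n : R in
  exists a' : R -> ('rV[R]_n -> R) -> ('rV[R]_n -> R) -> R,
    [/\ forall delta, delta \in `[dmin, dmax] ->
          bounded_bilinear_on V normV (a' delta),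
        (forall delta, delta \in `[dmin, dmax] ->
           continuous_within dmin dmax ghat delta ->
           forall u v, V u -> V v ->
             has_derivative_within dmin dmax
               (fun d => aform gamma d u v) delta (a' delta u v)) /\
        {ae @lebesgue_measure R, forall delta, delta \in `[dmin, dmax] ->
           forall u v, V u -> V v ->
             has_derivative_within dmin dmax
               (fun d => aform gamma d u v) delta (a' delta u v)},
        forall delta, delta \in `[dmin, dmax] ->
          forall u v, L2_zero Omega u -> L2_zero Omega v ->
            a' delta u v =
              \int[lebesgue_rV n]_x
                \int[sphere_measure x delta]_(x' in sphere x delta)
                  ((u x - u x') * (v x - v x') * gamma x x'),
        forall delta, delta \in `[dmin, dmax] ->
          forall u v, V u -> V v ->
            `|a' delta u v| <=
              (4 * omega * delta ^+ n.-1 * ghat delta)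
                * L2norm Omega u * L2norm Omega v &
        forall Lgamma : R, 0 < Lgamma ->
          (forall d1 d2, d1 \in `[dmin, dmax] -> d2 \in `[dmin, dmax] ->
             `|ghat d1 - ghat d2| <= Lgamma * `|d1 - d2|) ->
          forall d1 d2, d1 \in `[dmin, dmax] -> d2 \in `[dmin, dmax] ->
            d1 < d2 ->
            forall u v, H10 Omega u -> V v ->
              `|a' d1 u v - a' d2 u v| <=
                (2 * omega * d2 ^+ n.-1 *
                   (2 * CP * (n.-1%:R * d2^-1 * ghat d1 + Lgamma) + ghat d2))
                  * H10norm Omega u * L2norm Omega v * `|d1 - d2|].
Proof.
case: n hn Omega hOmega gamma hgamma_ge0 hgamma_sym hgamma_meas ghat hradial
  hH1 hH2 hH3 hPoincare hPoincare_H10 => [//|m] _ Omega hOmega gamma _ _ hgamma_meas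
  ghat hradial _ [g0 _ ik] _ hP hPH V normV omega.
have oOmega : open Omega by case: hOmega.
have mOmega := open_rV_measurable oOmega.
(* Measurability is given for [gamma] on pairs; the slice with second point 0 transfers it to the
   profile. *)
have mg : measurable_fun setT (fun z : 'rV[R]_m.+1 => ghat (enorm z)).
  rewrite (_ : (fun z => _) = fun z => gamma z 0).
    exact: (measurableT_comp hgamma_meas (measurable_pair2 (0 : 'rV[R]_m.+1))).
  by apply/funext => z; rewrite hradial subr0.
have omega0 : 0 <= omega by exact: omega_ge0.
have delta0 delta : delta \in `[dmin, dmax] -> 0 < delta.
  by rewrite in_itv/= => /andP[+ _]; exact: lt_le_trans.
have formE u v p : form_fun ghat u v p = (u p.1 - u p.2) * (v p.1 - v p.2) * gamma p.1 p.2.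
  by rewrite hradial.
have VE u : V u -> finite_energy ghat dstar u.
  move=> [Lu uy]; split; first exact: L2_zero_L2 Lu.
  by under eq_integral do rewrite formE.
have VL u : V u -> L2 (lebesgue_rV m.+1) u by move=> /VE[].
have VN u : V u -> l2 (lebesgue_rV m.+1) u = L2norm Omega u.
  by move=> [Lu _]; rewrite L2norm_zero.
have aE u v : (fun d => aform gamma d u v) = nonlocal_form ghat u v.
  apply/funext => d; apply: eq_Rintegral => p _; exact/esym/formE.
have aG_le delta u v : delta \in `[dmin, dmax] -> V u -> V v ->
    `|delta ^+ m * ghat delta * Gf u v delta| <=
    4 * omega * delta ^+ m * ghat delta * L2norm Omega u * L2norm Omega v.
  move=> /delta0 d0 Vu Vv.
  have k0 : 0 <= delta ^+ m * ghat delta by rewrite mulr_ge0 ?exprn_ge0 ?g0// ltW.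
  rewrite normrM ger0_norm// -!VN//.
  rewrite [leRHS](_ : _ = delta ^+ m * ghat delta *
    (4 * l2 (lebesgue_rV m.+1) u * l2 (lebesgue_rV m.+1) v * omega)); last by ring.
  by rewrite ler_wpM2l// Gf_le//; exact: VL.
exists (fun delta u v => delta ^+ m * ghat delta * Gf u v delta); split.
- move=> delta hdelta; split.
  + move=> c u w v /VL Lu /VL Lw /VL Lv; rewrite Gf_linearl//; ring.
  + move=> c u v w /VL Lu /VL Lv /VL Lw.
    by rewrite !(GfC u) Gf_linearl//; ring.
  (* The constant of the mean-square estimate, with one factor [CP] per argument from Poincare at
     [dstar]. *)
  + exists (4 * omega * delta ^+ m * ghat delta * CP * CP) => u v Vu Vv.
    have d0 := delta0 _ hdelta.
    apply: (le_trans (aG_le _ _ _ hdelta Vu Vv)).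
    have k0 : 0 <= 4 * omega * delta ^+ m * ghat delta.
      by rewrite mulr_ge0 ?g0 ?(ltW d0)// mulr_ge0 ?exprn_ge0 ?(ltW d0)// mulr_ge0.
    have uP := hP _ hdstar _ Vu; have vP := hP _ hdstar _ Vv.
    rewrite [leRHS](_ : _ = 4 * omega * delta ^+ m * ghat delta *
      ((CP * normV u) * (CP * normV v))); last by ring.
    rewrite -mulrA ler_wpM2l// ler_pM//; first by rewrite -VN// l2_ge0.
    by rewrite -VN// l2_ge0.
- split.
  + move=> delta hdelta gc u v Vu Vv; rewrite aE.
    apply: (form_derivative hdmin g0 mg ik hdstar (VE _ Vu) (VE _ Vv) hdelta).
    exact: Kquot_cont.
  + have := Kquot_ae ik; apply: filterS; first exact: (ae_filter_ringOfSetsType lebesgue_measure).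
    move=> delta h hdelta u v Vu Vv; rewrite aE.
    apply: (form_derivative hdmin g0 mg ik hdstar (VE _ Vu) (VE _ Vv) hdelta).
    exact: h.
- move=> delta hdelta u v /L2_zero_L2 Lu /L2_zero_L2 Lv.
  rewrite -(surface_integral g0 mg Lu Lv (delta0 _ hdelta)).
  apply: eq_Rintegral => x _; apply: eq_Rintegral => x' _.
  by rewrite hradial.
- by move=> delta hdelta u v Vu Vv; exact: aG_le.
- move=> L L0 gL d1 d2 hd1 hd2 d12 u v Hu Vv.
  have Lu : L2 (lebesgue_rV m.+1) u by case: Hu => /L2_zero_L2.
  have Lv := VL _ Vv.
  set D := H10norm Omega u.
  have D0 : 0 <= D by rewrite fine_ge0// Lnorm_ge0.
  have uD : l2 (lebesgue_rV m.+1) u <= CP * D.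
    by rewrite -(L2norm_zero mOmega); [exact: hPH|case: Hu].
  have d10 := delta0 _ hd1; have d20 := delta0 _ hd2.
  have Delta : `|d1 - d2| = d2 - d1 by rewrite distrC gtr0_norm// subr_gt0.
  have G1 := Gf_le d1 Lu Lv.
  have G12 := Gf_lipschitz d1 d2 Lu Lv D0 (fun h => H10_shift h oOmega Hu).
  have g1 := g0 _ (ltW d10); have g2 := g0 _ (ltW d20).
  have gd := gL _ _ hd1 hd2.
  rewrite -VN// -/omega in G1 G12 *; rewrite Delta in G12 gd *.
  set q := d2 - d1 in G12 gd *; set N := l2 _ v in G1 G12 *.
  have q0 : 0 <= q by rewrite subr_ge0 ltW.
  have N0 : 0 <= N by exact: l2_ge0.
  have P2 : 0 <= d2 ^+ m by rewrite exprn_ge0// ltW.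
  (* The increment of the power is paired with [ghat d1] and the increment of [ghat] with the larger
     power of d2, as the shape of the constant dictates. *)
  have kk : `|d1 ^+ m * ghat d1 - d2 ^+ m * ghat d2| <=
      d2 ^+ m * (m%:R * d2^-1 * ghat d1 + L) * q.
    have -> : d1 ^+ m * ghat d1 - d2 ^+ m * ghat d2 =
      - ((d2 ^+ m - d1 ^+ m) * ghat d1) + d2 ^+ m * (ghat d1 - ghat d2) by ring.
    rewrite [leRHS](_ : _ = m%:R * d2^-1 * d2 ^+ m * q * ghat d1 + d2 ^+ m * (L * q)); last by ring.
    apply: le_trans (ler_normD _ _) _; apply: lerD.
      rewrite normrN normrM (ger0_norm g1) ler_wpM2r// ger0_norm; last first.
        by rewrite subr_ge0 lerXn2r// ?nnegrE ltW.
      by apply: subrXX_le => //; exact: ltW.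
    by rewrite normrM (ger0_norm P2) ler_wpM2l.
  exact: (product_increment_le P2 g2 N0 omega0 kk G1 uD G12).
Qed.
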